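(* Consider bounded $n\in\mathbb{N}$ and $a=1$. For the sequence $F_n$ defined in the context (where $E_0\neq 2\pm 4t_0$), one has $$F_n\to A\,\mathrm{sn}(z_0+pn;k),\qquad \epsilon\to 0.$$ Here $\mathrm{sn}(z;k)$ is Jacobi's elliptic sine function of argument $z$ and modulus $k$. Furthermore, $A^2=k$, and $k$ satisfying $0<|k|<1$ is uniquely determined by $$k^2+\beta k+1=0,\qquad \beta:=\frac{4+4\gamma^2-\zeta^2}{4\gamma},$$ with $\gamma,\zeta$ the constants defined in the context. Finally, $p$ is chosen such that $k\,\mathrm{sn}^2(p;k)=-1/\gamma$, and $z_0$ is representative of the initial condition $f_0$, satisfying $A\,\mathrm{sn}(z_0;k)=F_0$.
   Context: Let $\mathbb{C}^*=\mathbb{C}\setminus\{0\}$ and $\mathbb{N}=\{0,1,2,\dots\}$. Given $a,f_0,f_1,t_0,\epsilon\in\mathbb{C}^*$ with $|\epsilon|<1$, put $t_n=t_0(1+\epsilon)^n$ and let the sequence $f:\mathbb{N}\to\mathbb{C}$, with initial values $f_0,f_1$, be defined by the $q$-difference second Painlevé equation (with $q=1+\epsilon$) $$f_{n+1}f_{n-1}=\frac{a(1+f_nt_n)}{f_n(f_n+t_n)}.$$ Define $$E_n=\frac{f_{n+1}^2f_n^2+t_0f_{n+1}f_n(f_{n+1}+f_n)+at_0(f_{n+1}+f_n)+a}{f_{n+1}f_n}.$$ Assume $E_0\neq 2\pm4t_0$ and define the sequence $F:\mathbb{N}\to\mathbb{C}$ by $$f_n=\frac{c+F_n}{c-F_n},\qquad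 c\in\mathbb{C}^*\ \text{such that}\ c^4=\frac{2-E_0-4t_0}{2-E_0+4t_0}.$$ Set $$\gamma=\frac{(2+E_0)c^2}{2-E_0-4t_0},\qquad \zeta=\frac{8c^2}{2-E_0-4t_0}.$$ Standing assumption: $f_n$ is studied in a domain where it remains bounded and sufficiently away from zero, and $F_n$ is finite.
   Formalization: It is assumed that γ≠0 (β and −1/γ divide by γ) and that β is not a real number in [−2,2]; otherwise both roots of k²+βk+1=0 have modulus 1 and no k with 0<|k|<1 exists (e.g. t_0=1, f_0=1, E_0=−5). *)

(* Defs.v *)
From Stdlib Require Export Reals.
From Coquelicot Require Export Coquelicot.

Open Scope C_scope.

(** * Jacobi's elliptic sine with complex modulus *)

Definition is_C_derive (g : C -> C) (z l : C) : Prop :=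
  @is_derive C_AbsRing C_NormedModule g z l.

(* An isolated singularity at which |g| tends to infinity.  The value that the
   total function [g] takes at such a point carries no information. *)
Definition is_pole (g : C -> C) (z : C) : Prop :=
  locally' z (fun w => exists l, is_C_derive g w l) /\
  filterlim (fun w => Cmod (g w)) (locally' z) (Rbar_locally p_infty).

Definition meromorphic (g : C -> C) : Prop :=
  forall z, (exists l, is_C_derive g z l) \/ is_pole g z.

(* sn(.;k) inverts the elliptic integral of dw / sqrt((1-w^2)(1-k^2w^2)) from 0;
   equivalently it is the only meromorphic function on C that solves this
   initial value problem.  It is determined up to its values at the poles. *)
Record is_jacobi_sn (k : C) (sn : C -> C) : Prop := {
  jacobi_sn_meromorphic : meromorphic sn;
  jacobi_sn_0 : sn 0 = 0;
  jacobi_sn_derive_0 : is_C_derive sn 0 1;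
  jacobi_sn_ode : forall z l, is_C_derive sn z l ->
    l ^ 2 = (1 - sn z ^ 2) * (1 - k ^ 2 * sn z ^ 2)
}.

(** * The q-difference second Painleve equation, q = 1 + eps *)

Definition qP2_t (t0 eps : C) (n : nat) : C := t0 * (1 + eps) ^ n.

Fixpoint qP2_f (a t0 f0 f1 eps : C) (n : nat) : C :=
  match n with
  | O => f0
  | S m =>
    match m with
    | O => f1
    | S l =>
      let y := qP2_f a t0 f0 f1 eps m in
      let t := qP2_t t0 eps m in
      a * (1 + y * t) / (y * (y + t)) / qP2_f a t0 f0 f1 eps l
    end
  end.

(* E_n is [qP2_E a t0 f_n f_(n+1)]: it involves t_0, not t_n. *)
Definition qP2_E (a t0 x y : C) : C :=
  (y ^ 2 * x ^ 2 + t0 * y * x * (y + x) + a * t0 * (y + x) + a) / (y * x).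

(* The F such that x = (c + F) / (c - F); see [cayley_F_spec]. *)
Definition cayley_F (c x : C) : C := c * (x - 1) / (x + 1).

Lemma cayley_F_spec (c x F : C) : c <> 0 -> x <> - (1) ->
  (c - F <> 0 /\ x = (c + F) / (c - F)) <-> F = cayley_F c x.
Proof.
intros hc hx.
assert (hx1 : x + 1 <> 0).
{ intro h. apply hx. replace x with (x + 1 - 1) by ring. rewrite h. ring. }
assert (h2 : (2 : C) <> 0).
{ intro h. apply (f_equal fst) in h. simpl in h. revert h. apply not_0_IZR. discriminate. }
unfold cayley_F. split.
- intros [hd ->].
  assert (e : (c + F) / (c - F) + 1 = 2 * c / (c - F)) by (field; exact hd).
  rewrite e. field. repeat split; assumption.
- intros ->.
  assert (e : c - c * (x - 1) / (x + 1) = 2 * c / (x + 1)) by (field; exact hx1).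
  assert (hd : 2 * c / (x + 1) <> 0).
  { intro h. apply hc.
    replace c with (2 * c / (x + 1) * (x + 1) / 2) by (field; exact hx1).
    rewrite h. unfold Cdiv. ring. }
  rewrite e. split; [exact hd|]. field. repeat split; assumption.
Qed.

(* For n <= N and as eps -> 0, f_n remains bounded and bounded away from zero,
   and F_n is finite (f_n = -1 corresponds to F_n = infinity). *)
Definition qP2_admissible (a t0 f0 f1 : C) (N : nat) : Prop :=
  exists m M r : R, (0 < m)%R /\ (0 < r <= 1)%R /\
    forall (eps : C) (n : nat), eps <> 0 -> (Cmod eps < r)%R -> (n <= N)%nat ->
      (m <= Cmod (qP2_f a t0 f0 f1 eps n) <= M)%R /\
      qP2_f a t0 f0 f1 eps n <> - (1).

Definition qP2_gamma (E0 t0 c : C) : C := (2 + E0) * c ^ 2 / (2 - E0 - 4 * t0).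

Definition qP2_zeta (E0 t0 c : C) : C := 8 * c ^ 2 / (2 - E0 - 4 * t0).

Definition qP2_beta (gamma zeta : C) : C :=
  (4 + 4 * gamma ^ 2 - zeta ^ 2) / (4 * gamma).

(* As eps -> 0 (eps <> 0), [G eps] tends to A * sn w in the Riemann sphere. *)
Definition tends_to_sn (G : C -> C) (A : C) (sn : C -> C) (w : C) : Prop :=
  (~ is_pole sn w -> filterlim G (locally' (0 : C)) (locally (A * sn w))) /\
  (is_pole sn w ->
   filterlim (fun eps => Cmod (G eps)) (locally' (0 : C)) (Rbar_locally p_infty)).

(* Main.v *)
Require Import Defs.
From Stdlib Require Import Lra Lia Psatz Classical IndefiniteDescription.

(* As [eps -> 0] the sequence tends to an orbit of an autonomous map that preserves [E_n].  In the
   variable [F] the level set is the symmetric biquadratic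
   [X^2 Y^2 + gamma (X^2 + Y^2) + zeta X Y + 1 = 0], which Euler's addition theorem parametrizes
   by [X = A sn z], [Y = A sn (z + p)]; the map is [z |-> z + p].

   All properties of sn come from its definition as a meromorphic solution of the first-order
   ODE, without Cauchy's theory.  Darboux's theorem on segments makes sn' continuous, so sn is
   twice differentiable where sn' does not vanish.  The zeros of sn' are isolated, because the
   constants are excluded by connectedness, and this yields the second-order ODE everywhere.  The
   three addition formulas then hold because their defects solve a linear system and vanish at 0.
   Surjectivity follows from a minimization argument.

   The orbit may go through poles of sn.  This is handled by moving the initial point [z0] to a
   generic point nearby, where all identities hold between finite numbers, and passing to the
   limit. *)

Notation near z := (@locally C_UniformSpace z).
Notation near' z := (@locally' C_UniformSpace z).

Lemma near_iff (z : C) (Q : C -> Prop) :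
  near z Q <-> exists d : R, (0 < d)%R /\ forall v, (Cmod (v - z) < d)%R -> Q v.
Proof.
rewrite (locally_C z Q). split.
- intros [d hd]. exists d. split; [apply cond_pos|]. intros v hv. apply hd. exact hv.
- intros [d [h0 hd]]. exists (mkposreal d h0). intros v hv. apply hd. exact hv.
Qed.

Lemma near'_iff (z : C) (Q : C -> Prop) :
  near' z Q <-> exists d : R, (0 < d)%R /\
    forall v, v <> z -> (Cmod (v - z) < d)%R -> Q v.
Proof.
unfold locally', within. rewrite near_iff.
split; intros [d [h0 hd]]; exists d; split; auto.
Qed.

Lemma near_near' (z : C) (Q : C -> Prop) : near z Q -> near' z Q.
Proof. rewrite near_iff, near'_iff. intros [d [h0 hd]]. exists d. auto. Qed.

Lemma near_of_near' (z : C) (Q : C -> Prop) : near' z Q -> Q z -> near z Q.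
Proof.
rewrite near_iff, near'_iff. intros [d [h0 hd]] hz. exists d. split; [exact h0|].
intros v hv. destruct (classic (v = z)) as [-> |hn]; auto.
Qed.

Lemma near_self (z : C) (Q : C -> Prop) : near z Q -> Q z.
Proof. apply locally_singleton. Qed.

Lemma near_near (z : C) (Q : C -> Prop) : near z Q -> near z (fun v => near v Q).
Proof. apply (locally_locally z). Qed.

Lemma near_shift (z d : C) (Q : C -> Prop) :
  near (z + d) Q -> near z (fun v => Q (v + d)).
Proof.
rewrite !near_iff. intros [e [h0 he]]. exists e. split; [exact h0|]. intros v hv.
apply he. replace (v + d - (z + d)) with (v - z) by ring. exact hv.
Qed.

Lemma near'_shift (z d : C) (Q : C -> Prop) :
  near' (z + d) Q -> near' z (fun v => Q (v + d)).
Proof.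
rewrite !near'_iff. intros [e [h0 he]]. exists e. split; [exact h0|]. intros v hv hvd.
apply he.
- intro h. apply hv. replace v with (v + d - d) by ring. rewrite h. ring.
- replace (v + d - (z + d)) with (v - z) by ring. exact hvd.
Qed.

Lemma near'_reflect (a z : C) (Q : C -> Prop) :
  near' (a - z) Q -> near' z (fun v => Q (a - v)).
Proof.
rewrite !near'_iff. intros [e [h0 he]]. exists e. split; [exact h0|]. intros v hv hvd.
apply he.
- intro h. apply hv. replace v with (a - (a - v)) by ring. rewrite h. ring.
- replace (a - v - (a - z)) with (- (v - z)) by ring. rewrite Cmod_opp. exact hvd.
Qed.

Lemma C_sub_neq0 (x y : C) : x <> y -> x - y <> 0.
Proof. intros h e. apply h. replace x with (x - y + y) by ring. rewrite e. ring. Qed.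

Lemma C_sub_eq0 (x y : C) : x - y = 0 -> x = y.
Proof. intro e. replace x with (x - y + y) by ring. rewrite e. ring. Qed.

Lemma Cmult_integral (x y : C) : x * y = 0 -> x = 0 \/ y = 0.
Proof.
intro h. destruct (classic (x = 0)) as [e|e]; [now left|].
destruct (classic (y = 0)) as [e'|e']; [now right|].
exfalso. exact (Cmult_neq_0 _ _ e e' h).
Qed.

Lemma Csqr_eq (x y : C) : x ^ 2 = y ^ 2 -> x = y \/ x = - y.
Proof.
intro h. assert (h2 : (x - y) * (x + y) = 0).
{ replace ((x - y) * (x + y)) with (x ^ 2 - y ^ 2) by ring. rewrite h. ring. }
destruct (Cmult_integral _ _ h2) as [h3|h3].
- left. apply C_sub_eq0. exact h3.
- right. apply C_sub_eq0. replace (x - - y) with (x + y) by ring. exact h3.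
Qed.

Lemma C2_neq0 : (2 : C) <> 0.
Proof. intro h. apply RtoC_inj in h. lra. Qed.

Global Instance near'_proper (z : C) : ProperFilter (near' z).
Proof.
split; [|apply locally'_filter].
intros Q hQ. apply near'_iff in hQ. destruct hQ as [d [h0 hd]].
exists (z + RtoC (d / 2)). apply hd.
- intro h. assert (h1 : RtoC (d / 2) = 0).
  { replace (RtoC (d / 2)) with (z + RtoC (d / 2) - z) by ring. rewrite h. ring. }
  apply RtoC_inj in h1. lra.
- replace (z + RtoC (d / 2) - z) with (RtoC (d / 2)) by ring.
  rewrite Cmod_R, Rabs_pos_eq; lra.
Qed.

(** * Limits of complex functions along a filter *)

Definition Clim {T : Type} (F : (T -> Prop) -> Prop) (g : T -> C) (l : C) : Prop :=
  forall e : R, (0 < e)%R -> F (fun v => (Cmod (g v - l) < e)%R).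

Lemma Clim_filterlim {T : Type} (F : (T -> Prop) -> Prop) {FF : Filter F} (g : T -> C) l :
  Clim F g l <-> filterlim g F (near l).
Proof.
split.
- intros h Q hQ. apply near_iff in hQ. destruct hQ as [d [h0 hd]].
  generalize (h d h0). unfold filtermap. apply filter_imp. intros v. apply hd.
- intros h e he. apply (h (fun v => (Cmod (v - l) < e)%R)). apply near_iff. exists e. auto.
Qed.

Section Limits.
Context {T : Type} {F : (T -> Prop) -> Prop} {FF : Filter F}.

Lemma Clim_const (a : C) : Clim F (fun _ => a) a.
Proof.
intros e he. apply filter_forall. intros _. replace (a - a) with (0 : C) by ring.
rewrite Cmod_0. exact he.
Qed.

Lemma Clim_ext_near (g h : T -> C) (l : C) :
  F (fun v => g v = h v) -> Clim F g l -> Clim F h l.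
Proof.
intros hE hg e he. generalize (filter_and _ _ hE (hg e he)). apply filter_imp.
intros v [-> hv]. exact hv.
Qed.

Lemma Clim_plus (g h : T -> C) (l m : C) :
  Clim F g l -> Clim F h m -> Clim F (fun v => g v + h v) (l + m).
Proof.
intros hg hh e he. assert (h2 : (0 < e / 2)%R) by lra.
generalize (filter_and _ _ (hg _ h2) (hh _ h2)). apply filter_imp. intros v [h3 h4].
replace (g v + h v - (l + m)) with ((g v - l) + (h v - m)) by ring.
eapply Rle_lt_trans; [apply Cmod_triangle|]. lra.
Qed.

Lemma Clim_bounded (g : T -> C) (l : C) :
  Clim F g l -> F (fun v => (Cmod (g v) < Cmod l + 1)%R).
Proof.
intros hg. generalize (hg 1%R Rlt_0_1). apply filter_imp. intros v hv.
replace (g v) with ((g v - l) + l) by ring.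
eapply Rle_lt_trans; [apply Cmod_triangle|]. lra.
Qed.

Lemma Clim_mult_0 (g h : T -> C) (M : R) :
  Clim F g 0 -> F (fun v => (Cmod (h v) <= M)%R) -> Clim F (fun v => g v * h v) 0.
Proof.
intros hg hh e he.
assert (hM : (0 < e / (Rabs M + 1))%R).
{ apply Rdiv_lt_0_compat; [exact he|]. pose proof (Rabs_pos M). lra. }
generalize (filter_and _ _ (hg _ hM) hh). apply filter_imp. intros v [h1 h2].
replace (g v * h v - 0) with (g v * h v) by ring. rewrite Cmod_mult.
replace (g v - 0) with (g v) in h1 by ring.
pose proof (Cmod_ge_0 (g v)). pose proof (Cmod_ge_0 (h v)). pose proof (Rle_abs M).
pose proof (Rabs_pos M).
assert (h6 : (Cmod (g v) * (Rabs M + 1) < e)%R).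
{ replace e with (e / (Rabs M + 1) * (Rabs M + 1))%R by (field; lra).
  apply Rmult_lt_compat_r; lra. }
nra.
Qed.

Lemma Clim_mult (g h : T -> C) (l m : C) :
  Clim F g l -> Clim F h m -> Clim F (fun v => g v * h v) (l * m).
Proof.
intros hg hh.
assert (hg0 : Clim F (fun v => g v - l) 0).
{ intros e he. generalize (hg e he). apply filter_imp. intros v hv.
  replace (g v - l - 0) with (g v - l) by ring. exact hv. }
assert (hh0 : Clim F (fun v => (h v - m) * l) 0).
{ apply Clim_mult_0 with (Cmod l).
  - intros e he. generalize (hh e he). apply filter_imp. intros v hv.
    replace (h v - m - 0) with (h v - m) by ring. exact hv.
  - apply filter_forall. intros _. apply Rle_refl. }
assert (h1 : Clim F (fun v => (g v - l) * h v) 0).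
{ apply Clim_mult_0 with (Cmod m + 1)%R; [exact hg0|].
  generalize (Clim_bounded _ _ hh). apply filter_imp. intros v hv. lra. }
generalize (Clim_plus _ _ _ _ (Clim_plus _ _ _ _ h1 hh0) (Clim_const (l * m))).
replace (0 + 0 + l * m) with (l * m) by ring.
apply Clim_ext_near. apply filter_forall. intros v. ring.
Qed.

Lemma Clim_opp (g : T -> C) (l : C) : Clim F g l -> Clim F (fun v => - g v) (- l).
Proof.
intros hg e he. generalize (hg e he). apply filter_imp. intros v hv.
replace (- g v - - l) with (- (g v - l)) by ring. rewrite Cmod_opp. exact hv.
Qed.

Lemma Clim_minus (g h : T -> C) (l m : C) :
  Clim F g l -> Clim F h m -> Clim F (fun v => g v - h v) (l - m).
Proof. intros hg hh. apply Clim_plus; [exact hg|]. apply Clim_opp. exact hh. Qed.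

Lemma Clim_pow (g : T -> C) (l : C) (n : nat) :
  Clim F g l -> Clim F (fun v => g v ^ n) (l ^ n).
Proof.
intro hg. induction n as [|n IH]; simpl; [apply Clim_const|]. apply Clim_mult; assumption.
Qed.

Lemma Clim_away_from_0 (g : T -> C) (l : C) :
  Clim F g l -> l <> 0 -> F (fun v => (Cmod l / 2 < Cmod (g v))%R).
Proof.
intros hg hl. assert (h0 : (0 < Cmod l)%R) by (apply Cmod_gt_0; exact hl).
assert (h1 : (0 < Cmod l / 2)%R) by lra.
generalize (hg _ h1). apply filter_imp. intros v hv.
assert (h2 : (Cmod l <= Cmod (g v) + Cmod (g v - l))%R).
{ replace l with (g v + - (g v - l)) at 1 by ring.
  eapply Rle_trans; [apply Cmod_triangle|]. rewrite Cmod_opp. lra. }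
lra.
Qed.

Lemma Clim_neq (g : T -> C) (l a : C) : Clim F g l -> l <> a -> F (fun v => g v <> a).
Proof.
intros hg hl.
generalize (Clim_away_from_0 _ _ (Clim_minus _ _ _ _ hg (Clim_const a)) (C_sub_neq0 _ _ hl)).
apply filter_imp. intros v hv e. rewrite e in hv.
replace (a - a) with (0 : C) in hv by ring. rewrite Cmod_0 in hv.
pose proof (Cmod_ge_0 (l - a)). lra.
Qed.

Lemma Clim_inv (g : T -> C) (l : C) : Clim F g l -> l <> 0 -> Clim F (fun v => / g v) (/ l).
Proof.
intros hg hl. assert (h0 : (0 < Cmod l)%R) by (apply Cmod_gt_0; exact hl).
assert (h1 : Clim F (fun v => (g v - l) * (- / (g v * l))) 0).
{ apply Clim_mult_0 with (2 / (Cmod l * Cmod l))%R.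
  - generalize (Clim_minus _ _ _ _ hg (Clim_const l)). replace (l - l) with (0 : C) by ring.
    trivial.
  - generalize (Clim_away_from_0 _ _ hg hl). apply filter_imp. intros v hv.
    assert (hgv : g v <> 0) by (apply Cmod_gt_0; lra).
    rewrite Cmod_opp, Cmod_inv, Cmod_mult by (apply Cmult_neq_0; assumption).
    replace (2 / (Cmod l * Cmod l))%R with (/ (Cmod l / 2 * Cmod l))%R by (field; lra).
    apply Rinv_le_contravar; nra. }
generalize (Clim_plus _ _ _ _ h1 (Clim_const (/ l))). replace (0 + / l) with (/ l) by ring.
apply Clim_ext_near. generalize (Clim_neq _ _ _ hg hl). apply filter_imp.
intros v hv. field. split; assumption.
Qed.

Lemma Clim_div (g h : T -> C) (l m : C) :
  Clim F g l -> Clim F h m -> m <> 0 -> Clim F (fun v => g v / h v) (l / m).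
Proof. intros hg hh hm. apply Clim_mult; [exact hg|]. apply Clim_inv; assumption. Qed.

End Limits.

Section ProperLimits.
Context {T : Type} {F : (T -> Prop) -> Prop} {FF : ProperFilter F}.

Lemma Clim_unique (g : T -> C) (l m : C) : Clim F g l -> Clim F g m -> l = m.
Proof.
intros hl hm. apply NNPP. intro hn.
assert (h0 : (0 < Cmod (l - m) / 2)%R).
{ assert (0 < Cmod (l - m))%R by (apply Cmod_gt_0; apply C_sub_neq0; exact hn). lra. }
destruct (filter_ex _ (filter_and _ _ (hl _ h0) (hm _ h0))) as [v [h1 h2]].
assert (h3 : (Cmod (l - m) <= Cmod (g v - l) + Cmod (g v - m))%R).
{ replace (l - m) with (- (g v - l) + (g v - m)) by ring.
  eapply Rle_trans; [apply Cmod_triangle|]. rewrite Cmod_opp. lra. }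
lra.
Qed.

Lemma Clim_not_infty (g : T -> C) (l : C) :
  Clim F g l -> ~ filterlim (fun v => Cmod (g v)) F (Rbar_locally p_infty).
Proof.
intros hg hi.
assert (h1 : F (fun v => (Cmod l + 1 < Cmod (g v))%R)).
{ apply (hi (fun x => (Cmod l + 1 < x)%R)). exists (Cmod l + 1)%R. auto. }
destruct (filter_ex _ (filter_and _ _ (Clim_bounded _ _ hg) h1)) as [v [h2 h3]]. lra.
Qed.

End ProperLimits.

Lemma Clim_id (z : C) : Clim (near z) (fun v => v) z.
Proof. intros e he. apply near_iff. exists e. auto. Qed.

Lemma Clim_near' (g : C -> C) (z l : C) : Clim (near z) g l -> Clim (near' z) g l.
Proof. intros h e he. apply near_near'. exact (h e he). Qed.

Lemma Clim_near'_near (g : C -> C) (z : C) : Clim (near' z) g (g z) -> Clim (near z) g (g z).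
Proof.
intros h e he. apply near_of_near'; [exact (h e he)|].
replace (g z - g z) with (0 : C) by ring. rewrite Cmod_0. exact he.
Qed.

(** * Complex derivatives *)

Lemma is_C_derive_Clim (g : C -> C) (z l : C) :
  is_C_derive g z l <-> Clim (near' z) (fun v => (g v - g z) / (v - z)) l.
Proof.
split.
- intros [_ h] e he.
  assert (hz : is_filter_lim (@locally (AbsRing_UniformSpace C_AbsRing) z) z) by (intros Q hQ; exact hQ).
  assert (he2 : (0 < e / 2)%R) by lra.
  specialize (h z hz (mkposreal _ he2)). apply locally_C in h. unfold locally', within.
  revert h. apply filter_imp. intros v hv hvz.
  unfold minus, plus, opp, scal, norm in hv. simpl in hv.
  change (Cmod (g v + - g z + - ((v + - z) * l)) <= e / 2 * Cmod (v + - z))%R in hv.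
  assert (h1 : v - z <> 0) by (apply C_sub_neq0; exact hvz).
  assert (h2 : (0 < Cmod (v - z))%R) by (apply Cmod_gt_0; exact h1).
  replace ((g v - g z) / (v - z) - l) with ((g v + - g z + - ((v + - z) * l)) / (v - z))
    by (field; exact h1).
  rewrite Cmod_div by exact h1.
  apply Rle_lt_trans with (e / 2 * Cmod (v - z) / Cmod (v - z))%R.
  + apply Rmult_le_compat_r; [|exact hv]. left. apply Rinv_0_lt_compat. exact h2.
  + field_simplify; lra.
- intros h. split; [apply is_linear_scal_l|]. intros y hy.
  assert (e : z = y).
  { apply (@is_filter_lim_locally_unique C_AbsRing (AbsRing_NormedModule C_AbsRing)).
    exact hy. }
  subst y. intros [e he]. apply locally_C. generalize (h e he). unfold locally', within.
  apply filter_imp. intros v hv.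
  unfold minus, plus, opp, scal, norm. simpl.
  change (Cmod (g v + - g z + - ((v + - z) * l)) <= e * Cmod (v + - z))%R.
  destruct (classic (v = z)) as [-> |hvz].
  + replace (g z + - g z + - ((z + - z) * l)) with (0 : C) by ring. rewrite Cmod_0.
    replace (z + - z) with (0 : C) by ring. rewrite Cmod_0. lra.
  + assert (h1 : v - z <> 0) by (apply C_sub_neq0; exact hvz).
    replace (g v + - g z + - ((v + - z) * l)) with (((g v - g z) / (v - z) - l) * (v - z))
      by (field; exact h1).
    rewrite Cmod_mult. apply Rmult_le_compat_r; [apply Cmod_ge_0|]. left. exact (hv hvz).
Qed.

Lemma is_C_derive_ext_near (g h : C -> C) (z l : C) :
  near z (fun v => g v = h v) -> is_C_derive g z l -> is_C_derive h z l.
Proof.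
rewrite !is_C_derive_Clim. intros hE. apply Clim_ext_near.
rewrite (near_self _ _ hE). apply near_near'. revert hE. apply filter_imp. now intros v ->.
Qed.

Lemma is_C_derive_continuous (g : C -> C) (z l : C) :
  is_C_derive g z l -> Clim (near z) g (g z).
Proof.
rewrite is_C_derive_Clim. intros h. apply Clim_near'_near.
assert (h0 : Clim (near' z) (fun v => v - z) 0).
{ generalize (Clim_minus _ _ _ _ (Clim_near' _ _ _ (Clim_id z)) (Clim_const z)).
  now replace (z - z) with (0 : C) by ring. }
generalize (Clim_plus _ _ _ _ (Clim_mult _ _ _ _ h h0) (Clim_const (g z))).
replace (l * 0 + g z) with (g z) by ring. apply Clim_ext_near.
apply near'_iff. exists 1%R. split; [lra|]. intros v hv _. field. now apply C_sub_neq0.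
Qed.

Lemma is_C_derive_const (a z : C) : is_C_derive (fun _ => a) z 0.
Proof.
apply is_C_derive_Clim. apply Clim_ext_near with (fun _ => 0); [|apply Clim_const].
apply filter_forall. intros v. unfold Cdiv. ring.
Qed.

Lemma is_C_derive_id (z : C) : is_C_derive (fun v => v) z 1.
Proof.
apply is_C_derive_Clim. apply Clim_ext_near with (fun _ => 1); [|apply Clim_const].
apply near'_iff. exists 1%R. split; [lra|]. intros v hv _. field. now apply C_sub_neq0.
Qed.

Lemma is_C_derive_plus (g h : C -> C) (z l m : C) :
  is_C_derive g z l -> is_C_derive h z m -> is_C_derive (fun v => g v + h v) z (l + m).
Proof.
rewrite !is_C_derive_Clim. intros hg hh.
generalize (Clim_plus _ _ _ _ hg hh). apply Clim_ext_near.
apply filter_forall. intros v. unfold Cdiv. ring.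
Qed.

Lemma is_C_derive_mult (g h : C -> C) (z l m : C) :
  is_C_derive g z l -> is_C_derive h z m ->
  is_C_derive (fun v => g v * h v) z (l * h z + g z * m).
Proof.
intros hg hh. pose proof (Clim_near' _ _ _ (is_C_derive_continuous _ _ _ hh)) as hc.
revert hg hh. rewrite !is_C_derive_Clim. intros hg hh.
generalize (Clim_plus _ _ _ _ (Clim_mult _ _ _ _ hg hc)
                              (Clim_mult _ _ _ _ (Clim_const (g z)) hh)).
apply Clim_ext_near. apply filter_forall. intros v. unfold Cdiv. ring.
Qed.

Lemma is_C_derive_opp (g : C -> C) (z l : C) :
  is_C_derive g z l -> is_C_derive (fun v => - g v) z (- l).
Proof.
rewrite !is_C_derive_Clim. intros hg. generalize (Clim_opp _ _ hg). apply Clim_ext_near.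
apply filter_forall. intros v. unfold Cdiv. ring.
Qed.

Lemma is_C_derive_minus (g h : C -> C) (z l m : C) :
  is_C_derive g z l -> is_C_derive h z m -> is_C_derive (fun v => g v - h v) z (l - m).
Proof. intros hg hh. apply is_C_derive_plus; [exact hg|]. now apply is_C_derive_opp. Qed.

Lemma is_C_derive_sqr (g : C -> C) (z l : C) :
  is_C_derive g z l -> is_C_derive (fun v => g v ^ 2) z (2 * g z * l).
Proof.
intro h. generalize (is_C_derive_mult _ _ _ _ _ h h).
replace (l * g z + g z * l) with (2 * g z * l) by ring.
apply is_C_derive_ext_near. apply filter_forall. intros v. ring.
Qed.

Lemma is_C_derive_shift (g : C -> C) (z d l : C) :
  is_C_derive g (z + d) l -> is_C_derive (fun v => g (v + d)) z l.
Proof.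
rewrite !is_C_derive_Clim. intros hg e he. generalize (near'_shift _ _ _ (hg e he)).
apply filter_imp. intros v. replace (v + d - (z + d)) with (v - z) by ring. trivial.
Qed.

Lemma is_C_derive_reflect (g : C -> C) (a z l : C) :
  is_C_derive g (a - z) l -> is_C_derive (fun v => g (a - v)) z (- l).
Proof.
intro hg. rewrite is_C_derive_Clim in hg. apply is_C_derive_Clim.
assert (h : Clim (near' z) (fun v => (g (a - v) - g (a - z)) / (a - v - (a - z))) l).
{ intros e he. exact (near'_reflect _ _ _ (hg e he)). }
generalize (Clim_opp _ _ h). apply Clim_ext_near.
apply near'_iff. exists 1%R. split; [lra|]. intros v hv _.
assert (h1 : v - z <> 0) by now apply C_sub_neq0.
replace (a - v - (a - z)) with (- (v - z)) by ring. field. exact h1.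
Qed.

(* [h(v)^2 - h(z)^2 = (h(v) - h(z)) (h(v) + h(z))] *)
Lemma is_C_derive_of_sqr (h : C -> C) (z d : C) :
  Clim (near z) h (h z) -> h z <> 0 -> is_C_derive (fun v => h v ^ 2) z d ->
  is_C_derive h z (d / (2 * h z)).
Proof.
intros hc h0 hd. rewrite is_C_derive_Clim in hd. apply is_C_derive_Clim.
assert (h1 : Clim (near' z) (fun v => h v + h z) (2 * h z)).
{ replace (2 * h z) with (h z + h z) by ring.
  apply Clim_plus; [now apply Clim_near'|apply Clim_const]. }
assert (h2 : 2 * h z <> 0) by (apply Cmult_neq_0; [apply C2_neq0|exact h0]).
generalize (Clim_div _ _ _ _ hd h1 h2). apply Clim_ext_near.
generalize (filter_and _ _ (Clim_neq _ _ _ h1 h2)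
  (proj2 (near'_iff z (fun v => v <> z)) (ex_intro _ 1%R (conj Rlt_0_1 (fun v hv _ => hv))))).
apply filter_imp. intros v [h3 h4]. field. split; [now apply C_sub_neq0|exact h3].
Qed.

Lemma Clim_near_shift (g : C -> C) (z d l : C) :
  Clim (near (z + d)) g l -> Clim (near z) (fun v => g (v + d)) l.
Proof. intros h e he. exact (near_shift z d (fun u => (Cmod (g u - l) < e)%R) (h e he)). Qed.

Lemma Clim_near'_shift (g : C -> C) (z d l : C) :
  Clim (near' (z + d)) g l -> Clim (near' z) (fun v => g (v + d)) l.
Proof. intros h e he. exact (near'_shift z d (fun u => (Cmod (g u - l) < e)%R) (h e he)). Qed.

(** * Segments *)

Definition seg (a b : C) (t : R) : C := a + RtoC t * (b - a).

Lemma seg_0 (a b : C) : seg a b 0 = a.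
Proof. unfold seg. ring. Qed.

Lemma seg_1 (a b : C) : seg a b 1 = b.
Proof. unfold seg. ring. Qed.

Lemma seg_sub (a b : C) (s t : R) : seg a b s - seg a b t = RtoC (s - t) * (b - a).
Proof. unfold seg. rewrite RtoC_minus. ring. Qed.

Lemma seg_ball (z a b : C) (r t : R) :
  (Cmod (a - z) < r)%R -> (Cmod (b - z) < r)%R -> (0 <= t <= 1)%R ->
  (Cmod (seg a b t - z) < r)%R.
Proof.
intros ha hb ht.
replace (seg a b t - z) with (RtoC (1 - t) * (a - z) + RtoC t * (b - z))
  by (unfold seg; rewrite RtoC_minus; ring).
eapply Rle_lt_trans; [apply Cmod_triangle|].
rewrite !Cmod_mult, !Cmod_R, !Rabs_pos_eq by lra.
destruct (Rle_lt_or_eq_dec 0 t (proj1 ht)) as [h|h].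
- assert (t * Cmod (b - z) < t * r)%R by (apply Rmult_lt_compat_l; lra).
  assert ((1 - t) * Cmod (a - z) <= (1 - t) * r)%R by (apply Rmult_le_compat_l; lra). lra.
- subst t. lra.
Qed.

Lemma seg_near (a b : C) (t : R) (Q : C -> Prop) :
  near (seg a b t) Q -> exists d, (0 < d)%R /\ forall s, (Rabs (s - t) < d)%R -> Q (seg a b s).
Proof.
intro h. apply near_iff in h. destruct h as [e [he hQ]].
pose proof (Cmod_ge_0 (b - a)) as h0.
exists (e / (Cmod (b - a) + 1))%R. split; [apply Rdiv_lt_0_compat; lra|].
intros s hs. apply hQ. rewrite seg_sub, Cmod_mult, Cmod_R.
apply Rle_lt_trans with (Rabs (s - t) * (Cmod (b - a) + 1))%R.
- apply Rmult_le_compat_l; [apply Rabs_pos|lra].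
- replace e with (e / (Cmod (b - a) + 1) * (Cmod (b - a) + 1))%R by (field; lra).
  apply Rmult_lt_compat_r; lra.
Qed.

Definition Re_along (g : C -> C) (a b u : C) (t : R) : R := Re (Cconj u * g (seg a b t)).

Lemma Re_along_continuous (g : C -> C) (a b u : C) (t : R) :
  Clim (near (seg a b t)) g (g (seg a b t)) -> continuity_pt (Re_along g a b u) t.
Proof.
intros h. apply continuity_pt_locally. intros [e he]. simpl.
assert (he' : (0 < e / (Cmod u + 1))%R).
{ pose proof (Cmod_ge_0 u). apply Rdiv_lt_0_compat; lra. }
destruct (seg_near _ _ _ _ (h _ he')) as [d [hd0 hd]].
exists (mkposreal d hd0). intros s hs. specialize (hd s hs).
unfold Re_along.
replace (Re (Cconj u * g (seg a b s)) - Re (Cconj u * g (seg a b t)))%R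
  with (Re (Cconj u * (g (seg a b s) - g (seg a b t)))) by (simpl; ring).
eapply Rle_lt_trans; [apply re_le_Cmod|]. rewrite Cmod_mult, Cmod_conj.
pose proof (Cmod_ge_0 u). pose proof (Cmod_ge_0 (g (seg a b s) - g (seg a b t))).
apply Rle_lt_trans with ((Cmod u + 1) * Cmod (g (seg a b s) - g (seg a b t)))%R; [nra|].
replace e with ((Cmod u + 1) * (e / (Cmod u + 1)))%R by (field; lra).
apply Rmult_lt_compat_l; lra.
Qed.

Lemma Re_along_derive (g : C -> C) (a b u : C) (t : R) (l : C) :
  is_C_derive g (seg a b t) l ->
  is_derive (Re_along g a b u) t (Re (Cconj u * (l * (b - a)))).
Proof.
intros h. destruct (classic (b = a)) as [-> |hab].
{ replace (Re (Cconj u * (l * (a - a)))) with 0%R by (simpl; ring).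
  apply is_derive_ext with (fun _ => Re_along g a a u t); [|apply (is_derive_const (V:=R_NormedModule))].
  intro s. unfold Re_along, seg. do 3 f_equal. ring. }
apply is_derive_Reals. intros e he.
rewrite is_C_derive_Clim in h.
assert (hab' : b - a <> 0) by now apply C_sub_neq0.
pose proof (proj1 (Cmod_gt_0 _) hab') as hm.
pose proof (Cmod_ge_0 u) as hu.
set (K := ((Cmod u + 1) * Cmod (b - a))%R).
assert (hK : (0 < K)%R) by (unfold K; nra).
assert (he' : (0 < e / K)%R) by (apply Rdiv_lt_0_compat; lra).
specialize (h _ he'). unfold locally', within in h.
destruct (seg_near _ _ _ _ h) as [d [hd0 hd]].
exists (mkposreal d hd0). intros s hs0 hs. simpl in hs.
replace s with ((t + s) - t)%R in hs by ring. specialize (hd (t + s)%R hs).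
assert (hne : seg a b (t + s) <> seg a b t).
{ intro hE. assert (h1 : seg a b (t + s) - seg a b t = 0) by (rewrite hE; ring).
  rewrite seg_sub in h1. apply Cmult_integral in h1. destruct h1 as [h1|h1]; [|tauto].
  apply RtoC_inj in h1. apply hs0. lra. }
specialize (hd hne). rewrite seg_sub in hd.
replace (t + s - t)%R with s in hd by ring.
assert (hs1 : RtoC s <> 0) by (intro hE; apply RtoC_inj in hE; tauto).
set (D := g (seg a b (t + s)) - g (seg a b t)) in hd.
assert (hE : ((Re_along g a b u (t + s) - Re_along g a b u t) / s - Re (Cconj u * (l * (b - a)))
  = Re (Cconj u * ((D / (RtoC s * (b - a)) - l) * (b - a))))%R).
{ replace (Cconj u * ((D / (RtoC s * (b - a)) - l) * (b - a)))
    with (Cconj u * D * RtoC (/ s) - Cconj u * (l * (b - a))).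
  2: { rewrite RtoC_inv by exact hs0. field. split; assumption. }
  unfold Re_along, D. simpl. field. exact hs0. }
rewrite hE. eapply Rle_lt_trans; [apply re_le_Cmod|].
rewrite !Cmod_mult, Cmod_conj.
apply Rle_lt_trans with (K * Cmod (D / (RtoC s * (b - a)) - l))%R.
- unfold K. pose proof (Cmod_ge_0 (D / (RtoC s * (b - a)) - l)). nra.
- replace e with (K * (e / K))%R by (field; lra). apply Rmult_lt_compat_l; lra.
Qed.

Lemma Cmod_conj_self (u : C) : Re (Cconj u * u) = (Cmod u ^ 2)%R.
Proof. rewrite Cmod2_alt. unfold Re, Im. simpl. ring. Qed.

Lemma mean_value_bound (g : C -> C) (a b K : C) (d : R) :
  (0 <= d)%R ->
  (forall t, (0 <= t <= 1)%R -> Clim (near (seg a b t)) g (g (seg a b t))) ->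
  (forall t, (0 < t < 1)%R ->
    exists l, is_C_derive g (seg a b t) l /\ (Cmod (l - K) <= d)%R) ->
  (Cmod (g b - g a - K * (b - a)) <= d * Cmod (b - a))%R.
Proof.
intros hd0 hc hd.
set (D := g b - g a - K * (b - a)).
set (g1 := fun v => g v - K * v).
destruct (functional_choice (fun t y => ((0 < t < 1)%R -> is_derive (Re_along g1 a b D) t y) /\
    (y <= Cmod D * (d * Cmod (b - a)))%R)) as [df hdf].
{ intro t. destruct (classic (0 < t < 1)%R) as [ht|ht].
  2: { exists 0%R. split; [tauto|]. repeat apply Rmult_le_pos; auto using Cmod_ge_0. }
  destruct (hd t ht) as [l [hl1 hl2]].
  exists (Re (Cconj D * ((l - K) * (b - a)))). split.
  - intros _. apply Re_along_derive. apply is_C_derive_minus; [exact hl1|].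
    replace K with (0 * seg a b t + K * 1) at 2 by ring.
    apply is_C_derive_mult; [apply is_C_derive_const|apply is_C_derive_id].
  - eapply Rle_trans; [apply Rle_abs|]. eapply Rle_trans; [apply re_le_Cmod|].
    rewrite !Cmod_mult, Cmod_conj. apply Rmult_le_compat_l; [apply Cmod_ge_0|].
    apply Rmult_le_compat_r; [apply Cmod_ge_0|exact hl2]. }
destruct (MVT_gen (Re_along g1 a b D) 0 1 df) as [c [hc1 hc2]].
- intros t ht. rewrite Rmin_left, Rmax_right in ht by lra. now apply hdf.
- intros t ht. rewrite Rmin_left, Rmax_right in ht by lra. apply Re_along_continuous.
  apply Clim_minus; [now apply hc|]. apply Clim_mult; [apply Clim_const|apply Clim_id].
- pose proof (proj2 (hdf c)) as h1.
  assert (h2 : (Re_along g1 a b D 1 - Re_along g1 a b D 0 = Cmod D ^ 2)%R).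
  { rewrite <- Cmod_conj_self. unfold Re_along. rewrite seg_0, seg_1.
    replace (Cconj D * D) with (Cconj D * g1 b - Cconj D * g1 a)
      by (unfold g1, D; ring). reflexivity. }
  rewrite h2 in hc2. pose proof (Cmod_ge_0 D) as h3.
  destruct (Rle_lt_or_eq_dec _ _ h3) as [h4|h4].
  + apply Rmult_le_reg_l with (Cmod D); [exact h4|]. nra.
  + rewrite <- h4. apply Rmult_le_pos; [exact hd0|apply Cmod_ge_0].
Qed.

Lemma darboux (h : R -> R) (dh : R -> R) :
  (forall t, (0 <= t <= 1)%R -> is_derive h t (dh t)) ->
  (0 < dh 0)%R -> (dh 1 < 0)%R -> exists t, (0 < t < 1)%R /\ dh t = 0%R.
Proof.
intros hd h0 h1.
assert (hc : forall t, (0 <= t <= 1)%R -> continuity_pt h t).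
{ intros t ht. apply continuity_pt_filterlim. apply (ex_derive_continuous h).
  exists (dh t). now apply hd. }
destruct (continuity_ab_maj h 0 1 Rle_0_1 hc) as [M [hM1 hM2]].
assert (hb : forall t l, (0 <= t <= 1)%R -> is_derive h t l -> forall e, (0 < e)%R ->
  exists d, (0 < d)%R /\ forall s, s <> 0%R -> (Rabs s < d)%R ->
     (Rabs ((h (t + s) - h t) / s - l) < e)%R).
{ intros t l _ hl e he. apply is_derive_Reals in hl. destruct (hl e he) as [d hd'].
  exists d. split; [apply cond_pos|]. exact hd'. }
assert (hM3 : M <> 0%R).
{ intros ->. destruct (hb 0%R _ (conj (Rle_refl 0) Rle_0_1) (hd 0%R ltac:(lra)) _ h0) as [d [hd0 hd1]].
  set (s := (Rmin d 1 / 2)%R).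
  assert (hs : (0 < s)%R) by (unfold s; apply Rdiv_lt_0_compat; [apply Rmin_pos|]; lra).
  assert (hs' : (s < d)%R) by (unfold s; pose proof (Rmin_l d 1); lra).
  assert (hs2 : (s <= 1)%R) by (unfold s; pose proof (Rmin_r d 1); lra).
  specialize (hd1 s ltac:(lra) ltac:(rewrite Rabs_pos_eq; lra)).
  apply Rabs_def2 in hd1. specialize (hM1 (0 + s)%R ltac:(lra)).
  assert (h3 : (0 < (h (0 + s) - h 0) / s)%R) by lra.
  assert (h4 : (0 < (h (0 + s) - h 0) / s * s)%R) by (apply Rmult_lt_0_compat; lra).
  replace ((h (0 + s) - h 0) / s * s)%R with (h (0 + s) - h 0)%R in h4 by (field; lra). lra. }
assert (hM4 : M <> 1%R).
{ intros ->. assert (h1' : (0 < - dh 1)%R) by lra.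
  destruct (hb 1%R _ (conj Rle_0_1 (Rle_refl 1)) (hd 1%R ltac:(lra)) _ h1') as [d [hd0 hd1]].
  set (s := (Rmin d 1 / 2)%R).
  assert (hs : (0 < s)%R) by (unfold s; apply Rdiv_lt_0_compat; [apply Rmin_pos|]; lra).
  assert (hs' : (s < d)%R) by (unfold s; pose proof (Rmin_l d 1); lra).
  assert (hs2 : (s <= 1)%R) by (unfold s; pose proof (Rmin_r d 1); lra).
  specialize (hd1 (- s)%R ltac:(lra) ltac:(rewrite Rabs_Ropp, Rabs_pos_eq; lra)).
  apply Rabs_def2 in hd1. specialize (hM1 (1 + - s)%R ltac:(lra)).
  assert (h3 : ((h (1 + - s) - h 1) / - s < 0)%R) by lra.
  assert (h4 : (0 < - ((h (1 + - s) - h 1) / - s) * s)%R) by (apply Rmult_lt_0_compat; lra).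
  replace (- ((h (1 + - s) - h 1) / - s) * s)%R with (h (1 + - s) - h 1)%R in h4 by (field; lra). lra. }
exists M. split; [lra|].
assert (pr : derivable_pt_lim h M (dh M)) by (apply is_derive_Reals, hd; lra).
rewrite <- (derive_pt_eq_0 h M (dh M) (exist _ _ pr) pr).
apply deriv_maximum with 0%R 1%R; try lra. intros t ht0 ht1. apply hM1. lra.
Qed.

Lemma real_clopen (Q : R -> Prop) :
  (forall t, (0 <= t <= 1)%R -> exists d, (0 < d)%R /\
    forall s s', (0 <= s <= 1)%R -> (0 <= s' <= 1)%R ->
      (Rabs (s - t) < d)%R -> (Rabs (s' - t) < d)%R -> Q s -> Q s') ->
  Q 0%R -> Q 1%R.
Proof.
intros hloc h0.
destruct (completeness (fun t => (0 <= t <= 1)%R /\ Q t)) as [T [hT1 hT2]].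
{ exists 1%R. intros t [ht _]. lra. }
{ exists 0%R. split; [lra|exact h0]. }
assert (hT : (0 <= T <= 1)%R).
{ split; [apply hT1; split; [lra|exact h0]|]. apply hT2. intros t [ht _]. lra. }
destruct (hloc T hT) as [d [hd0 hd]].
assert (hex : exists t, (0 <= t <= 1)%R /\ Q t /\ (T - d < t)%R).
{ apply NNPP. intro hn. assert (T <= T - d)%R; [|lra]. apply hT2. intros t [ht hQ].
  apply Rnot_lt_le. intro hlt. apply hn. exists t. auto. }
destruct hex as [t [ht [hQt htd]]].
assert (htT : (t <= T)%R) by (apply hT1; auto).
set (s := Rmin 1 (T + d / 2)).
assert (hs1 : (s <= 1)%R) by apply Rmin_l.
assert (hs2 : (s <= T + d / 2)%R) by apply Rmin_r.
assert (hs3 : (T <= s)%R) by (apply Rmin_glb; lra).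
assert (hQs : Q s).
{ apply (hd t s); auto; try lra; apply Rabs_def1; lra. }
assert (hsT : (s <= T)%R) by (apply hT1; split; [lra|exact hQs]).
replace 1%R with s; [exact hQs|]. unfold s in *.
destruct (Rle_dec 1 (T + d / 2)) as [h|h]; [now rewrite Rmin_left|].
rewrite Rmin_right in hsT by lra. lra.
Qed.

Lemma first_point (Q : R -> Prop) (t1 : R) :
  (forall t, (0 <= t <= 1)%R -> ~ Q t -> exists d, (0 < d)%R /\
    forall s, (Rabs (s - t) < d)%R -> ~ Q s) ->
  (0 <= t1 <= 1)%R -> Q t1 ->
  exists T, (0 <= T <= 1)%R /\ Q T /\ forall s, (0 <= s < T)%R -> ~ Q s.
Proof.
intros hloc ht1 hQ1.
destruct (completeness (fun t => (0 <= t <= 1)%R /\ forall s, (0 <= s < t)%R -> ~ Q s))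
  as [T [hT1 hT2]].
{ exists 1%R. intros t [ht _]. lra. }
{ exists 0%R. split; [lra|]. intros s hs. lra. }
assert (hT : (0 <= T <= 1)%R).
{ split; [apply hT1; split; [lra|]; intros s hs; lra|]. apply hT2. intros t [ht _]. lra. }
assert (hbefore : forall s, (0 <= s < T)%R -> ~ Q s).
{ intros s hs hQ. assert (T <= s)%R; [|lra]. apply hT2. intros t [ht hQt].
  apply Rnot_lt_le. intro hlt. exact (hQt s ltac:(lra) hQ). }
exists T. repeat split; try lra; [|exact hbefore].
apply NNPP. intro hn. destruct (hloc T hT hn) as [d [hd0 hd]].
assert (hTt : (T < t1)%R).
{ destruct (Rtotal_order T t1) as [h|[h|h]]; [exact h|subst; tauto|].
  exfalso. exact (hbefore t1 ltac:(lra) hQ1). }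
set (s := Rmin 1 (T + d / 2)).
assert (hs1 : (s <= 1)%R) by apply Rmin_l.
assert (hs2 : (s <= T + d / 2)%R) by apply Rmin_r.
assert (hs3 : (T < s)%R) by (apply Rmin_glb_lt; lra).
assert (s <= T)%R; [|lra]. apply hT1. split; [lra|]. intros x hx hQx.
destruct (Rlt_dec x T) as [h|h]; [exact (hbefore x ltac:(lra) hQx)|].
apply (hd x); [|exact hQx]. apply Rabs_def1; lra.
Qed.

(** * Locally constant predicates off a discrete set *)

Section Connectedness.
Context (Bad U : C -> Prop).
Hypothesis Bad_discrete : forall z, near' z (fun v => ~ Bad v).
Hypothesis U_loc_const : forall z, ~ Bad z -> near z U \/ near z (fun v => ~ U v).

Lemma loc_const_seg (a b : C) :
  (forall t, (0 <= t <= 1)%R -> ~ Bad (seg a b t)) -> U a -> U b.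
Proof.
intros hb ha. rewrite <- (seg_1 a b).
apply (real_clopen (fun t => U (seg a b t))); [|now rewrite seg_0].
intros t ht. destruct (U_loc_const _ (hb t ht)) as [h|h];
  destruct (seg_near _ _ _ _ h) as [d [hd0 hd]]; exists d; split; auto.
intros s s' _ _ hs _ hU. destruct (hd s hs hU).
Qed.

(* If the segment from [a] to [b] meets [z], go through [z + i (a - z)] instead. *)
Lemma loc_const_punctured (z : C) (r : R) :
  (forall v, v <> z -> (Cmod (v - z) < r)%R -> ~ Bad v) ->
  forall a b, a <> z -> b <> z -> (Cmod (a - z) < r)%R -> (Cmod (b - z) < r)%R -> U a -> U b.
Proof.
intros hr a b ha hb har hbr hUa.
destruct (classic (exists t, (0 <= t <= 1)%R /\ seg a b t = z)) as [[t [ht htz]]|hn].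
2: { apply loc_const_seg with a; [|exact hUa]. intros t ht. apply hr.
     - intro h. apply hn. now exists t.
     - now apply seg_ball. }
set (q := z + Ci * (a - z)).
assert (hqz : q - z = Ci * (a - z)) by (unfold q; ring).
assert (ha0 : a - z <> 0) by now apply C_sub_neq0.
assert (hb0 : b - z <> 0) by now apply C_sub_neq0.
assert (hqr : (Cmod (q - z) < r)%R).
{ rewrite hqz, Cmod_mult, Cmod_Ci. lra. }
assert (hIm : forall x y : R, RtoC x + RtoC y * Ci = 0 -> x = 0%R /\ y = 0%R).
{ intros x y h. split; [apply (f_equal fst) in h|apply (f_equal snd) in h]; simpl in h; lra. }
assert (ht1 : t <> 1%R).
{ intros ->. rewrite seg_1 in htz. tauto. }
assert (ht0 : t <> 0%R).
{ intros ->. rewrite seg_0 in htz. tauto. }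
assert (hrel : RtoC t * (b - z) = - (RtoC (1 - t) * (a - z))).
{ apply C_sub_eq0. replace (RtoC t * (b - z) - - (RtoC (1 - t) * (a - z)))
    with (seg a b t - z) by (unfold seg; rewrite RtoC_minus; ring).
  rewrite htz. ring. }
assert (hUq : U q).
{ apply loc_const_seg with a; [|exact hUa]. intros s hs. apply hr; [|now apply seg_ball].
  intro h. assert (h1 : (RtoC (1 - s) + RtoC s * Ci) * (a - z) = 0).
  { replace ((RtoC (1 - s) + RtoC s * Ci) * (a - z)) with (seg a q s - z)
      by (unfold seg, q; rewrite RtoC_minus; ring).
    rewrite h. ring. }
  apply Cmult_integral in h1. destruct h1 as [h1|h1]; [|tauto].
  apply hIm in h1. lra. }
apply loc_const_seg with q; [|exact hUq]. intros s hs. apply hr; [|now apply seg_ball].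
intro h.
assert (h1 : (RtoC (- (s * (1 - t))) + RtoC ((1 - s) * t) * Ci) * (a - z) = 0).
{ replace ((RtoC (- (s * (1 - t))) + RtoC ((1 - s) * t) * Ci) * (a - z))
    with (RtoC t * (RtoC (1 - s) * (q - z)) + RtoC s * - (RtoC (1 - t) * (a - z)))
    by (rewrite hqz, RtoC_opp, !RtoC_mult; ring).
  rewrite <- hrel.
  replace (RtoC t * (RtoC (1 - s) * (q - z)) + RtoC s * (RtoC t * (b - z)))
    with (RtoC t * (seg q b s - z)) by (unfold seg; rewrite RtoC_minus; ring).
  rewrite h. ring. }
apply Cmult_integral in h1. destruct h1 as [h1|h1]; [|tauto].
apply hIm in h1. destruct h1 as [h1 h2].
assert (h3 : (1 - s = 0)%R) by (apply Rmult_integral in h2; lra).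
apply Rmult_eq_compat_l with (r := (-1)%R) in h1. nra.
Qed.

Lemma loc_const_off_discrete (z1 z2 : C) : ~ Bad z1 -> ~ Bad z2 -> U z1 -> U z2.
Proof.
intros h1 h2 hU.
assert (h3 : near' (seg z1 z2 1) U).
{ apply (real_clopen (fun t => near' (seg z1 z2 t) U)).
  - intros t ht. generalize (Bad_discrete (seg z1 z2 t)). rewrite near'_iff.
    intros [r [hr0 hr]].
    assert (hnear : near (seg z1 z2 t) (fun v => (Cmod (v - seg z1 z2 t) < r)%R))
      by (apply near_iff; now exists r).
    destruct (seg_near _ _ _ _ (near_near _ _ hnear)) as [d [hd0 hd]].
    exists d. split; [exact hd0|]. intros s s' _ _ hs hs' hQ.
    assert (hoff : forall x, near' x (fun v => v <> seg z1 z2 t)).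
    { intro x. destruct (classic (x = seg z1 z2 t)) as [-> |hx].
      - apply near'_iff. exists 1%R. split; [lra|auto].
      - apply near_near'. exact (Clim_neq _ _ _ (Clim_id x) hx). }
    destruct (filter_ex _ (filter_and _ _ hQ (filter_and _ _ (hoff _) (near_near' _ _ (hd s hs)))))
      as [v [hv1 [hv2 hv3]]].
    generalize (filter_and _ _ (hoff _) (near_near' _ _ (hd s' hs'))). apply filter_imp.
    intros v' [hv4 hv5]. now apply (loc_const_punctured _ _ hr v v').
  - rewrite seg_0. apply near_near'. destruct (U_loc_const _ h1) as [h|h]; [exact h|].
    destruct (near_self _ _ h hU). }
rewrite seg_1 in h3. destruct (U_loc_const _ h2) as [h|h]; [now apply near_self|].
destruct (filter_ex _ (filter_and _ _ h3 (near_near' _ _ h))) as [v [h4 h5]]. tauto.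
Qed.

End Connectedness.

(** * Isolated zeros *)

Section IsolatedZero.
Context (w : C -> C) (z1 : C) (r : R).
Hypothesis w_continuous : forall z, (Cmod (z - z1) < r)%R -> Clim (near z) w (w z).
Hypothesis w_derive : forall z, (Cmod (z - z1) < r)%R -> w z <> 0 ->
  exists l, is_C_derive w z l /\ (Cmod (l - 1) <= 1 / 20)%R.

Lemma seg_seg (q z : C) (s t : R) : seg q (seg q z s) t = seg q z (t * s).
Proof. unfold seg. rewrite RtoC_mult. ring. Qed.

Lemma w_mean_value (q z : C) :
  (Cmod (q - z1) < r)%R -> (Cmod (z - z1) < r)%R ->
  (forall t, (0 < t < 1)%R -> w (seg q z t) <> 0) ->
  (Cmod (w z - w q - (z - q)) <= 1 / 20 * Cmod (z - q))%R.
Proof.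
intros hq hz hw. replace (z - q) with (1 * (z - q)) at 1 by ring.
apply mean_value_bound; [lra| |].
- intros t ht. apply w_continuous. now apply seg_ball.
- intros t ht. apply w_derive; [apply seg_ball; auto; lra|now apply hw].
Qed.

(* [w] is close to [v - b] at [q], hence along [q, z] until its first zero; but at
   that zero [v - b] would be larger than the error. *)
Lemma continue_estimate (q z b : C) (e : R) :
  (Cmod (q - z1) < r)%R -> (Cmod (z - z1) < r)%R ->
  (Cmod (w q - (q - b)) <= e)%R ->
  (forall t, (0 <= t <= 1)%R -> (e + 1 / 20 * (t * Cmod (z - q)) < Cmod (seg q z t - b))%R) ->
  w z <> 0 /\ (Cmod (w z - (z - b)) <= e + 1 / 20 * Cmod (z - q))%R.
Proof.
intros hq hz he hlow.
assert (hest : forall T, (0 <= T <= 1)%R -> (forall s, (0 <= s < T)%R -> w (seg q z s) <> 0) ->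
  (Cmod (w (seg q z T) - (seg q z T - b)) <= e + 1 / 20 * (T * Cmod (z - q)))%R).
{ intros T hT hs. destruct (Rle_lt_or_eq_dec 0 T (proj1 hT)) as [hT0| <-].
  2: { rewrite seg_0. lra. }
  pose proof (seg_ball _ _ _ _ _ hq hz hT) as hb.
  assert (h1 : (Cmod (w (seg q z T) - w q - (seg q z T - q)) <= 1 / 20 * (T * Cmod (z - q)))%R).
  { replace (T * Cmod (z - q))%R with (Cmod (seg q z T - q)).
    - apply w_mean_value; [exact hq|exact hb|]. intros t ht. rewrite seg_seg. apply hs. nra.
    - replace (seg q z T - q) with (RtoC T * (z - q)) by (unfold seg; ring).
      rewrite Cmod_mult, Cmod_R, Rabs_pos_eq by lra. reflexivity. }
  replace (w (seg q z T) - (seg q z T - b))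
    with ((w q - (q - b)) + (w (seg q z T) - w q - (seg q z T - q))) by ring.
  eapply Rle_trans; [apply Cmod_triangle|]. lra. }
assert (hnz : forall t, (0 <= t <= 1)%R -> w (seg q z t) <> 0).
{ intros t1 ht1 hw1.
  destruct (first_point (fun t => w (seg q z t) = 0) t1) as [T [hT1 [hT2 hT3]]]; auto.
  - intros t ht hwt.
    destruct (seg_near q z t _ (Clim_neq _ _ _ (w_continuous _ (seg_ball _ _ _ _ _ hq hz ht)) hwt))
      as [d hd]. exists d. exact hd.
  - specialize (hest T hT1 hT3). specialize (hlow T hT1). rewrite hT2 in hest.
    replace (0 - (seg q z T - b)) with (- (seg q z T - b)) in hest by ring.
    rewrite Cmod_opp in hest. lra. }
specialize (hest 1%R ltac:(lra) ltac:(intros s hs; apply hnz; lra)).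
rewrite seg_1, Rmult_1_l in hest. split; [|exact hest].
specialize (hnz 1%R ltac:(lra)). now rewrite seg_1 in hnz.
Qed.

Lemma Cmod_chord (u : C) (t : R) :
  Cmod u = 1%R -> (Cmod (1 + u) / 2 <= Cmod (1 + RtoC t * (u - 1)))%R.
Proof.
intro hu. pose proof (Cmod_ge_0 (1 + u)).
apply Rsqr_incr_0; [|lra|apply Cmod_ge_0]. rewrite !Rsqr_pow2.
assert (h1 : (Cmod u ^ 2 = 1)%R) by (rewrite hu; ring).
replace ((Cmod (1 + u) / 2) ^ 2)%R with (Cmod (1 + u) ^ 2 / 4)%R by field.
rewrite !Cmod2_alt. rewrite Cmod2_alt in h1. unfold Re, Im in *.
destruct u as [x y]. simpl in *.
assert (h2 : (y * y = 1 - x * x)%R) by lra.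
match goal with |- (?A <= ?B)%R =>
  assert (hA : (A = (1 + x) / 2)%R) by nra;
  assert (hB : (B = 1 - 2 * (t * (1 - t)) * (1 - x))%R) by nra
end.
rewrite hA, hB.
assert (h3 : (x <= 1)%R) by (pose proof (Rle_0_sqr y); unfold Rsqr in *; nra).
assert (h4 : (t * (1 - t) <= 1 / 4)%R) by (pose proof (Rle_0_sqr (t - 1 / 2)); unfold Rsqr in *; lra).
assert (h5 : (0 <= (1 / 4 - t * (1 - t)) * (1 - x))%R) by (apply Rmult_le_pos; lra). lra.
Qed.

Lemma rotate_estimate (q b u : C) (e : R) :
  (forall v, (Cmod (v - b) <= Cmod (q - b))%R -> (Cmod (v - z1) < r)%R) ->
  q <> b -> Cmod u = 1%R -> (1 / 2 < Cmod (1 + u))%R ->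
  (Cmod (w q - (q - b)) <= e)%R -> (e <= 3 / 20 * Cmod (q - b))%R ->
  w (b + u * (q - b)) <> 0 /\
  (Cmod (w (b + u * (q - b)) - u * (q - b)) <= e + 1 / 10 * Cmod (q - b))%R.
Proof.
intros hball hqb hu hu1 he hle.
assert (h0 : (0 < Cmod (q - b))%R) by (apply Cmod_gt_0; now apply C_sub_neq0).
set (z := b + u * (q - b)).
assert (hzb : z - b = u * (q - b)) by (unfold z; ring).
assert (hzq : (Cmod (z - q) <= 2 * Cmod (q - b))%R).
{ replace (z - q) with ((z - b) + - (q - b)) by ring.
  eapply Rle_trans; [apply Cmod_triangle|]. rewrite Cmod_opp, hzb, Cmod_mult, hu. lra. }
destruct (continue_estimate q z b e) as [h1 h2].
- apply hball. lra.
- apply hball. rewrite hzb, Cmod_mult, hu. lra.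
- exact he.
- intros t ht. replace (seg q z t - b) with ((1 + RtoC t * (u - 1)) * (q - b))
    by (unfold seg, z; ring).
  rewrite Cmod_mult. pose proof (Cmod_chord u t hu) as h3.
  pose proof (Cmod_ge_0 (z - q)).
  assert (t * Cmod (z - q) <= 2 * Cmod (q - b))%R by nra.
  assert (1 / 4 * Cmod (q - b) < Cmod (1 + RtoC t * (u - 1)) * Cmod (q - b))%R; [|lra].
  apply Rmult_lt_compat_r; lra.
- split; [exact h1|]. rewrite <- hzb. lra.
Qed.

Lemma isolated_zero (a : C) :
  w z1 = 0 -> (Cmod (a - z1) < r)%R -> w a <> 0 ->
  forall z, z <> z1 -> (Cmod (z - z1) <= Cmod (a - z1))%R -> w z <> 0.
Proof.
intros hz1 har ha.
assert (hr1 : (Cmod (z1 - z1) < r)%R).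
{ replace (z1 - z1) with (0 : C) by ring. rewrite Cmod_0. pose proof (Cmod_ge_0 (a - z1)). lra. }
destruct (first_point (fun t => w (seg a z1 t) = 0) 1) as [T [hT1 [hT2 hT3]]].
{ intros t ht hwt.
  destruct (seg_near a z1 t _ (Clim_neq _ _ _ (w_continuous _ (seg_ball _ _ _ _ _ har hr1 ht)) hwt))
    as [d hd]. exists d. exact hd. }
{ lra. }
{ now rewrite seg_1. }
assert (hT0 : (0 < T)%R).
{ destruct (Rle_lt_or_eq_dec 0 T (proj1 hT1)) as [h|h]; [exact h|]. subst T.
  rewrite seg_0 in hT2. tauto. }
set (b := seg a z1 T) in *.
set (L := Cmod (a - z1)) in *.
assert (haz : a <> z1) by (intros ->; tauto).
assert (hL : (0 < L)%R) by (apply Cmod_gt_0; now apply C_sub_neq0).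
assert (hLt : forall t, (0 <= t)%R -> Cmod (RtoC t * (a - z1)) = (t * L)%R).
{ intros t ht. rewrite Cmod_mult, Cmod_R, Rabs_pos_eq by lra. reflexivity. }
assert (hball : forall v, (Cmod (v - b) <= T * L)%R -> (Cmod (v - z1) < r)%R).
{ intros v hv. replace (v - z1) with ((v - b) + RtoC (1 - T) * (a - z1))
    by (unfold b, seg; rewrite RtoC_minus; ring).
  eapply Rle_lt_trans; [apply Cmod_triangle|]. rewrite hLt by lra. nra. }
assert (hcircle : forall z, z <> b -> (Cmod (z - b) <= T * L)%R ->
  w z <> 0 /\ (Cmod (w z - (z - b)) <= 1 / 4 * Cmod (z - b))%R).
{ intros z hzb hzL. set (n := Cmod (z - b)) in *.
  assert (hn : (0 < n)%R) by (apply Cmod_gt_0; now apply C_sub_neq0).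
  set (q := b + RtoC (n / L) * (a - z1)).
  assert (hqb : q - b = RtoC (n / L) * (a - z1)) by (unfold q; ring).
  assert (hnL : (0 < n / L)%R) by (apply Rdiv_lt_0_compat; lra).
  assert (hqn : Cmod (q - b) = n).
  { rewrite hqb, hLt by lra. field. lra. }
  assert (hqb0 : q - b <> 0) by (apply Cmod_gt_0; lra).
  assert (hqb' : q <> b) by (intro h; apply hqb0; rewrite h; ring).
  assert (hnT : (n / L <= T)%R).
  { apply Rmult_le_reg_r with L; [exact hL|]. replace (n / L * L)%R with n by (field; lra). lra. }
  assert (hqest : (Cmod (w q - (q - b)) <= 1 / 20 * n)%R).
  { assert (h1 : (Cmod (w b - w q - (b - q)) <= 1 / 20 * Cmod (b - q))%R).
    { apply w_mean_value.
      - apply hball. lra.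
      - apply hball. replace (b - b) with (0 : C) by ring. rewrite Cmod_0. nra.
      - intros t ht. replace (seg q b t) with (seg a z1 (T - (1 - t) * (n / L))).
        + apply hT3. split; [nra|]. assert (0 < (1 - t) * (n / L))%R; [|lra].
          apply Rmult_lt_0_compat; lra.
        + unfold q, b, seg. rewrite RtoC_minus, RtoC_mult, RtoC_minus. ring. }
    rewrite hT2 in h1. replace (0 - w q - (b - q)) with (- (w q - (q - b))) in h1 by ring.
    replace (b - q) with (- (q - b)) in h1 by ring. rewrite !Cmod_opp, hqn in h1. exact h1. }
  assert (hball' : forall v, (Cmod (v - b) <= n)%R -> (Cmod (v - z1) < r)%R).
  { intros v hv. apply hball. lra. }
  set (u := (z - b) / (q - b)).
  assert (hu : Cmod u = 1%R).
  { unfold u. rewrite Cmod_div by exact hqb0. fold n. rewrite hqn. field. lra. }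
  assert (hz : z = b + u * (q - b)) by (unfold u; field; exact hqb0).
  destruct (Rlt_dec (1 / 2) (Cmod (1 + u))) as [hu1|hu1].
  - destruct (rotate_estimate q b u (1 / 20 * n)) as [h1 h2]; rewrite ?hqn; auto; try lra.
    rewrite <- hz in h1, h2. split; [exact h1|].
    replace (z - b) with (u * (q - b)) by (rewrite hz at 1; ring). rewrite hqn in h2. lra.
  - assert (hi : (1 / 2 < Cmod (1 + Ci))%R).
    { apply Rnot_le_lt. intro h. pose proof (pow_incr (Cmod (1 + Ci)) (1 / 2) 2
        (conj (Cmod_ge_0 _) h)) as h1. rewrite Cmod2_alt in h1. simpl in h1. lra. }
    destruct (rotate_estimate q b Ci (1 / 20 * n)) as [h1 h2]; rewrite ?hqn; auto; try lra.
    { apply Cmod_Ci. }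
    set (q' := b + Ci * (q - b)) in *.
    assert (hq'b : q' - b = Ci * (q - b)) by (unfold q'; ring).
    assert (hq'n : Cmod (q' - b) = n) by (rewrite hq'b, Cmod_mult, Cmod_Ci, hqn; ring).
    assert (hq'b' : q' <> b).
    { intro h. rewrite h in hq'n. replace (b - b) with (0 : C) in hq'n by ring.
      rewrite Cmod_0 in hq'n. lra. }
    set (u' := - Ci * u).
    assert (hii : Ci * Ci = - (1)) by (apply injective_projections; simpl; ring).
    assert (hz' : z = b + u' * (q' - b)).
    { rewrite hq'b. unfold u'. rewrite hz at 1.
      replace (- Ci * u * (Ci * (q - b))) with (- (Ci * Ci) * (u * (q - b))) by ring.
      rewrite hii. ring. }
    assert (hu' : Cmod u' = 1%R) by (unfold u'; rewrite Cmod_mult, Cmod_opp, Cmod_Ci, hu; ring).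
    assert (hu1' : (1 / 2 < Cmod (1 + u'))%R).
    { assert (h3 : (Cmod (1 + Ci) <= Cmod (1 + u') + Cmod (1 + u))%R).
      { replace (1 + Ci) with ((1 + u') + Ci * (1 + u)) by (unfold u'; ring).
        eapply Rle_trans; [apply Cmod_triangle|]. rewrite Cmod_mult, Cmod_Ci. lra. }
      assert (h4 : (1 < Cmod (1 + Ci))%R).
      { apply Rnot_le_lt. intro h. pose proof (pow_incr (Cmod (1 + Ci)) 1 2
          (conj (Cmod_ge_0 _) h)) as h5. rewrite Cmod2_alt in h5. simpl in h5. lra. }
      lra. }
    destruct (rotate_estimate q' b u' (3 / 20 * n)) as [h5 h6]; rewrite ?hq'n; auto; try lra.
    { rewrite hq'b. rewrite hqn in h2. lra. }
    rewrite <- hz' in h5, h6. split; [exact h5|].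
    replace (z - b) with (u' * (q' - b)) by (rewrite hz' at 1; ring). rewrite hq'n in h6. lra. }
assert (hb1 : b = z1).
{ destruct (Rle_lt_or_eq_dec T 1 (proj2 hT1)) as [hlt|heq].
  2: { unfold b. rewrite heq. apply seg_1. }
  exfalso.
  set (q := b + RtoC (- (T * (1 - T))) * (a - z1)).
  assert (hz1b : z1 - b = - (RtoC (1 - T) * (a - z1))) by (unfold b, seg; rewrite RtoC_minus; ring).
  assert (hqb : q - b = - (RtoC (T * (1 - T)) * (a - z1))) by (unfold q; rewrite RtoC_opp; ring).
  assert (hqn : Cmod (q - b) = (T * (1 - T) * L)%R) by (rewrite hqb, Cmod_opp, hLt
    by (apply Rmult_le_pos; lra); reflexivity).
  assert (hpos : (0 < T * (1 - T) * L)%R) by (repeat apply Rmult_lt_0_compat; lra).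
  assert (hTT : (0 < T * T * L)%R) by (repeat apply Rmult_lt_0_compat; lra).
  destruct (hcircle q) as [h1 h2].
  { intro h. rewrite h in hqn. replace (b - b) with (0 : C) in hqn by ring.
    rewrite Cmod_0 in hqn. lra. }
  { rewrite hqn. lra. }
  rewrite hqn in h2.
  destruct (continue_estimate q z1 b (1 / 4 * (T * (1 - T) * L))) as [h3 _]; auto.
  - apply hball. rewrite hqn. lra.
  - intros t ht.
    replace (z1 - q) with (- (RtoC ((1 - T) * (1 - T)) * (a - z1)))
      by (unfold q, b, seg; rewrite RtoC_opp, !RtoC_mult, !RtoC_minus; ring).
    replace (seg q z1 t - b) with (- (RtoC ((T + t * (1 - T)) * (1 - T)) * (a - z1)))
      by (unfold q, b, seg; rewrite RtoC_opp, !RtoC_mult, RtoC_plus, RtoC_mult, !RtoC_minus; ring).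
    assert (htT : (0 <= t * (1 - T))%R) by (apply Rmult_le_pos; lra).
    rewrite !Cmod_opp, hLt by (apply Rmult_le_pos; lra). rewrite hLt by (apply Rmult_le_pos; lra).
    assert (0 <= t * ((1 - T) * (1 - T)) * L)%R by (repeat apply Rmult_le_pos; lra). nra. }
intros z hz hzL. apply hcircle; rewrite hb1; [exact hz|].
replace (T * L)%R with L; [exact hzL|].
assert (hT : T = 1%R); [|rewrite hT; ring].
assert (h : RtoC (1 - T) * (a - z1) = 0).
{ replace (RtoC (1 - T) * (a - z1)) with (b - z1) by (unfold b, seg; rewrite RtoC_minus; ring).
  rewrite hb1. ring. }
apply Cmult_integral in h. destruct h as [h|h]; [apply RtoC_inj in h; lra|].
exfalso. apply haz. now apply C_sub_eq0.
Qed.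

End IsolatedZero.

(** * Regularity of sn *)

Definition quartic (k s : C) : C := (1 - s ^ 2) * (1 - k ^ 2 * s ^ 2).

(* Half the derivative of [quartic k]. *)
Definition quartic' (k s : C) : C := 2 * k ^ 2 * s ^ 3 - (1 + k ^ 2) * s.

Lemma quartic_simple_root (k s : C) : k ^ 2 <> 1 -> quartic k s = 0 -> quartic' k s <> 0.
Proof.
unfold quartic, quartic'. intros hk h h'. apply Cmult_integral in h.
assert (hs : s <> 0 -> s * (k ^ 2 - 1) <> 0).
{ intros hs. apply Cmult_neq_0; [exact hs|now apply C_sub_neq0]. }
assert (h1 : (1 : C) <> 0) by (intro e; apply RtoC_inj in e; lra).
destruct h as [h|h].
- apply hs.
  + intros ->. apply h1. rewrite <- h. ring.
  + replace (s * (k ^ 2 - 1)) with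
      (2 * k ^ 2 * s ^ 3 - (1 + k ^ 2) * s + 2 * k ^ 2 * s * (1 - s ^ 2)) by ring.
    rewrite h, h'. ring.
- apply hs.
  + intros ->. apply h1. rewrite <- h. ring.
  + replace (s * (k ^ 2 - 1)) with
      (- (2 * k ^ 2 * s ^ 3 - (1 + k ^ 2) * s + 2 * s * (1 - k ^ 2 * s ^ 2))) by ring.
    rewrite h, h'. ring.
Qed.

Lemma Clim_quartic {T : Type} {F : (T -> Prop) -> Prop} {FF : Filter F} (k : C) (g : T -> C) l :
  Clim F g l -> Clim F (fun v => quartic k (g v)) (quartic k l).
Proof.
intro h. unfold quartic.
repeat first [apply Clim_minus | apply Clim_pow; exact h | apply Clim_const | apply Clim_mult].
Qed.

Lemma Clim_quartic' {T : Type} {F : (T -> Prop) -> Prop} {FF : Filter F} (k : C) (g : T -> C) l :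
  Clim F g l -> Clim F (fun v => quartic' k (g v)) (quartic' k l).
Proof.
intro h. unfold quartic'.
repeat first [apply Clim_minus | apply Clim_pow; exact h | exact h | apply Clim_const | apply Clim_mult].
Qed.

Section Regularity.
Context (k : C) (sn : C -> C).
Hypothesis sn_jacobi : is_jacobi_sn k sn.
Hypothesis k2_neq1 : k ^ 2 <> 1.

Notation w := (C_derive sn).

Lemma derive_not_pole (z l : C) : is_C_derive sn z l -> ~ is_pole sn z.
Proof.
intros h [_ hp]. apply is_C_derive_continuous in h. apply Clim_near' in h.
exact (Clim_not_infty _ _ h hp).
Qed.

Lemma sn_derive (z : C) : ~ is_pole sn z -> is_C_derive sn z (w z).
Proof.
intro hz. destruct (jacobi_sn_meromorphic _ _ sn_jacobi z) as [[l hl]|h]; [|tauto].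
now rewrite (is_C_derive_unique _ _ _ hl).
Qed.

Lemma sn_continuous (z : C) : ~ is_pole sn z -> Clim (near z) sn (sn z).
Proof. intro hz. exact (is_C_derive_continuous _ _ _ (sn_derive _ hz)). Qed.

Lemma sn_ode (z : C) : ~ is_pole sn z -> w z ^ 2 = quartic k (sn z).
Proof. intro hz. exact (jacobi_sn_ode _ _ sn_jacobi _ _ (sn_derive _ hz)). Qed.

Lemma near'_not_pole (z : C) : near' z (fun v => ~ is_pole sn v).
Proof.
destruct (classic (is_pole sn z)) as [[hp _]|hz].
- generalize hp. apply filter_imp. intros v [l hl]. exact (derive_not_pole _ _ hl).
- apply near_near'. generalize (near_near _ _ (Clim_bounded _ _ (sn_continuous _ hz))).
  apply filter_imp. intros v hv [_ hp].
  specialize (hp (fun x => (Cmod (sn z) + 1 < x)%R)).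
  assert (h1 : near' v (fun u => (Cmod (sn z) + 1 < Cmod (sn u))%R)).
  { apply hp. exists (Cmod (sn z) + 1)%R. auto. }
  destruct (filter_ex _ (filter_and _ _ h1 (near_near' _ _ hv))) as [u [h2 h3]]. lra.
Qed.

Lemma near_not_pole (z : C) : ~ is_pole sn z -> near z (fun v => ~ is_pole sn v).
Proof. intro h. apply near_of_near'; [apply near'_not_pole|exact h]. Qed.

Lemma not_pole_0 : ~ is_pole sn 0.
Proof. exact (derive_not_pole _ _ (jacobi_sn_derive_0 _ _ sn_jacobi)). Qed.

Lemma sn'_0 : w 0 = 1.
Proof. exact (is_C_derive_unique _ _ _ (jacobi_sn_derive_0 _ _ sn_jacobi)). Qed.

Lemma Re_conj_scale (a d l : C) :
  Re (Cconj (a * d) * (l * d)) = (Cmod d ^ 2 * Re (Cconj a * l))%R.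
Proof. rewrite Cmod2_alt. unfold Re, Im. simpl. ring. Qed.

Lemma Re_conj_near (a l : C) (e : R) : a <> 0 -> (e <= Cmod a / 2)%R ->
  (Cmod (l - a) < e)%R -> (0 < Re (Cconj a * l))%R.
Proof.
intros ha he hl.
assert (h0 : (0 < Cmod a)%R) by now apply Cmod_gt_0.
assert (h1 : Re (Cconj a * l) = (Re (Cconj a * (l - a)) + Cmod a ^ 2)%R).
{ rewrite <- Cmod_conj_self. unfold Re. simpl. ring. }
pose proof (re_le_Cmod (Cconj a * (l - a))) as h2. rewrite Cmod_mult, Cmod_conj in h2.
pose proof (Rle_abs (- Re (Cconj a * (l - a)))) as h3. rewrite Rabs_Ropp in h3.
assert (h4 : (Cmod a * Cmod (l - a) < Cmod a * Cmod a)%R) by (apply Rmult_lt_compat_l; lra).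
nra.
Qed.

(* Where the quartic does not vanish, the ODE leaves two opposite values for sn'.  By Darboux's
   theorem on segments a derivative cannot jump between them. *)
Lemma sn'_continuous_neq0 (z : C) : ~ is_pole sn z -> w z <> 0 -> Clim (near z) w (w z).
Proof.
intros hz hw e0 he0.
assert (hw0 : (0 < Cmod (w z))%R) by now apply Cmod_gt_0.
set (e := Rmin e0 (Cmod (w z) / 2)).
assert (he : (0 < e)%R) by (apply Rmin_pos; lra).
assert (he2 : (e <= Cmod (w z) / 2)%R) by apply Rmin_r.
assert (he1 : (e <= e0)%R) by apply Rmin_l.
assert (hball : near z (fun v => ~ is_pole sn v /\
    ((Cmod (w v - w z) < e)%R \/ (Cmod (- w v - w z) < e)%R))).
{ assert (hee : (0 < e * e)%R) by nra.
  generalize (filter_and _ _ (near_not_pole _ hz)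
    (Clim_quartic k _ _ (sn_continuous _ hz) _ hee)).
  apply filter_imp. intros v [hv1 hv2]. split; [exact hv1|].
  rewrite <- (sn_ode v hv1), <- (sn_ode z hz) in hv2.
  replace (w v ^ 2 - w z ^ 2) with (- (w v - w z) * (- w v - w z)) in hv2 by ring.
  rewrite Cmod_mult, Cmod_opp in hv2.
  destruct (Rlt_le_dec (Cmod (w v - w z)) e) as [h|h]; [now left|right].
  apply Rnot_le_lt. intro h'. apply (Rlt_irrefl (e * e)).
  eapply Rle_lt_trans; [|exact hv2]. apply Rmult_le_compat; lra. }
apply near_iff in hball. destruct hball as [r [hr0 hr]].
apply near_iff. exists r. split; [exact hr0|]. intros v hv.
destruct (hr v hv) as [_ [h|h]]; [lra|exfalso].
assert (hzz : (Cmod (z - z) < r)%R).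
{ replace (z - z) with (0 : C) by ring. now rewrite Cmod_0. }
assert (hneg : forall l, (Cmod (- l - w z) < e)%R -> (Re (Cconj (w z) * l) < 0)%R).
{ intros l hl. pose proof (Re_conj_near _ _ _ hw he2 hl) as h1.
  replace (Re (Cconj (w z) * - l)) with (- Re (Cconj (w z) * l))%R in h1 by (simpl; ring). lra. }
destruct (classic (v = z)) as [-> |hvz].
{ pose proof (hneg _ h) as h1. rewrite Cmod_conj_self in h1. nra. }
assert (hd0 : (0 < Cmod (v - z) ^ 2)%R).
{ apply pow_lt. apply Cmod_gt_0. now apply C_sub_neq0. }
destruct (darboux (Re_along sn z v (w z * (v - z)))
  (fun t => (Cmod (v - z) ^ 2 * Re (Cconj (w z) * w (seg z v t)))%R)) as [t [ht ht0]].
- intros t ht. destruct (hr _ (seg_ball _ _ _ _ _ hzz hv ht)) as [hp _].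
  rewrite <- Re_conj_scale. apply Re_along_derive. now apply sn_derive.
- apply Rmult_lt_0_compat; [exact hd0|]. rewrite seg_0, Cmod_conj_self. nra.
- rewrite seg_1. pose proof (hneg _ h). nra.
- assert (ht' : (0 <= t <= 1)%R) by lra.
  destruct (hr _ (seg_ball _ _ _ _ _ hzz hv ht')) as [_ [h1|h1]].
  + pose proof (Re_conj_near _ _ _ hw he2 h1). nra.
  + pose proof (hneg _ h1). nra.
Qed.

Lemma sn'_continuous (z : C) : ~ is_pole sn z -> Clim (near z) w (w z).
Proof.
intro hz. destruct (classic (w z = 0)) as [hw|hw]; [|now apply sn'_continuous_neq0].
intros e he. assert (hee : (0 < e * e)%R) by nra.
generalize (filter_and _ _ (near_not_pole _ hz)
    (Clim_quartic k _ _ (sn_continuous _ hz) _ hee)).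
apply filter_imp. intros v [hv1 hv2]. rewrite <- (sn_ode v hv1), <- (sn_ode z hz), hw in hv2.
rewrite hw. replace (w v - 0) with (w v) by ring.
replace (w v ^ 2 - 0 ^ 2) with (w v * w v) in hv2 by ring. rewrite Cmod_mult in hv2.
pose proof (Cmod_ge_0 (w v)). nra.
Qed.

Lemma sn''_neq0 (z : C) : ~ is_pole sn z -> w z <> 0 -> is_C_derive w z (quartic' k (sn z)).
Proof.
intros hz hw.
replace (quartic' k (sn z)) with (2 * quartic' k (sn z) * w z / (2 * w z))
  by (field; exact hw).
apply is_C_derive_of_sqr; [now apply sn'_continuous|exact hw|].
apply is_C_derive_ext_near with (fun v => quartic k (sn v)).
- generalize (near_not_pole _ hz). apply filter_imp. intros v hv. symmetry. now apply sn_ode.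
- pose proof (is_C_derive_sqr _ _ _ (sn_derive _ hz)) as h1.
  pose proof (is_C_derive_minus _ _ _ _ _ (is_C_derive_const 1 z) h1) as h2.
  pose proof (is_C_derive_minus _ _ _ _ _ (is_C_derive_const 1 z)
    (is_C_derive_mult _ _ _ _ _ (is_C_derive_const (k ^ 2) z) h1)) as h3.
  generalize (is_C_derive_mult _ _ _ _ _ h2 h3). unfold quartic.
  match goal with |- is_C_derive _ _ ?A -> is_C_derive _ _ ?B => replace A with B; [trivial|] end.
  unfold quartic'. ring.
Qed.

Lemma sn'_zero_isolated_aux (z : C) : ~ is_pole sn z -> w z = 0 ->
  near z (fun v => w v = 0) \/ near' z (fun v => w v <> 0).
Proof.
intros hz hw. set (K := quartic' k (sn z)).
assert (hK : K <> 0).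
{ apply quartic_simple_root; [exact k2_neq1|]. rewrite <- sn_ode, hw by exact hz. ring. }
assert (hK0 : (0 < Cmod K)%R) by now apply Cmod_gt_0.
assert (hK1 : (0 < Cmod K / 20)%R) by lra.
pose proof (filter_and _ _ (near_not_pole _ hz)
  (Clim_quartic' k _ _ (sn_continuous _ hz) _ hK1)) as hball. fold K in hball.
apply near_iff in hball. destruct hball as [r [hr0 hr]].
destruct (classic (exists a, (Cmod (a - z) < r)%R /\ w a <> 0)) as [[a [ha hwa]]|hn].
2: { left. apply near_iff. exists r. split; [exact hr0|]. intros v hv. apply NNPP. intro h.
     apply hn. now exists v. }
right.
assert (hdiv : forall v, / K * w v = 0 -> w v = 0).
{ intros v h. replace (w v) with (K * (/ K * w v)) by (field; exact hK). rewrite h. ring. }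
assert (hmul : forall v, w v = 0 -> / K * w v = 0).
{ intros v h. rewrite h. ring. }
assert (haz : a <> z) by (intros ->; tauto).
apply near'_iff. exists (Cmod (a - z)). split.
{ apply Cmod_gt_0. now apply C_sub_neq0. }
intros v hv hva hwv.
apply (isolated_zero (fun v => / K * w v) z r) with a v; auto; try lra.
- intros u hu. apply Clim_mult; [apply Clim_const|]. apply sn'_continuous. now apply hr.
- intros u hu hwu. exists (quartic' k (sn u) / K).
  destruct (hr u hu) as [hu1 hu2]. split.
  + replace (quartic' k (sn u) / K) with (0 * w u + / K * quartic' k (sn u))
      by (field; exact hK).
    refine (is_C_derive_mult (fun _ => / K) w u 0 _ (is_C_derive_const _ _) _).
    apply sn''_neq0; auto.
  + replace (quartic' k (sn u) / K - 1) with ((quartic' k (sn u) - K) / K) by (field; exact hK).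
    rewrite Cmod_div by exact hK. apply Rmult_le_reg_r with (Cmod K); [exact hK0|].
    unfold Rdiv at 1. rewrite Rmult_assoc, Rinv_l by lra. lra.
Qed.

Lemma sn'_zero_isolated (z : C) : ~ is_pole sn z -> near' z (fun v => w v <> 0).
Proof.
intro hz.
assert (hflat : ~ near z (fun v => w v = 0)).
{ intro h.
  assert (h0 : near (RtoC 0) (fun v => w v = 0)).
  { refine (loc_const_off_discrete (is_pole sn) (fun z => near z (fun v => w v = 0)) _ _ z 0 hz
      not_pole_0 h).
    - apply near'_not_pole.
    - intros x hx. destruct (classic (w x = 0)) as [hw|hw].
      + destruct (sn'_zero_isolated_aux x hx hw) as [h1|h1].
        * left. now apply near_near.
        * right. apply near_of_near'.
          -- generalize h1. apply filter_imp. intros v hv hv'. exact (hv (near_self _ _ hv')).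
          -- intro h2. destruct (filter_ex _ (filter_and _ _ h1 (near_near' _ _ h2))). tauto.
      + right. generalize (Clim_neq _ _ _ (sn'_continuous x hx) hw). apply filter_imp.
        intros v hv hv'. exact (hv (near_self _ _ hv')). }
  apply near_self in h0. rewrite sn'_0 in h0. apply RtoC_inj in h0. lra. }
destruct (classic (w z = 0)) as [hw|hw].
- destruct (sn'_zero_isolated_aux z hz hw); tauto.
- apply near_near'. exact (Clim_neq _ _ _ (sn'_continuous z hz) hw).
Qed.

Lemma sn'' (z : C) : ~ is_pole sn z -> is_C_derive w z (quartic' k (sn z)).
Proof.
intro hz. apply is_C_derive_Clim. intros e he. assert (he2 : (0 < e / 2)%R) by lra.
pose proof (filter_and _ _ (sn'_zero_isolated z hz) (near_near' _ _ (filter_and _ _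
  (near_not_pole _ hz) (Clim_quartic' k _ _ (sn_continuous _ hz) _ he2)))) as hball.
apply near'_iff in hball. destruct hball as [r [hr0 hr]].
apply near'_iff. exists r. split; [exact hr0|]. intros v hv hvr.
assert (hvz : v - z <> 0) by now apply C_sub_neq0.
assert (hvz' : (0 < Cmod (v - z))%R) by now apply Cmod_gt_0.
replace ((w v - w z) / (v - z) - quartic' k (sn z))
  with ((w v - w z - quartic' k (sn z) * (v - z)) / (v - z)) by (field; exact hvz).
rewrite Cmod_div by exact hvz. apply Rmult_lt_reg_r with (Cmod (v - z)); [exact hvz'|].
unfold Rdiv. rewrite Rmult_assoc, Rinv_l, Rmult_1_r by lra.
apply Rle_lt_trans with (e / 2 * Cmod (v - z))%R; [|nra].
assert (hseg : forall t, (0 < t <= 1)%R -> seg z v t <> z /\ (Cmod (seg z v t - z) < r)%R).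
{ intros t ht. split.
  - intro h. assert (h1 : RtoC t * (v - z) = 0).
    { replace (RtoC t * (v - z)) with (seg z v t - z) by (unfold seg; ring). rewrite h. ring. }
    apply Cmult_integral in h1. destruct h1 as [h1|h1]; [apply RtoC_inj in h1; lra|tauto].
  - apply seg_ball; [|exact hvr|lra]. replace (z - z) with (0 : C) by ring. now rewrite Cmod_0. }
apply mean_value_bound; [lra| |].
- intros t ht. apply sn'_continuous. destruct (Rle_lt_or_eq_dec 0 t (proj1 ht)) as [h| <-].
  + destruct (hseg t ltac:(lra)) as [h1 h2]. now apply hr.
  + now rewrite seg_0.
- intros t ht. destruct (hseg t ltac:(lra)) as [h1 h2]. destruct (hr _ h1 h2) as [h3 [h4 h5]].
  exists (quartic' k (sn (seg z v t))). split; [now apply sn''_neq0|lra].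
Qed.

Lemma sn_isolated_value (z c : C) : ~ is_pole sn z -> near' z (fun v => sn v <> c).
Proof.
intro hz. destruct (classic (sn z = c)) as [<- |hc].
2: { apply near_near'. exact (Clim_neq _ _ _ (sn_continuous z hz) hc). }
destruct (classic (w z = 0)) as [hw|hw].
- generalize (filter_and _ _ (sn'_zero_isolated z hz) (near_near' _ _ (near_not_pole _ hz))).
  apply filter_imp. intros v [h1 h2] h3. apply h1. pose proof (sn_ode v h2) as h4.
  rewrite h3, <- (sn_ode z hz), hw in h4. replace (w v ^ 2) with (w v * w v) in h4 by ring.
  replace (0 ^ 2 : C) with (0 : C) in h4 by ring.
  apply Cmult_integral in h4. tauto.
- pose proof (proj1 (is_C_derive_Clim _ _ _) (sn_derive z hz)) as h.
  generalize (Clim_neq _ _ _ h hw). apply filter_imp. intros v hv h1. apply hv. rewrite h1.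
  unfold Cdiv. ring.
Qed.

End Regularity.

(** * The addition theorem *)

Lemma linear_ode_dichotomy (g : nat -> C -> C) (z0 : C) (M : R) :
  let N := fun v => (Cmod (g 0%nat v) + Cmod (g 1%nat v) + Cmod (g 2%nat v))%R in
  near z0 (fun v => forall i, (i < 3)%nat ->
    exists l, is_C_derive (g i) v l /\ (Cmod l <= M * N v)%R) ->
  near z0 (fun v => N v = 0%R) \/ near z0 (fun v => N v <> 0%R).
Proof.
intros N h.
assert (hN0 : forall v, (0 <= N v)%R).
{ intro v. unfold N. pose proof (Cmod_ge_0 (g 0%nat v)). pose proof (Cmod_ge_0 (g 1%nat v)).
  pose proof (Cmod_ge_0 (g 2%nat v)). lra. }
set (B := (N z0 + 3)%R).
assert (hB : near z0 (fun v => (N v <= B)%R)).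
{ assert (hb : forall i, (i < 3)%nat -> near z0 (fun v => (Cmod (g i v) < Cmod (g i z0) + 1)%R)).
  { intros i hi. destruct (near_self _ _ h i hi) as [l [hl _]].
    exact (Clim_bounded _ _ (is_C_derive_continuous _ _ _ hl)). }
  pose proof (hb 0%nat ltac:(lia)) as b0. pose proof (hb 1%nat ltac:(lia)) as b1.
  pose proof (hb 2%nat ltac:(lia)) as b2. generalize (filter_and _ _ b0 (filter_and _ _ b1 b2)).
  apply filter_imp. intros v [h0 [h1 h2]]. unfold B, N. lra. }
assert (hball := filter_and _ _ h hB). apply near_iff in hball. destruct hball as [r1 [hr1 hr]].
set (M' := (Rabs M + 1)%R).
assert (hM' : (1 <= M')%R) by (unfold M'; pose proof (Rabs_pos M); lra).
assert (hMM : (M <= M')%R) by (unfold M'; pose proof (Rle_abs M); lra).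
set (r := Rmin r1 (/ (12 * M'))).
assert (hr0 : (0 < r)%R) by (apply Rmin_pos; [lra|]; apply Rinv_0_lt_compat; lra).
assert (hrr1 : (r <= r1)%R) by apply Rmin_l.
assert (hrM : (r * (12 * M') <= 1)%R).
{ replace 1%R with (/ (12 * M') * (12 * M'))%R by (field; lra).
  apply Rmult_le_compat_r; [lra|apply Rmin_r]. }
destruct (classic (exists q, (Cmod (q - z0) < r)%R /\ N q = 0%R)) as [[q [hq hNq]]|hn].
2: { right. apply near_iff. exists r. split; [exact hr0|]. intros v hv hNv. apply hn. now exists v. }
left. apply near_iff. exists r. split; [exact hr0|].
assert (hq0 : forall i, (i < 3)%nat -> g i q = 0).
{ intros i hi. apply Cmod_eq_0. pose proof (Cmod_ge_0 (g 0%nat q)).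
  pose proof (Cmod_ge_0 (g 1%nat q)). pose proof (Cmod_ge_0 (g 2%nat q)). unfold N in hNq.
  destruct i as [|[|[|i]]]; [lra|lra|lra|lia]. }
assert (hhalf : forall n v, (Cmod (v - z0) < r)%R -> (N v <= B * (/ 2) ^ n)%R).
{ induction n as [|n IH]; intros v hv.
  { simpl. rewrite Rmult_1_r. apply (hr v). lra. }
  assert (hBn : (0 <= B * (/ 2) ^ n)%R) by (eapply Rle_trans; [apply (hN0 q)|apply IH; exact hq]).
  assert (hi : forall i, (i < 3)%nat -> (Cmod (g i v) <= / 6 * (B * (/ 2) ^ n))%R).
  { intros i hi.
    assert (h1 : (Cmod (g i v - g i q - 0 * (v - q)) <= M' * (B * (/ 2) ^ n) * Cmod (v - q))%R).
    { apply mean_value_bound; [nra| |].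
      - intros t ht. pose proof (seg_ball _ _ _ _ _ hq hv ht) as hs.
        destruct (proj1 (hr (seg q v t) ltac:(lra)) i hi) as [l [hl _]].
        exact (is_C_derive_continuous _ _ _ hl).
      - intros t ht. assert (ht' : (0 <= t <= 1)%R) by lra.
        pose proof (seg_ball _ _ _ _ _ hq hv ht') as hs.
        destruct (proj1 (hr (seg q v t) ltac:(lra)) i hi) as [l [hl1 hl2]].
        exists l. split; [exact hl1|]. replace (l - 0) with l by ring.
        specialize (IH _ hs). specialize (hN0 (seg q v t)). nra. }
    rewrite hq0 in h1 by exact hi. replace (g i v - 0 - 0 * (v - q)) with (g i v) in h1 by ring.
    assert (h2 : (Cmod (v - q) <= 2 * r)%R).
    { replace (v - q) with ((v - z0) + - (q - z0)) by ring.
      eapply Rle_trans; [apply Cmod_triangle|]. rewrite Cmod_opp. lra. }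
    eapply Rle_trans; [exact h1|].
    apply Rle_trans with (M' * (B * (/ 2) ^ n) * (2 * r))%R.
    - apply Rmult_le_compat_l; [nra|exact h2].
    - replace (M' * (B * (/ 2) ^ n) * (2 * r))%R with (/ 6 * (B * (/ 2) ^ n) * (r * (12 * M')))%R
        by field.
      nra. }
  pose proof (hi 0%nat ltac:(lia)). pose proof (hi 1%nat ltac:(lia)).
  pose proof (hi 2%nat ltac:(lia)). unfold N. simpl. lra. }
intros v hv. apply Rle_antisym; [|apply hN0]. apply Rnot_lt_le. intro hpos.
assert (hB0 : (0 < B)%R) by (unfold B; specialize (hN0 z0); lra).
destruct (pow_lt_1_zero (/ 2) ltac:(rewrite Rabs_pos_eq; lra) (N v / B)) as [n hn].
{ apply Rdiv_lt_0_compat; lra. }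
specialize (hn n (le_n n)). rewrite Rabs_pos_eq in hn by (apply pow_le; lra).
specialize (hhalf n v hv).
assert (B * (/ 2) ^ n < B * (N v / B))%R by (apply Rmult_lt_compat_l; lra).
replace (B * (N v / B))%R with (N v) in H by (field; lra). lra.
Qed.

Section Addition.
Context (k : C) (sn : C -> C).
Hypothesis sn_jacobi : is_jacobi_sn k sn.
Hypothesis k2_neq1 : k ^ 2 <> 1.

Notation sn' := (C_derive sn).

(* With [x = sn z], [y = sn (z + p)], [s = sn p], [m = sn' p], these are the formulas for
   [sn (z + p)], [sn ((z + p) - p)] and [sn ((z + p) - z)], cleared of denominators.  Along the
   flow their left-hand sides satisfy a homogeneous linear system. *)
Definition addition_defect (s m x x' y y' : C) (i : nat) : C :=
  match i with
  | O => y * (1 - k ^ 2 * s ^ 2 * x ^ 2) - m * x - s * x'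
  | S O => x * (1 - k ^ 2 * s ^ 2 * y ^ 2) - m * y + s * y'
  | _ => s * (1 - k ^ 2 * x ^ 2 * y ^ 2) - (x' * y - x * y')
  end.

Lemma not_pole_of_lim (z l : C) : Clim (near' z) sn l -> ~ is_pole sn z /\ sn z = l.
Proof.
intro h. assert (hz : ~ is_pole sn z).
{ intros [_ hp]. exact (Clim_not_infty _ _ h hp). }
split; [exact hz|].
exact (Clim_unique _ _ _ (Clim_near' _ _ _ (sn_continuous _ _ sn_jacobi z hz)) h).
Qed.

Lemma not_pole_of_lim_shift (z d l : C) : Clim (near' z) (fun v => sn (v + d)) l ->
  ~ is_pole sn (z + d) /\ sn (z + d) = l.
Proof.
intro h. apply not_pole_of_lim.
assert (h' : Clim (near' (z + d + - d)) (fun v => sn (v + d)) l).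
{ now replace (z + d + - d) with z by ring. }
generalize (Clim_near'_shift _ _ _ _ h'). apply Clim_ext_near. apply filter_forall.
intro v. f_equal. ring.
Qed.

Section Translation.
Context (p : C).
Hypothesis p_not_pole : ~ is_pole sn p.
Hypothesis p_neq0 : sn p <> 0.

Let G (i : nat) (z : C) : C :=
  addition_defect (sn p) (sn' p) (sn z) (sn' z) (sn (z + p)) (sn' (z + p)) i.

Lemma addition_defect_derive (z : C) : ~ is_pole sn z -> ~ is_pole sn (z + p) ->
  let x := sn z in let y := sn (z + p) in let s := sn p in let m := sn' p in
  is_C_derive (G 0) z (((k ^ 2 * s ^ 2 * x * y + m) * G 0 z +
    (1 - 2 * k ^ 2 * s ^ 2 * x ^ 2) * G 1 z + k ^ 2 * s ^ 3 * x * G 2 z) / s) /\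
  is_C_derive (G 1) z (((2 * k ^ 2 * s ^ 2 * y ^ 2 - 1) * G 0 z -
    (k ^ 2 * s ^ 2 * x * y + m) * G 1 z - k ^ 2 * s ^ 3 * y * G 2 z) / s) /\
  is_C_derive (G 2) z (2 * k ^ 2 * x * y * (y * G 0 z - x * G 1 z)).
Proof.
intros hz hzp x y s m.
pose proof (sn_derive _ _ sn_jacobi z hz) as dx.
pose proof (sn'' _ _ sn_jacobi k2_neq1 z hz) as dx'.
pose proof (is_C_derive_shift _ _ _ _ (sn_derive _ _ sn_jacobi _ hzp)) as dy.
pose proof (is_C_derive_shift _ _ _ _ (sn'' _ _ sn_jacobi k2_neq1 _ hzp)) as dy'.
pose proof (is_C_derive_sqr _ _ _ dx) as dx2.
pose proof (is_C_derive_sqr _ _ _ dy) as dy2.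
pose proof (sn_ode _ _ sn_jacobi p p_not_pole) as hm.
assert (dc : forall a, is_C_derive (fun _ => a) z 0) by (intro a; apply is_C_derive_const).
fold x y s m in dx, dx', dy, dy', dx2, dy2, hm |- *.
assert (hs : s <> 0) by exact p_neq0.
assert (hm' : m * m = quartic k s) by (rewrite <- hm; ring).
split; [|split].
- generalize (is_C_derive_minus _ _ _ _ _ (is_C_derive_minus _ _ _ _ _
    (is_C_derive_mult _ _ _ _ _ dy (is_C_derive_minus _ _ _ _ _ (dc 1)
      (is_C_derive_mult _ _ _ _ _ (dc (k ^ 2 * s ^ 2)) dx2)))
    (is_C_derive_mult _ _ _ _ _ (dc m) dx)) (is_C_derive_mult _ _ _ _ _ (dc s) dx')).
  match goal with |- is_C_derive _ _ ?A -> is_C_derive _ _ ?B => replace A with B; [trivial|] end.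
  unfold G, addition_defect. fold x y s m.
  match goal with |- ?A / s = ?B => replace A with (s * B); [field; exact hs|] end.
  fold x y. unfold quartic'.
  apply C_sub_eq0.
  match goal with |- ?A = RtoC 0 => transitivity (x * (m * m - quartic k s)) end;
    [unfold quartic; ring|rewrite hm'; ring].
- generalize (is_C_derive_plus _ _ _ _ _ (is_C_derive_minus _ _ _ _ _
    (is_C_derive_mult _ _ _ _ _ dx (is_C_derive_minus _ _ _ _ _ (dc 1)
      (is_C_derive_mult _ _ _ _ _ (dc (k ^ 2 * s ^ 2)) dy2)))
    (is_C_derive_mult _ _ _ _ _ (dc m) dy)) (is_C_derive_mult _ _ _ _ _ (dc s) dy')).
  match goal with |- is_C_derive _ _ ?A -> is_C_derive _ _ ?B => replace A with B; [trivial|] end.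
  unfold G, addition_defect. fold x y s m.
  match goal with |- ?A / s = ?B => replace A with (s * B); [field; exact hs|] end.
  fold x y. unfold quartic'.
  apply C_sub_eq0.
  match goal with |- ?A = RtoC 0 => transitivity (- y * (m * m - quartic k s)) end;
    [unfold quartic; ring|rewrite hm'; ring].
- generalize (is_C_derive_minus _ _ _ _ _
    (is_C_derive_mult _ _ _ _ _ (dc s) (is_C_derive_minus _ _ _ _ _ (dc 1)
      (is_C_derive_mult _ _ _ _ _ (is_C_derive_mult _ _ _ _ _ (dc (k ^ 2)) dx2) dy2)))
    (is_C_derive_minus _ _ _ _ _ (is_C_derive_mult _ _ _ _ _ dx' dy)
      (is_C_derive_mult _ _ _ _ _ dx dy'))).
  match goal with |- is_C_derive _ _ ?A -> is_C_derive _ _ ?B => replace A with B; [trivial|] end.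
  unfold G, addition_defect. fold x y s m. unfold quartic'. ring.
Qed.

Lemma addition_dichotomy (z : C) : ~ is_pole sn z -> ~ is_pole sn (z + p) ->
  let N := fun v => (Cmod (G 0 v) + Cmod (G 1 v) + Cmod (G 2 v))%R in
  near z (fun v => N v = 0%R) \/ near z (fun v => N v <> 0%R).
Proof.
intros hz hzp N.
set (x := sn z). set (y := sn (z + p)). set (s := sn p). set (m := sn' p).
assert (hs : s <> 0) by exact p_neq0.
assert (cx : Clim (near z) sn x) by (apply (sn_continuous _ _ sn_jacobi); exact hz).
assert (cy : Clim (near z) (fun v => sn (v + p)) y).
{ apply Clim_near_shift. exact (sn_continuous _ _ sn_jacobi _ hzp). }
assert (hc : exists M, (0 <= M)%R /\ near z (fun v =>
  (Cmod ((k ^ 2 * s ^ 2 * sn v * sn (v + p) + m) / s) <= M)%R /\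
  (Cmod ((1 - 2 * k ^ 2 * s ^ 2 * sn v ^ 2) / s) <= M)%R /\
  (Cmod (k ^ 2 * s ^ 3 * sn v / s) <= M)%R /\
  (Cmod ((2 * k ^ 2 * s ^ 2 * sn (v + p) ^ 2 - 1) / s) <= M)%R /\
  (Cmod (k ^ 2 * s ^ 3 * sn (v + p) / s) <= M)%R /\
  (Cmod (2 * k ^ 2 * sn v * sn (v + p) * sn (v + p)) <= M)%R /\
  (Cmod (2 * k ^ 2 * sn v * sn (v + p) * sn v) <= M)%R)).
{ assert (hb : forall g l, Clim (near z) g l -> exists M, (0 <= M)%R /\
    near z (fun v => (Cmod (g v) <= M)%R)).
  { intros g l hg. exists (Cmod l + 1)%R. split; [pose proof (Cmod_ge_0 l); lra|].
    generalize (Clim_bounded _ _ hg). apply filter_imp. intros v hv. lra. }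
  assert (hand : forall Q1 Q2 : R -> C -> Prop,
    (forall M M' v, (M <= M')%R -> Q1 M v -> Q1 M' v) ->
    (forall M M' v, (M <= M')%R -> Q2 M v -> Q2 M' v) ->
    (exists M, (0 <= M)%R /\ near z (Q1 M)) -> (exists M, (0 <= M)%R /\ near z (Q2 M)) ->
    exists M, (0 <= M)%R /\ near z (fun v => Q1 M v /\ Q2 M v)).
  { intros Q1 Q2 h1 h2 [M1 [hM1 hQ1]] [M2 [hM2 hQ2]]. exists (Rmax M1 M2).
    split; [eapply Rle_trans; [exact hM1|apply Rmax_l]|].
    generalize (filter_and _ _ hQ1 hQ2). apply filter_imp. intros v [h3 h4].
    split; [exact (h1 _ _ _ (Rmax_l _ _) h3)|exact (h2 _ _ _ (Rmax_r _ _) h4)]. }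
  repeat (apply (hand (fun M v => (Cmod _ <= M)%R)); [intros; lra|intros; intuition lra| |]);
  eapply hb;
  repeat first [exact cx | exact cy | apply Clim_pow; first [exact cx | exact cy] |
    apply Clim_const | apply Clim_minus | apply Clim_plus | apply Clim_mult | apply Clim_div]. }
destruct hc as [M [hM0 hM]].
apply linear_ode_dichotomy with M.
generalize (filter_and _ _ hM (filter_and _ _ (near_not_pole _ _ sn_jacobi _ hz)
  (near_shift _ _ (fun u => ~ is_pole sn u) (near_not_pole _ _ sn_jacobi _ hzp)))).
apply filter_imp. intros v [[h1 [h2 [h3 [h4 [h5 [h6 h7]]]]]] [hv hvp]] i hi.
destruct (addition_defect_derive v hv hvp) as [d0 [d1 d2]]. fold s m in d0, d1, d2.
assert (hterm : forall a b, (Cmod a <= M)%R -> (Cmod (a * b) <= M * Cmod b)%R).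
{ intros a b ha. rewrite Cmod_mult. apply Rmult_le_compat_r; [apply Cmod_ge_0|exact ha]. }
assert (htri : forall a b c, (Cmod (a + b + c) <= Cmod a + Cmod b + Cmod c)%R).
{ intros a b c. eapply Rle_trans; [apply Cmod_triangle|].
  apply Rplus_le_compat_r. apply Cmod_triangle. }
fold (N v).
destruct i as [|[|[|i]]]; [| | |lia].
- eexists. split; [exact d0|].
  match goal with |- (Cmod (?A / s) <= _)%R => replace (A / s) with
    ((k ^ 2 * s ^ 2 * sn v * sn (v + p) + m) / s * G 0 v +
     (1 - 2 * k ^ 2 * s ^ 2 * sn v ^ 2) / s * G 1 v + k ^ 2 * s ^ 3 * sn v / s * G 2 v)
    by (unfold Cdiv; ring) end.
  eapply Rle_trans; [apply htri|]. unfold N. rewrite !Rmult_plus_distr_l.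
  repeat apply Rplus_le_compat; now apply hterm.
- eexists. split; [exact d1|].
  match goal with |- (Cmod (?A / s) <= _)%R => replace (A / s) with
    ((2 * k ^ 2 * s ^ 2 * sn (v + p) ^ 2 - 1) / s * G 0 v +
     (k ^ 2 * s ^ 2 * sn v * sn (v + p) + m) / s * - G 1 v +
     k ^ 2 * s ^ 3 * sn (v + p) / s * - G 2 v)
    by (unfold Cdiv; ring) end.
  eapply Rle_trans; [apply htri|]. unfold N. rewrite !Rmult_plus_distr_l.
  rewrite <- (Cmod_opp (G 1 v)), <- (Cmod_opp (G 2 v)).
  repeat apply Rplus_le_compat; now apply hterm.
- eexists. split; [exact d2|].
  match goal with |- (Cmod ?A <= _)%R => replace A with
    (2 * k ^ 2 * sn v * sn (v + p) * sn (v + p) * G 0 v +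
     2 * k ^ 2 * sn v * sn (v + p) * sn v * - G 1 v + 0)
    by ring end.
  eapply Rle_trans; [apply htri|]. unfold N. rewrite !Rmult_plus_distr_l, Cmod_0.
  rewrite <- (Cmod_opp (G 1 v)).
  pose proof (hterm _ (G 0 v) h6). pose proof (hterm _ (- G 1 v) h7).
  pose proof (Cmod_ge_0 (G 2 v)).
  assert (0 <= M * Cmod (G 2 v))%R by (apply Rmult_le_pos; assumption). lra.
Qed.

Lemma addition (z : C) : ~ is_pole sn z -> ~ is_pole sn (z + p) ->
  forall i, (i < 3)%nat ->
  addition_defect (sn p) (sn' p) (sn z) (sn' z) (sn (z + p)) (sn' (z + p)) i = 0.
Proof.
intros hz hzp.
assert (h : (Cmod (G 0 z) + Cmod (G 1 z) + Cmod (G 2 z) = 0)%R).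
{ refine (loc_const_off_discrete (fun v => is_pole sn v \/ is_pole sn (v + p))
    (fun v => (Cmod (G 0 v) + Cmod (G 1 v) + Cmod (G 2 v) = 0)%R) _ _ 0 z _ _ _).
  - intro v. generalize (filter_and _ _ (near'_not_pole _ _ sn_jacobi v)
      (near'_shift _ _ (fun u => ~ is_pole sn u) (near'_not_pole _ _ sn_jacobi (v + p)))).
    apply filter_imp. tauto.
  - intros v hv. apply addition_dichotomy; tauto.
  - rewrite Cplus_0_l. intros [h|h]; [|tauto]. exact (not_pole_0 _ _ sn_jacobi h).
  - tauto.
  - unfold G, addition_defect. rewrite Cplus_0_l, (jacobi_sn_0 _ _ sn_jacobi), (sn'_0 _ _ sn_jacobi).
    match goal with |- (Cmod ?A + Cmod ?B + Cmod ?D = _)%R =>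
      replace A with (RtoC 0) by ring; replace B with (RtoC 0) by ring;
      replace D with (RtoC 0) by ring end.
    rewrite Cmod_0. ring. }
pose proof (Cmod_ge_0 (G 0 z)). pose proof (Cmod_ge_0 (G 1 z)). pose proof (Cmod_ge_0 (G 2 z)).
intros i hi. change (G i z = 0). apply Cmod_eq_0.
destruct i as [|[|[|i]]]; [lra|lra|lra|lia].
Qed.

Lemma addition_formula (z : C) : ~ is_pole sn z -> ~ is_pole sn (z + p) ->
  sn (z + p) * (1 - k ^ 2 * sn p ^ 2 * sn z ^ 2) = sn' p * sn z + sn p * sn' z.
Proof.
intros hz hzp. pose proof (addition z hz hzp 0%nat ltac:(lia)) as h. unfold addition_defect in h.
apply C_sub_eq0. rewrite <- h. ring.
Qed.

Lemma sn_odd : ~ is_pole sn (- p) /\ sn (- p) = - sn p /\ sn' (- p) = sn' p.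
Proof.
pose proof (not_pole_0 _ _ sn_jacobi) as h0.
assert (hp0 : - p + p = 0) by ring.
assert (hlim : Clim (near' (- p)) sn (- sn p)).
{ assert (c0 : Clim (near' (- p)) (fun v => sn (v + p)) 0).
  { apply Clim_near'_shift, Clim_near'. rewrite hp0.
    pose proof (sn_continuous _ _ sn_jacobi 0 h0) as h.
    rewrite (jacobi_sn_0 _ _ sn_jacobi) in h. exact h. }
  assert (c1 : Clim (near' (- p)) (fun v => sn' (v + p)) 1).
  { apply Clim_near'_shift, Clim_near'. rewrite hp0.
    pose proof (sn'_continuous _ _ sn_jacobi 0 h0) as h.
    rewrite (sn'_0 _ _ sn_jacobi) in h. exact h. }
  assert (cY : Clim (near' (- p)) (fun v => 1 - k ^ 2 * sn p ^ 2 * sn (v + p) ^ 2) 1).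
  { generalize (Clim_minus _ _ _ _ (Clim_const 1)
      (Clim_mult _ _ _ _ (Clim_const (k ^ 2 * sn p ^ 2)) (Clim_pow _ _ 2 c0))).
    now replace (1 - k ^ 2 * sn p ^ 2 * 0 ^ 2) with (1 : C) by ring. }
  assert (h1 : (1 : C) <> 0) by (intro e; apply RtoC_inj in e; lra).
  generalize (Clim_div _ _ _ _ (Clim_minus _ _ _ _ (Clim_mult _ _ _ _ (Clim_const (sn' p)) c0)
    (Clim_mult _ _ _ _ (Clim_const (sn p)) c1)) cY h1).
  replace ((sn' p * 0 - sn p * 1) / 1) with (- sn p) by field.
  apply Clim_ext_near.
  assert (hnp : near' (- p) (fun v => ~ is_pole sn (v + p))).
  { exact (near'_shift _ _ (fun u => ~ is_pole sn u) (near'_not_pole _ _ sn_jacobi _)). }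
  generalize (filter_and _ _ (Clim_neq _ _ _ cY h1)
    (filter_and _ _ (near'_not_pole _ _ sn_jacobi (- p)) hnp)).
  apply filter_imp. intros v [hY [hv hvp]].
  pose proof (addition v hv hvp 1%nat ltac:(lia)) as h. unfold addition_defect in h.
  transitivity (sn v * (1 - k ^ 2 * sn p ^ 2 * sn (v + p) ^ 2) /
    (1 - k ^ 2 * sn p ^ 2 * sn (v + p) ^ 2)).
  2: { revert hY. generalize (1 - k ^ 2 * sn p ^ 2 * sn (v + p) ^ 2). intros Y hY.
       field. exact hY. }
  f_equal. symmetry. apply C_sub_eq0. rewrite <- h. ring. }
destruct (not_pole_of_lim _ _ hlim) as [hp hval].
repeat split; [exact hp|exact hval|].
assert (hp0' : ~ is_pole sn (- p + p)) by now rewrite hp0.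
pose proof (addition_formula (- p) hp hp0') as h.
rewrite hp0, (jacobi_sn_0 _ _ sn_jacobi), hval in h.
assert (h1 : sn p * (sn' (- p) - sn' p) = 0).
{ transitivity (sn' p * - sn p + sn p * sn' (- p)); [ring|]. rewrite <- h. ring. }
apply Cmult_integral in h1. destruct h1 as [h1|h1]; [tauto|]. now apply C_sub_eq0.
Qed.

End Translation.

End Addition.

(** * Surjectivity of sn *)

Lemma R_bounded_adherent (u : nat -> R) (r : R) :
  (forall n, (Rabs (u n) <= r)%R) ->
  exists l, forall e N, (0 < e)%R -> exists n, (N <= n)%nat /\ (Rabs (u n - l) < e)%R.
Proof.
intro h. destruct (Bolzano_Weierstrass u _ (compact_P3 (- r) r)) as [l hl].
{ intro n. specialize (h n). pose proof (Rle_abs (u n)). pose proof (Rle_abs (- u n)).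
  rewrite Rabs_Ropp in *. lra. }
exists l. intros e N he.
apply (hl (fun x => (Rabs (x - l) < e)%R) N). exists (mkposreal e he). intros x hx. exact hx.
Qed.

Lemma Cmod_le_Re_Im (z : C) : (Cmod z <= Rabs (fst z) + Rabs (snd z))%R.
Proof.
replace z with (RtoC (fst z) + RtoC (snd z) * Ci) at 1
  by (apply injective_projections; simpl; ring).
eapply Rle_trans; [apply Cmod_triangle|]. rewrite Cmod_mult, !Cmod_R, Cmod_Ci. lra.
Qed.

Lemma C_bounded_adherent (u : nat -> C) (r : R) :
  (forall n, (Cmod (u n) <= r)%R) ->
  exists l, forall e N, (0 < e)%R -> exists n, (N <= n)%nat /\ (Cmod (u n - l) < e)%R.
Proof.
intro h.
destruct (R_bounded_adherent (fun n => fst (u n)) r) as [l1 hl1].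
{ intro n. eapply Rle_trans; [|apply h]. eapply Rle_trans; [|apply Rmax_Cmod]. apply Rmax_l. }
destruct (functional_choice (fun n m => (n <= m)%nat /\ (Rabs (fst (u m) - l1) < / (INR n + 1))%R))
  as [f hf].
{ intro n. apply hl1. apply Rinv_0_lt_compat. pose proof (pos_INR n). lra. }
destruct (R_bounded_adherent (fun n => snd (u (f n))) r) as [l2 hl2].
{ intro n. eapply Rle_trans; [|apply (h (f n))]. eapply Rle_trans; [|apply Rmax_Cmod].
  apply Rmax_r. }
exists (l1, l2). intros e N he.
destruct (archimed_cor1 (e / 2)) as [N1 [hN1 hN1']]; [lra|].
destruct (hl2 (e / 2)%R (N + N1)%nat) as [n [hn1 hn2]]; [lra|].
destruct (hf n) as [hf1 hf2]. exists (f n). split; [lia|].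
eapply Rle_lt_trans; [apply Cmod_le_Re_Im|]. simpl.
assert (h3 : (/ (INR n + 1) <= / INR N1)%R).
{ apply Rinv_le_contravar; [now apply lt_0_INR|].
  assert (INR N1 <= INR n)%R by (apply le_INR; lia). lra. }
unfold Rminus in *. lra.
Qed.

Lemma min_attained (Q : C -> Prop) (phi : C -> R) (r : R) :
  (exists u, Q u) -> (forall u, Q u -> (Cmod u <= r)%R) ->
  (forall l, (forall e, (0 < e)%R -> exists u, Q u /\ (Cmod (u - l) < e)%R) -> Q l) ->
  (forall u, Q u -> (0 <= phi u)%R) ->
  (forall u e, Q u -> (0 < e)%R -> near u (fun v => Q v -> (phi u < phi v + e)%R)) ->
  exists u, Q u /\ forall v, Q v -> (phi u <= phi v)%R.
Proof.
intros [u0 hu0] hb hcl hpos hcont.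
destruct (completeness (fun x => exists u, Q u /\ x = (- phi u)%R)) as [I [hI1 hI2]].
{ exists 0%R. intros x [u [hu ->]]. specialize (hpos u hu). lra. }
{ now exists (- phi u0)%R, u0. }
destruct (functional_choice (fun (n : nat) u => Q u /\ (phi u < - I + / (INR n + 1))%R)) as [s hs].
{ intro n. apply NNPP. intro hn.
  assert (hp : (0 < / (INR n + 1))%R).
  { apply Rinv_0_lt_compat. pose proof (pos_INR n). lra. }
  assert (I <= I - / (INR n + 1))%R; [|lra].
  apply hI2. intros x [u [hu ->]]. apply Rnot_lt_le. intro hlt. apply hn. exists u.
  split; [exact hu|lra]. }
destruct (C_bounded_adherent s r) as [l hl].
{ intro n. apply hb. apply hs. }
assert (hQl : Q l).
{ apply hcl. intros e he. destruct (hl e 0%nat he) as [n [_ hn]]. exists (s n).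
  split; [apply hs|exact hn]. }
exists l. split; [exact hQl|]. intros v hv.
assert (hv' : (- phi v <= I)%R) by (apply hI1; now exists v).
apply Rnot_lt_le. intro hlt.
assert (he : (0 < (phi l - phi v) / 2)%R) by lra.
pose proof (hcont l _ hQl he) as hc. apply near_iff in hc. destruct hc as [d [hd0 hd]].
destruct (archimed_cor1 _ he) as [N [hN hN']].
destruct (hl d N hd0) as [n [hn1 hn2]]. destruct (hs n) as [hs1 hs2].
specialize (hd _ hn2 hs1).
assert (h3 : (/ (INR n + 1) <= / INR N)%R).
{ apply Rinv_le_contravar; [now apply lt_0_INR|].
  assert (INR N <= INR n)%R by (apply le_INR; lia). lra. }
lra.
Qed.

Section Surjectivity.
Context (k : C) (sn : C -> C).
Hypothesis sn_jacobi : is_jacobi_sn k sn.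
Hypothesis k2_neq1 : k ^ 2 <> 1.

Notation sn' := (C_derive sn).

Let attained (v : C) : Prop := exists u, ~ is_pole sn u /\ sn u = v.

(* Minimize [sqrt |sn u - v2| + c/4 |u - u1|].  At the minimum [sn u = v2], since otherwise moving
   [u] by [h (v2 - sn u) / sn' u] decreases the first term by about [h/2 sqrt |sn u - v2|] and
   increases the second one by at most half of that. *)
Lemma attained_near (u1 v2 : C) (c : R) : (0 < c)%R -> ~ is_pole sn u1 ->
  (forall v, (Cmod (v - v2) <= Cmod (sn u1 - v2))%R ->
    (c ^ 2 * Cmod (v - v2) <= Cmod (quartic k v))%R) ->
  attained v2.
Proof.
intros hc hu1 hlow.
set (D := Cmod (sn u1 - v2)) in *.
assert (hD : (0 <= D)%R) by apply Cmod_ge_0.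
pose proof (sqrt_pos D) as hsD.
set (R0 := (4 * sqrt D / c + 1)%R).
set (Q := fun u => ~ is_pole sn u /\ (Cmod (sn u - v2) <= D)%R /\ (Cmod (u - u1) <= R0)%R).
set (phi := fun u => (sqrt (Cmod (sn u - v2)) + c / 4 * Cmod (u - u1))%R).
assert (hR0 : (0 < R0)%R).
{ unfold R0. assert (0 <= 4 * sqrt D / c)%R; [|lra].
  apply Rmult_le_pos; [lra|]. left. now apply Rinv_0_lt_compat. }
assert (h11 : Cmod (u1 - u1) = 0%R) by (replace (u1 - u1) with (0 : C) by ring; apply Cmod_0).
destruct (min_attained Q phi (Cmod u1 + R0)) as [u [hu hmin]].
- exists u1. repeat split; [exact hu1|apply Rle_refl|lra].
- intros u [_ [_ hu]]. replace u with (u1 + (u - u1)) by ring.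
  eapply Rle_trans; [apply Cmod_triangle|]. lra.
- intros l hl. assert (hlp : ~ is_pole sn l).
  { intro hp. assert (h1 : near' l (fun v => (D + Cmod v2 < Cmod (sn v))%R)).
    { apply (proj2 hp (fun x => (D + Cmod v2 < x)%R)). exists (D + Cmod v2)%R. auto. }
    apply near'_iff in h1. destruct h1 as [d [hd0 hd]].
    destruct (hl d hd0) as [v [[hv1 [hv2 _]] hvl]].
    specialize (hd v ltac:(intros ->; tauto) hvl).
    assert (Cmod (sn v) <= Cmod (sn v - v2) + Cmod v2)%R; [|lra].
    replace (sn v) with ((sn v - v2) + v2) at 1 by ring. apply Cmod_triangle. }
  repeat split; [exact hlp| |]; apply Rnot_lt_le; intro hlt.
  + assert (he : (0 < Cmod (sn l - v2) - D)%R) by lra.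
    pose proof (sn_continuous _ _ sn_jacobi l hlp _ he) as h1. apply near_iff in h1.
    destruct h1 as [d [hd0 hd]]. destruct (hl d hd0) as [v [[hv1 [hv2 _]] hvl]].
    specialize (hd v hvl).
    assert (Cmod (sn l - v2) <= Cmod (sn v - sn l) + Cmod (sn v - v2))%R; [|lra].
    replace (sn l - v2) with (- (sn v - sn l) + (sn v - v2)) by ring.
    eapply Rle_trans; [apply Cmod_triangle|]. rewrite Cmod_opp. lra.
  + assert (he : (0 < Cmod (l - u1) - R0)%R) by lra.
    destruct (hl _ he) as [v [[_ [_ hv]] hvl]].
    assert (Cmod (l - u1) <= Cmod (v - l) + Cmod (v - u1))%R; [|lra].
    replace (l - u1) with (- (v - l) + (v - u1)) by ring.
    eapply Rle_trans; [apply Cmod_triangle|]. rewrite Cmod_opp. lra.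
- intros u _. unfold phi. pose proof (sqrt_pos (Cmod (sn u - v2))).
  pose proof (Cmod_ge_0 (u - u1)). nra.
- intros u e [hup _] he.
  assert (he2 : (0 < (e / 2) * (e / 2))%R) by nra.
  assert (he3 : (0 < e / c)%R) by (apply Rdiv_lt_0_compat; lra).
  generalize (filter_and _ _ (sn_continuous _ _ sn_jacobi u hup _ he2) (Clim_id u _ he3)).
  apply filter_imp. intros v [h1 h2] _. unfold phi.
  assert (h3 : (sqrt (Cmod (sn u - v2)) <= sqrt (Cmod (sn v - v2)) + e / 2)%R).
  { pose proof (sqrt_pos (Cmod (sn v - v2))) as h4.
    apply Rsqr_incr_0; [|apply sqrt_pos|lra].
    rewrite Rsqr_sqrt by apply Cmod_ge_0. rewrite Rsqr_plus, Rsqr_sqrt by apply Cmod_ge_0.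
    assert (Cmod (sn u - v2) <= Cmod (sn v - sn u) + Cmod (sn v - v2))%R.
    { replace (sn u - v2) with (- (sn v - sn u) + (sn v - v2)) by ring.
      eapply Rle_trans; [apply Cmod_triangle|]. rewrite Cmod_opp. lra. }
    unfold Rsqr. nra. }
  assert (h5 : (Cmod (u - u1) <= Cmod (v - u) + Cmod (v - u1))%R).
  { replace (u - u1) with (- (v - u) + (v - u1)) by ring.
    eapply Rle_trans; [apply Cmod_triangle|]. rewrite Cmod_opp. lra. }
  assert (h6 : (c * Cmod (v - u) < e)%R).
  { replace e with (c * (e / c))%R by (field; lra). now apply Rmult_lt_compat_l. }
  nra.
- destruct hu as [hup [huD huR]].
  assert (hint : (Cmod (u - u1) < R0)%R).
  { assert (h1 : (phi u <= phi u1)%R).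
    { apply hmin. repeat split; [exact hu1|apply Rle_refl|lra]. }
    unfold phi in h1. rewrite h11 in h1. fold D in h1.
    pose proof (sqrt_pos (Cmod (sn u - v2))) as h2.
    unfold R0. apply Rle_lt_trans with (4 * sqrt D / c)%R; [|lra].
    apply Rmult_le_reg_l with (c / 4)%R; [lra|].
    replace (c / 4 * (4 * sqrt D / c))%R with (sqrt D) by (field; lra). lra. }
  exists u. split; [exact hup|]. apply NNPP. intro hne.
  set (d := Cmod (sn u - v2)) in *.
  assert (hd : (0 < d)%R) by (apply Cmod_gt_0; now apply C_sub_neq0).
  set (a := sn' u).
  assert (hsd : (0 < sqrt d)%R) by now apply sqrt_lt_R0.
  assert (hsdd : (sqrt d * sqrt d = d)%R) by (apply sqrt_sqrt; lra).
  assert (ha : (c * sqrt d <= Cmod a)%R).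
  { apply Rsqr_incr_0; [|nra|apply Cmod_ge_0].
    replace (Rsqr (Cmod a)) with (Cmod (a ^ 2))
      by (rewrite Cmod_pow; unfold Rsqr; simpl; ring).
    unfold a. rewrite (sn_ode _ _ sn_jacobi u hup).
    eapply Rle_trans; [|apply hlow; exact huD]. unfold Rsqr. fold d. nra. }
  assert (ha0 : (0 < Cmod a)%R) by nra.
  assert (ha1 : a <> 0) by now apply Cmod_gt_0.
  assert (hae : (0 < Cmod a / 4)%R) by lra.
  pose proof (proj1 (is_C_derive_Clim _ _ _) (sn_derive _ _ sn_jacobi u hup) _ hae) as hder.
  assert (hei : (0 < R0 - Cmod (u - u1))%R) by lra.
  pose proof (filter_and _ _ hder (near_near' _ _ (filter_and _ _
    (near_not_pole _ _ sn_jacobi u hup) (Clim_id u _ hei)))) as hball.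
  apply near'_iff in hball. destruct hball as [r [hr0 hr]].
  set (dir := (v2 - sn u) / a).
  assert (hdir : Cmod dir = (d / Cmod a)%R).
  { unfold dir. rewrite Cmod_div by exact ha1.
    replace (v2 - sn u) with (- (sn u - v2)) by ring. now rewrite Cmod_opp. }
  assert (hdirp : (0 < Cmod dir)%R) by (rewrite hdir; apply Rdiv_lt_0_compat; lra).
  set (h := Rmin 1 (r / (2 * Cmod dir))).
  assert (hh0 : (0 < h)%R) by (apply Rmin_pos; [lra|apply Rdiv_lt_0_compat; lra]).
  assert (hh1 : (h <= 1)%R) by apply Rmin_l.
  assert (hhr : (h * Cmod dir < r)%R).
  { apply Rle_lt_trans with (r / (2 * Cmod dir) * Cmod dir)%R.
    - apply Rmult_le_compat_r; [lra|apply Rmin_r].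
    - replace (r / (2 * Cmod dir) * Cmod dir)%R with (r / 2)%R by (field; lra). lra. }
  set (v := u + RtoC h * dir).
  assert (hvu : v - u = RtoC h * dir) by (unfold v; ring).
  assert (hvum : Cmod (v - u) = (h * Cmod dir)%R).
  { rewrite hvu, Cmod_mult, Cmod_R, Rabs_pos_eq by lra. reflexivity. }
  assert (hvu0 : v - u <> 0) by (apply Cmod_gt_0; rewrite hvum; nra).
  assert (hvne : v <> u) by (intro e; apply hvu0; rewrite e; ring).
  destruct (hr v hvne) as [h1 [h2 h3]]; [lra|]. fold a in h1.
  assert (hstep : (Cmod (sn v - v2) <= (1 - 3 / 4 * h) * d)%R).
  { replace (sn v - v2) with (RtoC (1 - h) * (sn u - v2) +
      ((sn v - sn u) / (v - u) - a) * (v - u)).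
    - eapply Rle_trans; [apply Cmod_triangle|]. rewrite !Cmod_mult, Cmod_R, hvum.
      rewrite Rabs_pos_eq by lra. fold d.
      assert (Cmod ((sn v - sn u) / (v - u) - a) * (h * Cmod dir) <= Cmod a / 4 * (h * Cmod dir))%R.
      { apply Rmult_le_compat_r; [nra|lra]. }
      replace (Cmod a / 4 * (h * Cmod dir))%R with (h * d / 4)%R in H
        by (rewrite hdir; field; lra). lra.
    - replace (((sn v - sn u) / (v - u) - a) * (v - u)) with (sn v - sn u - a * (v - u))
        by (field; exact hvu0).
      rewrite hvu. unfold dir. rewrite RtoC_minus. field. exact ha1. }
  assert (hvQ : Q v).
  { repeat split; [exact h2|nra|].
    replace (v - u1) with ((v - u) + (u - u1)) by ring.
    eapply Rle_trans; [apply Cmod_triangle|]. lra. }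
  specialize (hmin v hvQ). unfold phi in hmin. fold d in hmin.
  assert (hs1 : (sqrt (Cmod (sn v - v2)) <= sqrt d * (1 - 3 / 8 * h))%R).
  { apply Rsqr_incr_0; [|apply sqrt_pos|nra]. rewrite Rsqr_sqrt by apply Cmod_ge_0.
    eapply Rle_trans; [exact hstep|]. unfold Rsqr.
    replace (sqrt d * (1 - 3 / 8 * h) * (sqrt d * (1 - 3 / 8 * h)))%R
      with (sqrt d * sqrt d * ((1 - 3 / 8 * h) * (1 - 3 / 8 * h)))%R by ring.
    rewrite hsdd. nra. }
  assert (hs2 : (Cmod (v - u1) <= h * Cmod dir + Cmod (u - u1))%R).
  { replace (v - u1) with ((v - u) + (u - u1)) by ring.
    eapply Rle_trans; [apply Cmod_triangle|]. lra. }
  assert (hs3 : (c * Cmod dir <= sqrt d)%R).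
  { rewrite hdir. apply Rmult_le_reg_r with (Cmod a); [exact ha0|].
    replace (c * (d / Cmod a) * Cmod a)%R with (c * d)%R by (field; lra). nra. }
  nra.
Qed.

Lemma quartic_derive (z : C) : is_C_derive (quartic k) z (2 * quartic' k z).
Proof.
pose proof (is_C_derive_sqr _ _ _ (is_C_derive_id z)) as h1.
pose proof (is_C_derive_minus _ _ _ _ _ (is_C_derive_const 1 z) h1) as h2.
pose proof (is_C_derive_minus _ _ _ _ _ (is_C_derive_const 1 z)
  (is_C_derive_mult _ _ _ _ _ (is_C_derive_const (k ^ 2) z) h1)) as h3.
generalize (is_C_derive_mult _ _ _ _ _ h2 h3). unfold quartic.
match goal with |- is_C_derive _ _ ?A -> is_C_derive _ _ ?B => replace A with B; [trivial|] end.
unfold quartic'. ring.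
Qed.

Lemma quartic_lower_bound (z : C) : quartic k z = 0 ->
  exists c, (0 < c)%R /\ near z (fun v => (c ^ 2 * Cmod (v - z) <= Cmod (quartic k v))%R).
Proof.
intro hz. set (l := 2 * quartic' k z).
assert (hl : l <> 0).
{ apply Cmult_neq_0; [exact C2_neq0|]. now apply quartic_simple_root. }
assert (hl0 : (0 < Cmod l)%R) by now apply Cmod_gt_0.
exists (sqrt (Cmod l / 2)). split; [apply sqrt_lt_R0; lra|].
replace (sqrt (Cmod l / 2) ^ 2)%R with (Cmod l / 2)%R
  by (simpl; rewrite Rmult_1_r, sqrt_sqrt; lra).
apply near_of_near'.
- generalize (filter_and _ _ (Clim_away_from_0 _ _
    (proj1 (is_C_derive_Clim _ _ _) (quartic_derive z)) hl) (Clim_near' _ _ _ (Clim_id z) 1%R Rlt_0_1)).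
  unfold locally', within. apply filter_imp. intros v hv hvz. specialize (hv hvz).
  destruct hv as [hv _]. fold l in hv. rewrite hz in hv.
  assert (hvz0 : v - z <> 0) by now apply C_sub_neq0.
  assert (hvz1 : (0 < Cmod (v - z))%R) by now apply Cmod_gt_0.
  replace (quartic k v) with ((quartic k v - 0) / (v - z) * (v - z)) by (field; exact hvz0).
  rewrite Cmod_mult. apply Rmult_le_compat_r; lra.
- replace (z - z) with (0 : C) by ring. rewrite Cmod_0, Rmult_0_r. apply Cmod_ge_0.
Qed.

Lemma quartic_roots_discrete (z : C) : near' z (fun v => quartic k v <> 0).
Proof.
destruct (classic (quartic k z = 0)) as [hz|hz].
- destruct (quartic_lower_bound z hz) as [c [hc h]].
  generalize (near_near' _ _ h). unfold locally', within. apply filter_imp.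
  intros v hv hvz hq. specialize (hv hvz). rewrite hq, Cmod_0 in hv.
  assert (h1 : (0 < Cmod (v - z))%R) by (apply Cmod_gt_0; now apply C_sub_neq0).
  assert (0 < c ^ 2 * Cmod (v - z))%R by (apply Rmult_lt_0_compat; [apply pow_lt|]; assumption). lra.
- apply near_near'. exact (Clim_neq _ _ _ (Clim_quartic k _ _ (Clim_id z)) hz).
Qed.

Lemma sn_surjective (v : C) : exists u, ~ is_pole sn u /\ sn u = v.
Proof.
assert (hoff : forall v, quartic k v <> 0 -> attained v).
{ intros v2 hv2.
  refine (loc_const_off_discrete (fun v => quartic k v = 0) attained
    quartic_roots_discrete _ 0 v2 _ hv2 _).
  - intros z hz. set (rho := (Cmod (quartic k z) / 2)%R).
    assert (hrho : (0 < rho)%R).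
    { unfold rho. assert (0 < Cmod (quartic k z))%R by now apply Cmod_gt_0. lra. }
    pose proof (Clim_away_from_0 _ _ (Clim_quartic k _ _ (Clim_id z)) hz) as h.
    apply near_iff in h. destruct h as [d [hd0 hd]].
    set (r := Rmin (d / 4) (1 / 4)).
    assert (hr0 : (0 < r)%R) by (apply Rmin_pos; lra).
    assert (hr1 : (r <= d / 4)%R) by apply Rmin_l.
    assert (hr2 : (r <= 1 / 4)%R) by apply Rmin_r.
    destruct (classic (exists v1, (Cmod (v1 - z) < r)%R /\ attained v1))
      as [[v1 [hv1 [u1 [hu1 hu1v]]]]|hn].
    + left. apply near_iff. exists r. split; [exact hr0|]. intros v3 hv3.
      apply (attained_near u1 v3 (sqrt rho)); [now apply sqrt_lt_R0|exact hu1|].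
      intros x hx. rewrite hu1v in hx.
      assert (h1 : (Cmod (v1 - v3) < 2 * r)%R).
      { replace (v1 - v3) with ((v1 - z) + - (v3 - z)) by ring.
        eapply Rle_lt_trans; [apply Cmod_triangle|]. rewrite Cmod_opp. lra. }
      assert (h2 : (Cmod (x - z) < d)%R).
      { replace (x - z) with ((x - v3) + (v3 - z)) by ring.
        eapply Rle_lt_trans; [apply Cmod_triangle|]. lra. }
      specialize (hd x h2). fold rho in hd.
      replace (sqrt rho ^ 2)%R with rho by (simpl; rewrite Rmult_1_r, sqrt_sqrt; lra).
      pose proof (Cmod_ge_0 (x - v3)). nra.
    + right. apply near_iff. exists r. split; [exact hr0|]. intros v3 hv3 hA. apply hn. now exists v3.
  - unfold quartic. intro h. assert (h1 : (1 : C) = 0) by (rewrite <- h; ring).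
    apply RtoC_inj in h1. lra.
  - exists 0. split; [exact (not_pole_0 _ _ sn_jacobi)|exact (jacobi_sn_0 _ _ sn_jacobi)]. }
destruct (classic (quartic k v = 0)) as [hv|hv]; [|now apply hoff].
destruct (quartic_lower_bound v hv) as [c [hc h]].
apply near_iff in h. destruct h as [d [hd0 hd]].
destruct (filter_ex _ (filter_and _ _ (quartic_roots_discrete v)
  (Clim_near' _ _ _ (Clim_id v) d hd0))) as [v1 [h1 h2]].
destruct (hoff v1 h1) as [u1 [hu1 hu1v]].
apply (attained_near u1 v c hc hu1). intros x hx. apply hd. rewrite hu1v in hx. lra.
Qed.

End Surjectivity.

(** * Translations *)

Section Translations.
Context (k : C) (sn : C -> C).
Hypothesis sn_jacobi : is_jacobi_sn k sn.
Hypothesis k_neq0 : k <> 0.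
Hypothesis k2_neq1 : k ^ 2 <> 1.

Notation sn' := (C_derive sn).

Lemma sn_generic_value (z c : C) : near' z (fun v => sn v <> c).
Proof.
destruct (classic (is_pole sn z)) as [[_ hp]|hz].
- assert (h : near' z (fun v => (Cmod c < Cmod (sn v))%R)).
  { apply (hp (fun x => (Cmod c < x)%R)). exists (Cmod c). auto. }
  revert h. apply filter_imp. intros v hv e. rewrite e in hv. lra.
- exact (sn_isolated_value _ _ sn_jacobi k2_neq1 z c hz).
Qed.

Lemma sn_generic_denominator (s z : C) : s <> 0 ->
  near' z (fun v => 1 - k ^ 2 * s ^ 2 * sn v ^ 2 <> 0).
Proof.
intro hs.
generalize (filter_and _ _ (sn_generic_value z (1 / (k * s))) (sn_generic_value z (- (1 / (k * s))))).
apply filter_imp. intros v [h1 h2] h.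
destruct (Csqr_eq (sn v) (1 / (k * s))) as [e|e]; [|tauto|tauto].
replace ((1 / (k * s)) ^ 2) with ((1 - (1 - k ^ 2 * s ^ 2 * sn v ^ 2)) / (k ^ 2 * s ^ 2))
  by (rewrite h; field; split; assumption).
field. split; assumption.
Qed.

(* [sn (K + u)] equals [sn' u / (1 - k^2 sn^2 u)], which is even in [u]. *)
Lemma sn_reflection (K z : C) : ~ is_pole sn K -> sn K = 1 -> ~ is_pole sn z ->
  ~ is_pole sn (2 * K - z) /\ sn (2 * K - z) = sn z /\ sn' (2 * K - z) = - sn' z.
Proof.
intros hK hK1 hz.
assert (h10 : (1 : C) <> 0) by (intro e; apply RtoC_inj in e; lra).
assert (hK0 : sn K <> 0) by now rewrite hK1.
assert (hKd : sn' K = 0).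
{ pose proof (sn_ode _ _ sn_jacobi K hK) as h. rewrite hK1 in h. unfold quartic in h.
  assert (h2 : sn' K * sn' K = 0).
  { transitivity (sn' K ^ 2); [ring|]. rewrite h. ring. }
  apply Cmult_integral in h2. tauto. }
assert (hsym : near' z (fun v => sn v = sn (2 * K - v))).
{ pose proof (near'_not_pole _ _ sn_jacobi z) as g1.
  pose proof (near'_shift z (- K) _ (near'_not_pole _ _ sn_jacobi (z + - K))) as g2.
  pose proof (near'_reflect (2 * K) z _ (near'_not_pole _ _ sn_jacobi (2 * K - z))) as g3.
  pose proof (near'_shift z (- K) _ (sn_generic_value (z + - K) 0)) as g4.
  pose proof (near'_shift z (- K) _ (sn_generic_denominator 1 (z + - K) h10)) as g5.
  generalize (filter_and _ _ g1 (filter_and _ _ g2 (filter_and _ _ g3 (filter_and _ _ g4 g5)))).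
  apply filter_imp. refine (fun v : C => _). intros [h1 [h2 [h3 [h4 h5]]]].
  set (u := v + - K) in *.
  assert (e1 : v = u + K) by (unfold u; ring).
  assert (e2 : 2 * K - v = - u + K) by (unfold u; ring).
  rewrite e1 in h1 |- * at 1. rewrite e2 in h3 |- *.
  destruct (sn_odd _ _ sn_jacobi k2_neq1 u h2 h4) as [o1 [o2 o3]].
  pose proof (addition_formula _ _ sn_jacobi k2_neq1 K hK hK0 u h2 h1) as a1.
  pose proof (addition_formula _ _ sn_jacobi k2_neq1 K hK hK0 (- u) o1 h3) as a2.
  rewrite hK1, hKd in a1, a2. rewrite o2, o3 in a2.
  apply C_sub_eq0.
  assert (h6 : (sn (u + K) - sn (- u + K)) * (1 - k ^ 2 * 1 ^ 2 * sn u ^ 2) = 0).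
  { transitivity (sn (u + K) * (1 - k ^ 2 * 1 ^ 2 * sn u ^ 2) -
      sn (- u + K) * (1 - k ^ 2 * 1 ^ 2 * (- sn u) ^ 2)); [ring|].
    rewrite a1, a2. ring. }
  apply Cmult_integral in h6. tauto. }
assert (hlim : Clim (near' (2 * K - z)) sn (sn z)).
{ intros e he. pose proof (Clim_ext_near _ _ _ hsym
    (Clim_near' _ _ _ (sn_continuous _ _ sn_jacobi z hz)) e he) as h.
  assert (h' : near' (2 * K - (2 * K - z)) (fun v => (Cmod (sn (2 * K - v) - sn z) < e)%R)).
  { replace (2 * K - (2 * K - z)) with z by ring. exact h. }
  generalize (near'_reflect _ _ _ h'). apply filter_imp. refine (fun v : C => _).
  now replace (2 * K - (2 * K - v)) with v by ring. }
destruct (not_pole_of_lim _ _ sn_jacobi _ _ hlim) as [hp hval].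
repeat split; [exact hp|exact hval|].
assert (h1 : - sn' (2 * K - z) = sn' z).
{ symmetry. apply is_C_derive_unique. change (is_C_derive sn z (- sn' (2 * K - z))).
  apply is_C_derive_ext_near with (fun v => sn (2 * K - v)).
  - apply near_of_near'; [|exact hval]. generalize hsym. apply filter_imp. intros v. easy.
  - apply is_C_derive_reflect. exact (sn_derive _ _ sn_jacobi _ hp). }
rewrite <- h1. ring.
Qed.

Lemma sn_curve_surjective (s m : C) : m ^ 2 = quartic k s ->
  exists p, ~ is_pole sn p /\ sn p = s /\ sn' p = m.
Proof.
intro h. destruct (sn_surjective _ _ sn_jacobi k2_neq1 1) as [K [hK hK1]].
destruct (sn_surjective _ _ sn_jacobi k2_neq1 s) as [p [hp hps]].
destruct (Csqr_eq (sn' p) m) as [e|e].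
- rewrite h, (sn_ode _ _ sn_jacobi p hp), hps. reflexivity.
- now exists p.
- destruct (sn_reflection K p hK hK1 hp) as [h1 [h2 h3]]. exists (2 * K - p).
  repeat split; [exact h1|congruence|]. rewrite h3, e. ring.
Qed.

Section Shift.
Context (p : C).
Hypothesis p_not_pole : ~ is_pole sn p.
Hypothesis p_neq0 : sn p <> 0.

Notation s := (sn p).
Notation m := (sn' p).

Lemma subtraction_formula (z : C) : ~ is_pole sn z -> ~ is_pole sn (z - p) ->
  sn (z - p) * (1 - k ^ 2 * s ^ 2 * sn z ^ 2) = m * sn z - s * sn' z.
Proof.
intros hz hzp. destruct (sn_odd _ _ sn_jacobi k2_neq1 p p_not_pole p_neq0) as [o1 [o2 o3]].
assert (o4 : sn (- p) <> 0).
{ rewrite o2. intro e. apply p_neq0. replace s with (- - s) by ring. rewrite e. ring. }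
pose proof (addition_formula _ _ sn_jacobi k2_neq1 (- p) o1 o4 z hz hzp) as h.
rewrite o2, o3 in h.
replace (1 - k ^ 2 * s ^ 2 * sn z ^ 2) with (1 - k ^ 2 * (- s) ^ 2 * sn z ^ 2) by ring.
change (z - p) with (z + - p). rewrite h. ring.
Qed.

Lemma addition_norm (z : C) : ~ is_pole sn z ->
  (m * sn z + s * sn' z) * (m * sn z - s * sn' z) =
  (1 - k ^ 2 * s ^ 2 * sn z ^ 2) * (sn z ^ 2 - s ^ 2).
Proof.
intro hz.
transitivity (m ^ 2 * sn z ^ 2 - s ^ 2 * sn' z ^ 2); [ring|].
rewrite (sn_ode _ _ sn_jacobi p p_not_pole), (sn_ode _ _ sn_jacobi z hz). unfold quartic. ring.
Qed.

Lemma sn_shift_sum_prod (z : C) :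
  ~ is_pole sn z -> ~ is_pole sn (z + p) -> ~ is_pole sn (z - p) ->
  1 - k ^ 2 * s ^ 2 * sn z ^ 2 <> 0 ->
  (sn (z + p) + sn (z - p)) * (1 - k ^ 2 * s ^ 2 * sn z ^ 2) = 2 * m * sn z /\
  sn (z + p) * sn (z - p) * (1 - k ^ 2 * s ^ 2 * sn z ^ 2) = sn z ^ 2 - s ^ 2.
Proof.
intros hz h1 h2 hY.
pose proof (addition_formula _ _ sn_jacobi k2_neq1 p p_not_pole p_neq0 z hz h1) as a1.
pose proof (subtraction_formula z hz h2) as a2.
pose proof (addition_norm z hz) as hn.
revert a1 a2 hn hY. generalize (1 - k ^ 2 * s ^ 2 * sn z ^ 2). intros Y a1 a2 hn hY. split.
- rewrite Cmult_plus_distr_r, a1, a2. ring.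
- apply C_sub_eq0.
  assert (h3 : Y * (sn (z + p) * sn (z - p) * Y - (sn z ^ 2 - s ^ 2)) = 0).
  { transitivity ((sn (z + p) * Y) * (sn (z - p) * Y) - Y * (sn z ^ 2 - s ^ 2)); [ring|].
    rewrite a1, a2, hn. ring. }
  apply Cmult_integral in h3. tauto.
Qed.

(* Near [z0] the two shifts are the roots [(m x + s x') / Y] and [(m x - s x') / Y] of the
   biquadratic.  If [Y] vanishes at [z0], one of them is infinite there and the other one is
   rewritten as [(x^2 - s^2) / (m x -/+ s x')]. *)
Lemma sn_shift_value (z0 y1 : C) : ~ is_pole sn z0 ->
  sn z0 ^ 2 + y1 ^ 2 - 2 * m * sn z0 * y1 - s ^ 2 - k ^ 2 * s ^ 2 * sn z0 ^ 2 * y1 ^ 2 = 0 ->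
  (~ is_pole sn (z0 + p) /\ sn (z0 + p) = y1) \/ (~ is_pole sn (z0 - p) /\ sn (z0 - p) = y1).
Proof.
intros hz hB.
set (x0 := sn z0) in *. set (x0' := sn' z0).
assert (cx : Clim (near' z0) sn x0) by (apply Clim_near'; exact (sn_continuous _ _ sn_jacobi z0 hz)).
assert (cx' : Clim (near' z0) sn' x0') by (apply Clim_near'; exact (sn'_continuous _ _ sn_jacobi z0 hz)).
assert (cY : Clim (near' z0) (fun v => 1 - k ^ 2 * s ^ 2 * sn v ^ 2) (1 - k ^ 2 * s ^ 2 * x0 ^ 2)).
{ apply Clim_minus; [apply Clim_const|]. apply Clim_mult; [apply Clim_const|]. now apply Clim_pow. }
assert (cp : Clim (near' z0) (fun v => m * sn v + s * sn' v) (m * x0 + s * x0')).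
{ apply Clim_plus; apply Clim_mult; auto; apply Clim_const. }
assert (cm : Clim (near' z0) (fun v => m * sn v - s * sn' v) (m * x0 - s * x0')).
{ apply Clim_minus; apply Clim_mult; auto; apply Clim_const. }
assert (cn : Clim (near' z0) (fun v => sn v ^ 2 - s ^ 2) (x0 ^ 2 - s ^ 2)).
{ apply Clim_minus; [now apply Clim_pow|apply Clim_const]. }
assert (hgen : near' z0 (fun v => ~ is_pole sn v /\ ~ is_pole sn (v + p) /\ ~ is_pole sn (v - p) /\
  1 - k ^ 2 * s ^ 2 * sn v ^ 2 <> 0)).
{ pose proof (near'_not_pole _ _ sn_jacobi z0) as g1.
  pose proof (near'_shift z0 p _ (near'_not_pole _ _ sn_jacobi (z0 + p))) as g2.
  pose proof (near'_shift z0 (- p) _ (near'_not_pole _ _ sn_jacobi (z0 + - p))) as g3.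
  exact (filter_and _ _ g1 (filter_and _ _ g2 (filter_and _ _ g3
    (sn_generic_denominator s z0 p_neq0)))). }
pose proof (not_pole_of_lim_shift _ _ sn_jacobi z0 p) as dplus.
pose proof (not_pole_of_lim_shift _ _ sn_jacobi z0 (- p)) as dminus.
assert (hdiv : forall a b c : C, b <> 0 -> a * b = c -> c / b = a).
{ intros a b c hb <-. field. exact hb. }
pose proof (addition_norm z0 hz) as hn. fold x0 x0' in hn.
destruct (classic (1 - k ^ 2 * s ^ 2 * x0 ^ 2 = 0)) as [hY|hY].
- assert (hm : m <> 0).
  { intro hm. pose proof (sn_ode _ _ sn_jacobi p p_not_pole) as hq. rewrite hm in hq.
    assert (hx : x0 ^ 2 = s ^ 2).
    { apply C_sub_eq0. rewrite <- hB, hm.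
      transitivity (x0 ^ 2 - s ^ 2 + y1 ^ 2 * (1 - k ^ 2 * s ^ 2 * x0 ^ 2));
      [rewrite hY|]; ring. }
    rewrite hx in hY. unfold quartic in hq.
    assert (hq' : (1 - s ^ 2) * (1 - k ^ 2 * s ^ 2) = 0) by (rewrite <- hq; ring).
    apply k2_neq1. apply Cmult_integral in hq'. destruct hq' as [h|h].
    - apply C_sub_eq0.
      transitivity (- (1 - k ^ 2 * s ^ 2 * s ^ 2) + k ^ 2 * (1 + s ^ 2) * (1 - s ^ 2)); [ring|].
      rewrite hY, h. ring.
    - assert (hs1 : s ^ 2 = 1).
      { apply C_sub_eq0.
        transitivity (s ^ 2 * (1 - k ^ 2 * s ^ 2) - (1 - k ^ 2 * s ^ 2 * s ^ 2)); [ring|].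
        rewrite hY, h. ring. }
      rewrite hs1 in h. symmetry. apply C_sub_eq0. rewrite <- h. ring. }
  assert (hx0 : x0 <> 0).
  { intro e. rewrite e in hY. assert (h1 : (1 : C) = 0) by (rewrite <- hY; ring).
    apply RtoC_inj in h1. lra. }
  assert (hmx : 2 * m * x0 <> 0) by (repeat apply Cmult_neq_0; auto using C2_neq0).
  assert (hy1 : y1 * (2 * m * x0) = x0 ^ 2 - s ^ 2).
  { symmetry. apply C_sub_eq0. rewrite <- hB.
    transitivity (x0 ^ 2 - s ^ 2 - y1 * (2 * m * x0) + y1 ^ 2 * (1 - k ^ 2 * s ^ 2 * x0 ^ 2));
      [rewrite hY|]; ring. }
  rewrite hY in hn. rewrite Cmult_0_l in hn. apply Cmult_integral in hn. destruct hn as [hn|hn].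
  + left. apply dplus.
    assert (hb : m * x0 - s * x0' = 2 * m * x0).
    { transitivity (2 * m * x0 - (m * x0 + s * x0')); [ring|]. rewrite hn. ring. }
    rewrite hb in cm. rewrite <- (hdiv y1 _ _ hmx hy1).
    generalize (Clim_div _ _ _ _ cn cm hmx). apply Clim_ext_near.
    generalize (filter_and _ _ hgen (Clim_neq _ _ _ cm hmx)).
    apply filter_imp. intros v [[h1 [h2 [h3 h4]]] h5]. apply hdiv; [exact h5|].
    rewrite <- (subtraction_formula v h1 h3), Cmult_assoc.
    exact (proj2 (sn_shift_sum_prod v h1 h2 h3 h4)).
  + right. apply dminus.
    assert (hb : m * x0 + s * x0' = 2 * m * x0).
    { transitivity (2 * m * x0 - (m * x0 - s * x0')); [ring|]. rewrite hn. ring. }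
    rewrite hb in cp. rewrite <- (hdiv y1 _ _ hmx hy1).
    generalize (Clim_div _ _ _ _ cn cp hmx). apply Clim_ext_near.
    generalize (filter_and _ _ hgen (Clim_neq _ _ _ cp hmx)).
    apply filter_imp. intros v [[h1 [h2 [h3 h4]]] h5]. apply hdiv; [exact h5|].
    rewrite <- (addition_formula _ _ sn_jacobi k2_neq1 p p_not_pole p_neq0 v h1 h2), Cmult_assoc.
    rewrite (Cmult_comm (sn (v - p))). exact (proj2 (sn_shift_sum_prod v h1 h2 h3 h4)).
- assert (hprod : (y1 - (m * x0 + s * x0') / (1 - k ^ 2 * s ^ 2 * x0 ^ 2)) *
     (y1 - (m * x0 - s * x0') / (1 - k ^ 2 * s ^ 2 * x0 ^ 2)) = 0).
  { assert (hB' : (1 - k ^ 2 * s ^ 2 * x0 ^ 2) * y1 ^ 2 - 2 * m * x0 * y1 + (x0 ^ 2 - s ^ 2) = 0)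
      by (rewrite <- hB; ring).
    revert hn hY hB'. generalize (1 - k ^ 2 * s ^ 2 * x0 ^ 2), (x0 ^ 2 - s ^ 2), (s * x0').
    intros Y D b hn hY hB'.
    transitivity ((Y * y1 ^ 2 - 2 * m * x0 * y1 + (m * x0 + b) * (m * x0 - b) / Y) / Y);
      [field; exact hY|].
    rewrite hn. replace (Y * D / Y) with D by (field; exact hY). rewrite hB'. unfold Cdiv. ring. }
  apply Cmult_integral in hprod. destruct hprod as [h|h]; apply C_sub_eq0 in h; rewrite h.
  + left. apply dplus. generalize (Clim_div _ _ _ _ cp cY hY). apply Clim_ext_near.
    generalize hgen. apply filter_imp. intros v [h1 [h2 [h3 h4]]]. apply hdiv; [exact h4|].
    exact (addition_formula _ _ sn_jacobi k2_neq1 p p_not_pole p_neq0 v h1 h2).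
  + right. apply dminus. generalize (Clim_div _ _ _ _ cm cY hY). apply Clim_ext_near.
    generalize hgen. apply filter_imp. intros v [h1 [h2 [h3 h4]]]. apply hdiv; [exact h4|].
    exact (subtraction_formula v h1 h3).
Qed.
End Shift.
End Translations.

(** * Algebra of the autonomous map *)

Lemma C1_neq0 : (1 : C) <> 0.
Proof. intro e. apply RtoC_inj in e. lra. Qed.

Lemma Cinv_0 : / (0 : C) = 0.
Proof. apply injective_projections; simpl; unfold Rdiv; ring. Qed.

Lemma C_sqrt_exists (a : C) : exists s : C, s ^ 2 = a.
Proof.
set (x := fst a). set (y := snd a). set (r := Cmod a).
assert (hr : (r * r = x * x + y * y)%R).
{ replace (r * r)%R with (Cmod a ^ 2)%R by (unfold r; simpl; ring).
  rewrite Cmod2_alt. unfold Re, Im, x, y. simpl. ring. }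
assert (hx : (Rabs x <= r)%R) by apply re_le_Cmod.
pose proof (Rle_abs x) as hx1. pose proof (Rle_abs (- x)) as hx2. rewrite Rabs_Ropp in hx2.
set (u := sqrt ((r + x) / 2)). set (v := sqrt ((r - x) / 2)).
assert (hu : (u * u = (r + x) / 2)%R) by (apply sqrt_sqrt; lra).
assert (hv : (v * v = (r - x) / 2)%R) by (apply sqrt_sqrt; lra).
assert (huv : (2 * u * v = Rabs y)%R).
{ apply Rsqr_inj; [|apply Rabs_pos|].
  - pose proof (sqrt_pos ((r + x) / 2)). pose proof (sqrt_pos ((r - x) / 2)).
    fold u in H. fold v in H0. nra.
  - rewrite <- Rsqr_abs. unfold Rsqr.
    replace (2 * u * v * (2 * u * v))%R with (4 * (u * u) * (v * v))%R by ring.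
    rewrite hu, hv. nra. }
destruct (Rle_lt_dec 0 y) as [hy|hy].
- rewrite Rabs_pos_eq in huv by exact hy. exists (u, v).
  apply injective_projections; simpl; fold x y; lra.
- rewrite Rabs_left in huv by exact hy. exists (u, - v)%R.
  apply injective_projections; simpl; fold x y; lra.
Qed.

Section Coefficients.
Context (E0 t0 c : C).
Hypothesis E0_minus : 2 - E0 - 4 * t0 <> 0.
Hypothesis E0_plus : 2 - E0 + 4 * t0 <> 0.
Hypothesis c_neq0 : c <> 0.
Hypothesis c4 : c ^ 4 = (2 - E0 - 4 * t0) / (2 - E0 + 4 * t0).

Notation gamma := (qP2_gamma E0 t0 c).
Notation zeta := (qP2_zeta E0 t0 c).

Lemma cayley_biquadratic (x y : C) : x <> - (1) -> y <> - (1) -> x <> 0 -> y <> 0 ->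
  qP2_E 1 t0 x y = E0 ->
  let X := cayley_F c x in let Y := cayley_F c y in
  X ^ 2 * Y ^ 2 + gamma * (X ^ 2 + Y ^ 2) + zeta * X * Y + 1 = 0.
Proof.
intros hx hy hx0 hy0 hE X Y.
destruct (proj2 (cayley_F_spec c x X c_neq0 hx) eq_refl) as [dX eX].
destruct (proj2 (cayley_F_spec c y Y c_neq0 hy) eq_refl) as [dY eY].
assert (hpoly : y ^ 2 * x ^ 2 + t0 * y * x * (y + x) + 1 * t0 * (y + x) + 1 = E0 * (y * x)).
{ rewrite <- hE. unfold qP2_E. field. split; assumption. }
revert dX dY eX eY. generalize X, Y. clear X Y. intros X Y dX dY eX eY.
assert (h4 : c ^ 4 * (2 - E0 + 4 * t0) = 2 - E0 - 4 * t0) by (rewrite c4; field; exact E0_plus).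
assert (hk : (2 - E0 - 4 * t0) * (X ^ 2 * Y ^ 2) + (2 + E0) * c ^ 2 * (X ^ 2 + Y ^ 2)
   + 8 * c ^ 2 * X * Y + c ^ 4 * (2 - E0 + 4 * t0) = 0).
{ apply (f_equal (fun u => (u - E0 * (y * x)) * ((c - X) ^ 2 * (c - Y) ^ 2))) in hpoly.
  transitivity ((y ^ 2 * x ^ 2 + t0 * y * x * (y + x) + 1 * t0 * (y + x) + 1 - E0 * (y * x))
    * ((c - X) ^ 2 * (c - Y) ^ 2)).
  - rewrite eX, eY. field. split; assumption.
  - rewrite hpoly. ring. }
rewrite h4 in hk. unfold qP2_gamma, qP2_zeta.
transitivity (((2 - E0 - 4 * t0) * (X ^ 2 * Y ^ 2) + (2 + E0) * c ^ 2 * (X ^ 2 + Y ^ 2)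
   + 8 * c ^ 2 * X * Y + (2 - E0 - 4 * t0)) / (2 - E0 - 4 * t0)); [field; exact E0_minus|].
rewrite hk. unfold Cdiv. ring.
Qed.

(* The sum and product of the two roots of the biquadratic in [Y] give back the map. *)
Lemma cayley_step (X Xp Xm : C) :
  c - X <> 0 -> c - Xp <> 0 -> c - Xm <> 0 -> X ^ 2 + gamma <> 0 ->
  (Xp + Xm) * (X ^ 2 + gamma) = - zeta * X ->
  Xp * Xm * (X ^ 2 + gamma) = 1 + gamma * X ^ 2 ->
  let f := (c + X) / (c - X) in
  (c + Xp) / (c - Xp) * ((c + Xm) / (c - Xm)) * (f * (f + t0)) = 1 + f * t0.
Proof.
intros d dp dm hD hS hP f.
assert (h4 : c ^ 4 * (2 - E0 + 4 * t0) = 2 - E0 - 4 * t0) by (rewrite c4; field; exact E0_plus).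
set (L := 2 - E0 - 4 * t0) in *.
assert (hg : gamma * L = (2 + E0) * c ^ 2) by (unfold qP2_gamma; fold L; field; exact E0_minus).
assert (hz : zeta * L = 8 * c ^ 2) by (unfold qP2_zeta; fold L; field; exact E0_minus).
set (Vp := (1 + t0) * c ^ 2 + 2 * c * X + (1 - t0) * X ^ 2).
set (Vm := (1 + t0) * c ^ 2 - 2 * c * X + (1 - t0) * X ^ 2).
assert (hU : (c ^ 2 * (X ^ 2 + gamma) + 1 + gamma * X ^ 2) * L =
  4 * c ^ 2 * ((1 + t0) * c ^ 2 + (1 - t0) * X ^ 2)).
{ transitivity (c ^ 2 * X ^ 2 * L + c ^ 2 * (gamma * L) + L + (gamma * L) * X ^ 2); [ring|].
  rewrite hg. transitivity (c ^ 2 * X ^ 2 * L + c ^ 2 * ((2 + E0) * c ^ 2) +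
    c ^ 4 * (2 - E0 + 4 * t0) + (2 + E0) * c ^ 2 * X ^ 2); [rewrite h4; reflexivity|].
  unfold L. ring. }
assert (hm : (c + Xp) * (c + Xm) * (X ^ 2 + gamma) * L = 4 * c ^ 2 * Vm).
{ transitivity ((c ^ 2 * (X ^ 2 + gamma) + c * ((Xp + Xm) * (X ^ 2 + gamma)) +
    Xp * Xm * (X ^ 2 + gamma)) * L); [ring|]. rewrite hS, hP.
  transitivity ((c ^ 2 * (X ^ 2 + gamma) + 1 + gamma * X ^ 2) * L - c * X * (zeta * L)); [ring|].
  rewrite hU, hz. unfold Vm. ring. }
assert (hp : (c - Xp) * (c - Xm) * (X ^ 2 + gamma) * L = 4 * c ^ 2 * Vp).
{ transitivity ((c ^ 2 * (X ^ 2 + gamma) - c * ((Xp + Xm) * (X ^ 2 + gamma)) +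
    Xp * Xm * (X ^ 2 + gamma)) * L); [ring|]. rewrite hS, hP.
  transitivity ((c ^ 2 * (X ^ 2 + gamma) + 1 + gamma * X ^ 2) * L + c * X * (zeta * L)); [ring|].
  rewrite hU, hz. unfold Vp. ring. }
assert (hnum : (c + Xp) * (c + Xm) * Vp = (c - Xp) * (c - Xm) * Vm).
{ assert (h4c : 4 * c ^ 2 * ((X ^ 2 + gamma) * L) <> 0).
  { repeat apply Cmult_neq_0; auto. intro e. apply RtoC_inj in e. lra. 
    apply C1_neq0. }
  apply C_sub_eq0.
  assert (h : 4 * c ^ 2 * ((X ^ 2 + gamma) * L) *
     ((c + Xp) * (c + Xm) * Vp - (c - Xp) * (c - Xm) * Vm) = 0).
  { transitivity ((c + Xp) * (c + Xm) * (X ^ 2 + gamma) * L * (4 * c ^ 2 * Vp) -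
      (c - Xp) * (c - Xm) * (X ^ 2 + gamma) * L * (4 * c ^ 2 * Vm)); [ring|].
    rewrite hm, hp. ring. }
  apply Cmult_integral in h. tauto. }
unfold f.
transitivity ((c + Xp) * (c + Xm) * Vp / ((c - Xp) * (c - Xm) * (c - X) ^ 2)).
- unfold Vp. field. repeat split; assumption.
- rewrite hnum. unfold Vm. field. repeat split; assumption.
Qed.

End Coefficients.

Lemma qP2_f_SS (a t0 f0 f1 eps : C) (n : nat) :
  qP2_f a t0 f0 f1 eps (S (S n)) =
  a * (1 + qP2_f a t0 f0 f1 eps (S n) * qP2_t t0 eps (S n)) /
   (qP2_f a t0 f0 f1 eps (S n) * (qP2_f a t0 f0 f1 eps (S n) + qP2_t t0 eps (S n))) /
   qP2_f a t0 f0 f1 eps n.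
Proof. reflexivity. Qed.

Lemma qP2_t_0 (t0 : C) (n : nat) : qP2_t t0 0 n = t0.
Proof.
unfold qP2_t. rewrite Cplus_0_r, Cpow_1_l. ring.
Qed.

Lemma qP2_E_conserved (t0 x y : C) : x <> 0 -> y <> 0 -> y + t0 <> 0 -> 1 + y * t0 <> 0 ->
  qP2_E 1 t0 y (1 * (1 + y * t0) / (y * (y + t0)) / x) = qP2_E 1 t0 x y.
Proof. intros hx hy h1 h2. unfold qP2_E. field. repeat split; assumption. Qed.

Section Limit.
Context (t0 f0 f1 : C).
Hypothesis E0_neq : qP2_E 1 t0 f0 f1 <> - (2).
Context (N : nat).
Hypothesis admissible : qP2_admissible 1 t0 f0 f1 N.

Notation f eps n := (qP2_f 1 t0 f0 f1 eps n).
Notation G n := (qP2_f 1 t0 f0 f1 0 n).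

Lemma qP2_t_lim (n : nat) : Clim (near' (RtoC 0)) (fun eps => qP2_t t0 eps n) t0.
Proof.
assert (h : Clim (near' (RtoC 0)) (fun eps => qP2_t t0 eps n) (qP2_t t0 0 n));
  [|now rewrite qP2_t_0 in h].
unfold qP2_t. apply Clim_mult; [apply Clim_const|]. apply Clim_pow.
apply Clim_plus; [apply Clim_const|]. apply Clim_near', Clim_id.
Qed.

Lemma admissible_near : exists m M, (0 < m)%R /\ near' (RtoC 0) (fun eps => forall n, (n <= N)%nat ->
  (m <= Cmod (f eps n) <= M)%R /\ f eps n <> - (1)).
Proof.
destruct admissible as [m [M [r [hm [hr h]]]]]. exists m, M. split; [exact hm|].
apply near'_iff. exists r. split; [lra|]. intros eps he1 he2 n hn. apply h; auto.
now replace (eps - 0) with eps in he2 by ring.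
Qed.

Lemma limit_neq0 (n : nat) : (n <= N)%nat ->
  Clim (near' (RtoC 0)) (fun eps => f eps n) (G n) -> G n <> 0.
Proof.
intros hn hl h0. rewrite h0 in hl.
destruct admissible_near as [m [M [hm h]]].
destruct (filter_ex _ (filter_and _ _ h (hl m hm))) as [eps [h1 h2]].
destruct (h1 n hn) as [[h3 _] _]. replace (f eps n - 0) with (f eps n) in h2 by ring. lra.
Qed.

Lemma limit_orbit (n : nat) :
  ((n <= N)%nat -> Clim (near' (RtoC 0)) (fun eps => f eps n) (G n)) /\
  ((S n <= N)%nat -> Clim (near' (RtoC 0)) (fun eps => f eps (S n)) (G (S n)) /\
     qP2_E 1 t0 (G n) (G (S n)) = qP2_E 1 t0 f0 f1) /\
  ((S (S n) <= N)%nat -> G (S n) + t0 <> 0).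
Proof.
destruct admissible_near as [m [M [hm hadm]]].
(* If [G_(n+1) = - t0] then [f_(n+2)] stays bounded only if [1 + t0 G_(n+1) = 0] too, whence
   [t0^2 = 1] and [E = -2]. *)
assert (hden : forall n, (S (S n) <= N)%nat ->
  Clim (near' (RtoC 0)) (fun eps => f eps n) (G n) ->
  Clim (near' (RtoC 0)) (fun eps => f eps (S n)) (G (S n)) ->
  qP2_E 1 t0 (G n) (G (S n)) = qP2_E 1 t0 f0 f1 -> G (S n) + t0 <> 0).
{ clear n. intros n hn hl0 hl1 hE h.
  assert (hG0 : G n <> 0) by (apply limit_neq0; [lia|exact hl0]).
  assert (hG1 : G (S n) <> 0) by (apply limit_neq0; [lia|exact hl1]).
  assert (hGt : G (S n) = - t0).
  { apply C_sub_eq0. transitivity (G (S n) + t0); [ring|exact h]. }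
  assert (hnum : 1 + G (S n) * t0 = 0).
  { apply (@Clim_unique C (near' (RtoC 0)) _ (fun eps => 1 + f eps (S n) * qP2_t t0 eps (S n))).
    - apply Clim_plus; [apply Clim_const|]. apply Clim_mult; [exact hl1|apply qP2_t_lim].
    - apply Clim_ext_near with (fun eps => (f eps (S n) + qP2_t t0 eps (S n)) *
        (f eps (S n) * f eps n * f eps (S (S n)))).
      + generalize hadm. apply filter_imp. intros eps he.
        destruct (he (S (S n)) hn) as [[h2 _] _].
        destruct (he (S n) ltac:(lia)) as [[h1 _] _]. destruct (he n ltac:(lia)) as [[h0 _] _].
        assert (g2 : f eps (S (S n)) <> 0) by (apply Cmod_gt_0; lra).
        assert (g1 : f eps (S n) <> 0) by (apply Cmod_gt_0; lra).
        assert (g0 : f eps n <> 0) by (apply Cmod_gt_0; lra).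
        assert (gt : f eps (S n) + qP2_t t0 eps (S n) <> 0).
        { intro e. apply g2. rewrite qP2_f_SS, e, Cmult_0_r. unfold Cdiv. rewrite Cinv_0. ring. }
        rewrite qP2_f_SS. revert g1 g0 gt.
        generalize (f eps (S n)), (f eps n), (qP2_t t0 eps (S n)). intros x y t g1 g0 gt.
        field. repeat split; assumption.
      + apply Clim_mult_0 with (M * M * M)%R.
        * pose proof (Clim_plus _ _ _ _ hl1 (qP2_t_lim (S n))) as hs.
          rewrite h in hs. exact hs.
        * generalize hadm. apply filter_imp. intros eps he. rewrite !Cmod_mult.
          destruct (he (S (S n)) hn) as [[_ h2] _].
          destruct (he (S n) ltac:(lia)) as [[_ h1] _]. destruct (he n ltac:(lia)) as [[_ h0] _].
          apply Rmult_le_compat; auto using Cmod_ge_0.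
          -- apply Rmult_le_pos; apply Cmod_ge_0.
          -- apply Rmult_le_compat; auto using Cmod_ge_0. }
  apply E0_neq. rewrite <- hE. revert hG0 hG1 hGt hnum. generalize (G (S n)), (G n).
  intros y x hx hy -> hnum.
  assert (ht2 : t0 ^ 2 = 1).
  { symmetry. apply C_sub_eq0. rewrite <- hnum. ring. }
  assert (ht0 : t0 <> 0).
  { intro e. apply hy. rewrite e. ring. }
  unfold qP2_E.
  transitivity ((x ^ 2 * (t0 ^ 2 - t0 ^ 2) + x * t0 * t0 ^ 2 + x * t0 + (1 - t0 ^ 2)) / (- t0 * x)).
  - field. split; assumption.
  - rewrite ht2. field. split; assumption. }
induction n as [|n [IH1 [IH2 IH3]]].
- assert (h0 : Clim (near' (RtoC 0)) (fun eps => f eps 0%nat) (G 0%nat)) by exact (Clim_const f0).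
  assert (h1 : Clim (near' (RtoC 0)) (fun eps => f eps 1%nat) (G 1%nat)) by exact (Clim_const f1).
  repeat split; auto.
- assert (hstep : (S (S n) <= N)%nat ->
    Clim (near' (RtoC 0)) (fun eps => f eps (S (S n))) (G (S (S n))) /\
    qP2_E 1 t0 (G (S n)) (G (S (S n))) = qP2_E 1 t0 f0 f1).
  { intro hn. assert (hn1 : (n <= N)%nat) by lia. assert (hn2 : (S n <= N)%nat) by lia.
    specialize (IH1 hn1). destruct (IH2 hn2) as [IH4 IH5]. specialize (IH3 hn).
    assert (hG0 : G n <> 0) by (apply limit_neq0; assumption).
    assert (hG1 : G (S n) <> 0) by (apply limit_neq0; assumption).
    assert (hl : Clim (near' (RtoC 0)) (fun eps => f eps (S (S n))) (G (S (S n)))).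
    { rewrite qP2_f_SS, qP2_t_0.
      apply Clim_ext_near with (fun eps => 1 * (1 + f eps (S n) * qP2_t t0 eps (S n)) /
        (f eps (S n) * (f eps (S n) + qP2_t t0 eps (S n))) / f eps n).
      { apply filter_forall. intro eps. symmetry. apply qP2_f_SS. }
      apply Clim_div; [|exact IH1|exact hG0].
      apply Clim_div; [| |now apply Cmult_neq_0].
      - apply Clim_mult; [apply Clim_const|]. apply Clim_plus; [apply Clim_const|].
        apply Clim_mult; [exact IH4|apply qP2_t_lim].
      - apply Clim_mult; [exact IH4|]. apply Clim_plus; [exact IH4|apply qP2_t_lim]. }
    split; [exact hl|]. rewrite <- IH5.
    assert (hG2 : G (S (S n)) <> 0) by (apply limit_neq0; assumption).
    rewrite qP2_f_SS, qP2_t_0 in hG2 |- *. apply qP2_E_conserved; auto.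
    intro e. apply hG2. rewrite e. unfold Cdiv. ring. }
  repeat split; try (apply hstep; assumption).
  + intro hn. apply IH2. exact hn.
  + intro hn. destruct (hstep ltac:(lia)) as [h1 h2]. apply hden; auto. apply IH2. lia.
Qed.

End Limit.

Lemma cayley_F_inv (c x : C) : c <> 0 -> x <> - (1) ->
  c - cayley_F c x <> 0 /\ (c + cayley_F c x) / (c - cayley_F c x) = x.
Proof.
intros hc hx. destruct (proj2 (cayley_F_spec c x _ hc hx) eq_refl) as [h1 h2]. split; [exact h1|].
symmetry. exact h2.
Qed.

Lemma Clim_cayley {T : Type} {F : (T -> Prop) -> Prop} {FF : Filter F} (c : C) (g : T -> C) (l : C) :
  Clim F g l -> l <> - (1) -> Clim F (fun v => cayley_F c (g v)) (cayley_F c l).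
Proof.
intros h hl. unfold cayley_F. apply Clim_div.
- apply Clim_mult; [apply Clim_const|]. apply Clim_minus; [exact h|apply Clim_const].
- apply Clim_plus; [exact h|apply Clim_const].
- intro e. apply hl. apply C_sub_eq0. rewrite <- e. ring.
Qed.

Lemma cayley_infty {T : Type} {F : (T -> Prop) -> Prop} {FF : Filter F} (c : C) (g : T -> C) :
  c <> 0 -> Clim F g (- (1)) -> F (fun v => g v <> - (1)) ->
  filterlim (fun v => Cmod (cayley_F c (g v))) F (Rbar_locally p_infty).
Proof.
intros hc hg hne Q [M hM].
assert (hc0 : (0 < Cmod c)%R) by now apply Cmod_gt_0.
assert (he : (0 < Rmin 1 (Cmod c / (Rabs M + 1)))%R).
{ apply Rmin_pos; [lra|]. apply Rdiv_lt_0_compat; [exact hc0|]. pose proof (Rabs_pos M). lra. }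
unfold filtermap. generalize (filter_and _ _ (hg _ he) hne). apply filter_imp.
intros v [h1 h2]. apply hM.
pose proof (Rmin_l 1 (Cmod c / (Rabs M + 1))) as h3.
pose proof (Rmin_r 1 (Cmod c / (Rabs M + 1))) as h4.
pose proof (Rle_abs M) as h5. pose proof (Rabs_pos M) as h6.
replace (g v - - (1)) with (g v + 1) in h1 by ring.
assert (hn : g v + 1 <> 0).
{ intro e. apply h2. apply C_sub_eq0. rewrite <- e. ring. }
assert (hn0 : (0 < Cmod (g v + 1))%R) by now apply Cmod_gt_0.
assert (h7 : (1 < Cmod (g v - 1))%R).
{ assert (h8 : (Cmod 2 <= Cmod (g v + 1) + Cmod (g v - 1))%R).
  { replace (2 : C) with ((g v + 1) + - (g v - 1)) by ring.
    eapply Rle_trans; [apply Cmod_triangle|]. rewrite Cmod_opp. lra. }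
  rewrite Cmod_R, Rabs_pos_eq in h8 by lra. lra. }
unfold cayley_F. rewrite Cmod_div, Cmod_mult by exact hn.
apply Rle_lt_trans with (Rabs M); [exact h5|].
apply Rmult_lt_reg_r with (Cmod (g v + 1)); [exact hn0|].
unfold Rdiv. rewrite Rmult_assoc, Rinv_l, Rmult_1_r by lra.
assert (h9 : ((Rabs M + 1) * Cmod (g v + 1) < Cmod c)%R).
{ replace (Cmod c) with ((Rabs M + 1) * (Cmod c / (Rabs M + 1)))%R by (field; lra).
  apply Rmult_lt_compat_l; lra. }
nra.
Qed.

Section Orbit.
Context (k : C) (sn : C -> C).
Hypothesis sn_jacobi : is_jacobi_sn k sn.
Hypothesis k_neq0 : k <> 0.
Hypothesis k2_neq1 : k ^ 2 <> 1.
Context (E0 t0 c A p z0 : C).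
Hypothesis E0_minus : 2 - E0 - 4 * t0 <> 0.
Hypothesis E0_plus : 2 - E0 + 4 * t0 <> 0.
Hypothesis c_neq0 : c <> 0.
Hypothesis c4 : c ^ 4 = (2 - E0 - 4 * t0) / (2 - E0 + 4 * t0).
Hypothesis A2 : A ^ 2 = k.
Hypothesis p_not_pole : ~ is_pole sn p.

Notation sn' := (C_derive sn).
Notation gamma := (qP2_gamma E0 t0 c).
Notation zeta := (qP2_zeta E0 t0 c).

Hypothesis p_gamma : k * gamma * sn p ^ 2 = - (1).
Hypothesis p_zeta : zeta = - (2) * gamma * sn' p.

Lemma sn_p_neq0 : sn p <> 0.
Proof.
intro e. apply C1_neq0. transitivity (- - (1) : C); [ring|]. rewrite <- p_gamma, e. ring.
Qed.

Lemma gamma_neq0 : gamma <> 0.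
Proof.
intro e. apply C1_neq0. transitivity (- - (1) : C); [ring|]. rewrite <- p_gamma, e. ring.
Qed.

Lemma A_neq0 : A <> 0.
Proof. intro e. apply k_neq0. rewrite <- A2, e. ring. Qed.

Definition orbit_pt (v : C) (n : nat) : C := v + p * RtoC (INR n).
Definition orbit_F (v : C) (n : nat) : C := A * sn (orbit_pt v n).
Definition orbit_f (v : C) (n : nat) : C := (c + orbit_F v n) / (c - orbit_F v n).

Lemma orbit_generic (n : nat) : near' z0 (fun v => ~ is_pole sn (orbit_pt v n) /\
  c - orbit_F v n <> 0 /\ 1 - k ^ 2 * sn p ^ 2 * sn (orbit_pt v n) ^ 2 <> 0).
Proof.
set (d := p * RtoC (INR n)).
pose proof (near'_shift z0 d _ (near'_not_pole _ _ sn_jacobi (z0 + d))) as g1.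
pose proof (near'_shift z0 d _ (sn_generic_value _ _ sn_jacobi k2_neq1 (z0 + d) (c / A))) as g2.
pose proof (near'_shift z0 d _ (sn_generic_denominator _ _ sn_jacobi k_neq0 k2_neq1 (sn p) (z0 + d)
  sn_p_neq0)) as g3.
generalize (filter_and _ _ g1 (filter_and _ _ g2 g3)). apply filter_imp.
refine (fun v : C => _). intros [h1 [h2 h3]]. repeat split; [exact h1| |exact h3].
intro e. apply h2. change (v + d) with (orbit_pt v n).
transitivity (orbit_F v n / A); [unfold orbit_F; field; exact A_neq0|].
f_equal. symmetry. now apply C_sub_eq0.
Qed.

Lemma orbit_step (n : nat) : near' z0 (fun v =>
  orbit_f v (S (S n)) * orbit_f v n * (orbit_f v (S n) * (orbit_f v (S n) + t0)) =
  1 + orbit_f v (S n) * t0).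
Proof.
generalize (filter_and _ _ (orbit_generic n) (filter_and _ _ (orbit_generic (S n))
  (orbit_generic (S (S n))))).
apply filter_imp. refine (fun v : C => _). intros [[a1 [a2 _]] [[b1 [b2 b3]] [c1 [c2 _]]]].
set (u := orbit_pt v (S n)) in *.
assert (eP : orbit_pt v (S (S n)) = u + p).
{ unfold u, orbit_pt. rewrite (S_INR (S n)), RtoC_plus. ring. }
assert (eM : orbit_pt v n = u - p).
{ unfold u, orbit_pt. rewrite (S_INR n), RtoC_plus. ring. }
rewrite eP in c1. rewrite eM in a1.
destruct (sn_shift_sum_prod _ _ sn_jacobi k2_neq1 p p_not_pole sn_p_neq0 u b1 c1 a1 b3) as [hS hP].
rewrite <- eP, <- eM in hS, hP.
assert (hD : orbit_F v (S n) ^ 2 + gamma = gamma * (1 - k ^ 2 * sn p ^ 2 * sn u ^ 2)).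
{ unfold orbit_F. fold u. transitivity (A ^ 2 * sn u ^ 2 + gamma); [ring|]. rewrite A2.
  transitivity (gamma - k * (k * gamma * sn p ^ 2) * sn u ^ 2); [rewrite p_gamma|]; ring. }
unfold orbit_f. apply cayley_step with E0; auto.
- rewrite hD. apply Cmult_neq_0; [exact gamma_neq0|exact b3].
- rewrite hD, p_zeta. unfold orbit_F. fold u.
  transitivity (A * gamma * ((sn (orbit_pt v (S (S n))) + sn (orbit_pt v n)) *
    (1 - k ^ 2 * sn p ^ 2 * sn u ^ 2))); [ring|]. rewrite hS. ring.
- rewrite hD. unfold orbit_F. fold u.
  transitivity (A ^ 2 * gamma * (sn (orbit_pt v (S (S n))) * sn (orbit_pt v n) *
    (1 - k ^ 2 * sn p ^ 2 * sn u ^ 2))); [ring|]. rewrite hP.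
  transitivity (A ^ 2 * gamma * sn u ^ 2 - A ^ 2 * gamma * sn p ^ 2); [ring|].
  rewrite A2, p_gamma.
  transitivity (1 + gamma * (A ^ 2 * sn u ^ 2)); [rewrite A2|]; ring.
Qed.

Lemma orbit_f_initial (n : nat) (x : C) : x <> - (1) ->
  ~ is_pole sn (orbit_pt z0 n) -> A * sn (orbit_pt z0 n) = cayley_F c x ->
  Clim (near' z0) (fun v => orbit_f v n) x.
Proof.
intros hx hp hv. destruct (cayley_F_inv c x c_neq0 hx) as [h1 h2].
rewrite <- h2, <- hv. rewrite <- hv in h1.
assert (h : Clim (near' z0) (fun v => orbit_F v n) (A * sn (orbit_pt z0 n))).
{ apply Clim_mult; [apply Clim_const|]. apply Clim_near'.
  apply (Clim_near_shift sn z0 (p * RtoC (INR n))).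
  exact (sn_continuous _ _ sn_jacobi _ hp). }
apply Clim_div; [apply Clim_plus|apply Clim_minus|exact h1]; auto; apply Clim_const.
Qed.

Context (f0 f1 : C) (N : nat).
Notation G n := (qP2_f 1 t0 f0 f1 0 n).
Hypothesis G_neq0 : forall n, (n <= N)%nat -> G n <> 0.
Hypothesis G_t0 : forall n, (S (S n) <= N)%nat -> G (S n) + t0 <> 0.
Hypothesis initial_0 : Clim (near' z0) (fun v => orbit_f v 0) f0.
Hypothesis initial_1 : (1 <= N)%nat -> Clim (near' z0) (fun v => orbit_f v 1) f1.

Lemma orbit_f_lim (n : nat) :
  ((n <= N)%nat -> Clim (near' z0) (fun v => orbit_f v n) (G n)) /\
  ((S n <= N)%nat -> Clim (near' z0) (fun v => orbit_f v (S n)) (G (S n))).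
Proof.
induction n as [|n [IH1 IH2]]; [split; auto|]. split; [exact IH2|]. intro hn.
specialize (IH1 ltac:(lia)). specialize (IH2 ltac:(lia)).
pose proof (G_neq0 n ltac:(lia)) as hG0. pose proof (G_neq0 (S n) ltac:(lia)) as hG1.
pose proof (G_t0 n hn) as hG2.
rewrite qP2_f_SS, qP2_t_0.
assert (hg : Clim (near' z0) (fun v => orbit_f v (S n) + t0) (G (S n) + t0)).
{ apply Clim_plus; [exact IH2|apply Clim_const]. }
apply Clim_ext_near with (fun v => 1 * (1 + orbit_f v (S n) * t0) /
  (orbit_f v (S n) * (orbit_f v (S n) + t0)) / orbit_f v n).
- generalize (filter_and _ _ (orbit_step n) (filter_and _ _ (Clim_neq _ _ _ IH1 hG0)
    (filter_and _ _ (Clim_neq _ _ _ IH2 hG1) (Clim_neq _ _ _ hg hG2)))).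
  apply filter_imp. intros v [<- [h1 [h2 h3]]]. field. repeat split; assumption.
- apply Clim_div; [|exact IH1|exact hG0].
  apply Clim_div; [| |now apply Cmult_neq_0].
  + apply Clim_mult; [apply Clim_const|]. apply Clim_plus; [apply Clim_const|].
    apply Clim_mult; [exact IH2|apply Clim_const].
  + apply Clim_mult; assumption.
Qed.

Lemma orbit_F_cayley (n : nat) : near' z0 (fun v => orbit_F v n = cayley_F c (orbit_f v n)).
Proof.
generalize (orbit_generic n). apply filter_imp. refine (fun v : C => _). intros [_ [h _]].
unfold orbit_f, cayley_F. generalize dependent (orbit_F v n). intros X hX.
assert (e : (c + X) / (c - X) + 1 = 2 * c / (c - X)) by (field; exact hX).
rewrite e. field. split; [exact hX|exact c_neq0].
Qed.

Lemma limit_tends_to_sn (n : nat) (g : C -> C) : (n <= N)%nat ->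
  Clim (near' (RtoC 0)) g (G n) -> near' (RtoC 0) (fun eps => g eps <> - (1)) ->
  tends_to_sn (fun eps => cayley_F c (g eps)) A sn (z0 + p * RtoC (INR n)).
Proof.
intros hn hg hne. change (z0 + p * RtoC (INR n)) with (orbit_pt z0 n).
pose proof (proj1 (orbit_f_lim n) hn) as hl.
destruct (classic (G n = - (1))) as [hG|hG].
- split.
  + intro hp. exfalso.
    assert (h : Clim (near' z0) (fun v => orbit_F v n) (A * sn (orbit_pt z0 n))).
    { apply Clim_mult; [apply Clim_const|]. apply Clim_near'.
      apply (Clim_near_shift sn z0 (p * RtoC (INR n))).
      exact (sn_continuous _ _ sn_jacobi _ hp). }
    set (X := A * sn (orbit_pt z0 n)) in h. rewrite hG in hl.
    assert (e : - (1) * (c - X) = c + X).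
    { apply (@Clim_unique C (near' z0) _ (fun v => orbit_f v n * (c - orbit_F v n))).
      - apply Clim_mult; [exact hl|]. apply Clim_minus; [apply Clim_const|exact h].
      - apply Clim_ext_near with (fun v => c + orbit_F v n).
        + generalize (orbit_generic n). apply filter_imp. intros v [_ [h1 _]].
          unfold orbit_f. field. exact h1.
        + apply Clim_plus; [apply Clim_const|exact h]. }
    assert (e2 : 2 * c = 0).
    { transitivity (c + X - - (1) * (c - X)); [ring|]. rewrite e. ring. }
    apply Cmult_integral in e2. destruct e2 as [e2|e2]; [exact (C2_neq0 e2)|tauto].
  + intros _. rewrite hG in hg. now apply (cayley_infty c g).
- assert (h : Clim (near' z0) (fun v => sn (orbit_pt v n)) (cayley_F c (G n) / A)).
  { apply Clim_ext_near with (fun v => cayley_F c (orbit_f v n) / A).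
    - generalize (orbit_F_cayley n). apply filter_imp. intros v <-. unfold orbit_F.
      field. exact A_neq0.
    - apply Clim_div; [now apply Clim_cayley|apply Clim_const|exact A_neq0]. }
  destruct (not_pole_of_lim_shift _ _ sn_jacobi z0 (p * RtoC (INR n)) _ h) as [hp hv].
  split; [intros _|tauto].
  unfold orbit_pt. rewrite hv.
  replace (A * (cayley_F c (G n) / A)) with (cayley_F c (G n)) by (field; exact A_neq0).
  apply (Clim_filterlim (near' (RtoC 0))). now apply Clim_cayley.
Qed.

End Orbit.

Lemma Cmod_conj_inv (k : C) : Cmod k = 1%R -> / k = Cconj k.
Proof.
intro h. assert (hk : k <> 0) by (apply Cmod_gt_0; lra).
assert (e : k * Cconj k = 1).
{ rewrite <- Cmod2_conj, h. f_equal. ring. }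
transitivity (/ k * (k * Cconj k)); [rewrite e; ring|]. field. exact hk.
Qed.

Lemma modulus_unique (beta : C) : ~ (exists b : R, (-2 <= b <= 2)%R /\ beta = b) ->
  exists k : C, unique (fun k : C => (0 < Cmod k < 1)%R /\ k ^ 2 + beta * k + 1 = 0) k.
Proof.
intro hbeta.
assert (hroot : exists k, k ^ 2 + beta * k + 1 = 0).
{ destruct (C_sqrt_exists (beta ^ 2 - 4)) as [d hd]. exists ((- beta + d) / 2).
  transitivity ((d ^ 2 - (beta ^ 2 - 4)) / 4); [field|]. rewrite hd. unfold Cdiv. ring. }
assert (hn0 : forall k, k ^ 2 + beta * k + 1 = 0 -> k <> 0).
{ intros k h ->. apply C1_neq0. rewrite <- h. ring. }
assert (hn1 : forall k, k ^ 2 + beta * k + 1 = 0 -> Cmod k <> 1%R).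
{ intros k h h1. apply hbeta. exists (- (2 * Re k))%R.
  pose proof (re_le_Cmod k) as h2. rewrite h1 in h2. apply Rabs_le_between in h2.
  split; [lra|]. pose proof (hn0 k h) as hk.
  assert (e : beta = - (k + / k)).
  { apply C_sub_eq0. transitivity ((k ^ 2 + beta * k + 1) / k); [field; exact hk|].
    rewrite h. unfold Cdiv. ring. }
  rewrite e, (Cmod_conj_inv k h1). apply injective_projections; simpl; unfold Re; ring. }
assert (hinv : forall k, k ^ 2 + beta * k + 1 = 0 -> (/ k) ^ 2 + beta * / k + 1 = 0).
{ intros k h. pose proof (hn0 k h) as hk.
  transitivity ((k ^ 2 + beta * k + 1) / k ^ 2); [field; exact hk|]. rewrite h. unfold Cdiv. ring. }
assert (hex : exists k, (0 < Cmod k < 1)%R /\ k ^ 2 + beta * k + 1 = 0).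
{ destruct hroot as [k hk]. pose proof (hn0 k hk) as h0. pose proof (hn1 k hk) as h1.
  assert (h2 : (0 < Cmod k)%R) by now apply Cmod_gt_0.
  destruct (Rlt_dec (Cmod k) 1) as [h3|h3]; [now exists k|].
  exists (/ k). split; [|now apply hinv]. rewrite Cmod_inv by exact h0. split.
  - now apply Rinv_0_lt_compat.
  - rewrite <- Rinv_1. apply Rinv_lt_contravar; lra. }
destruct hex as [k [hk1 hk2]]. exists k. split; [now split|]. intros k' [hk1' hk2'].
assert (h : (k - k') * (1 - k * k') = 0).
{ transitivity (k' * - (k ^ 2 + beta * k + 1) + k * (k' ^ 2 + beta * k' + 1) - 0); [ring|].
  rewrite hk2, hk2'. ring. }
apply Cmult_integral in h. destruct h as [h|h]; [now apply C_sub_eq0|].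
exfalso. assert (e : Cmod (k * k') = 1%R).
{ replace (k * k') with (1 : C); [apply Cmod_1|]. now apply C_sub_eq0. }
rewrite Cmod_mult in e. nra.
Qed.

Theorem theorem2p7 (a t0 f0 f1 c : C) :
  let E0 := qP2_E a t0 f0 f1 in
  let gamma := qP2_gamma E0 t0 c in
  let zeta := qP2_zeta E0 t0 c in
  let beta := qP2_beta gamma zeta in
  let F := fun (n : nat) (eps : C) => cayley_F c (qP2_f a t0 f0 f1 eps n) in
  let modulus := fun k : C =>
    (0 < Cmod k < 1)%R /\ k ^ 2 + beta * k + 1 = 0 in
  a = 1 -> t0 <> 0 -> f0 <> 0 -> f1 <> 0 -> f0 <> - (1) ->
  E0 <> 2 + 4 * t0 -> E0 <> 2 - 4 * t0 ->
  c <> 0 -> c ^ 4 = (2 - E0 - 4 * t0) / (2 - E0 + 4 * t0) ->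
  gamma <> 0 ->
  ~ (exists b : R, (-2 <= b <= 2)%R /\ beta = b) ->
  exists k : C, unique modulus k /\
    forall (sn : C -> C), is_jacobi_sn k sn ->
    forall A : C, A ^ 2 = k ->
      (exists z0 : C, ~ is_pole sn z0 /\ A * sn z0 = cayley_F c f0) /\
      (forall z0 : C, ~ is_pole sn z0 -> A * sn z0 = cayley_F c f0 ->
        exists p : C, ~ is_pole sn p /\ k * sn p ^ 2 = - (1) / gamma /\
          forall N : nat, qP2_admissible a t0 f0 f1 N ->
          forall n : nat, (n <= N)%nat ->
            tends_to_sn (F n) A sn (z0 + p * RtoC (INR n))).
Proof.
intros E0 gamma zeta beta F modulus ha ht0 hf0 hf1 hf0' hEp hEm hc hc4 hgamma hbeta. subst a.
destruct (modulus_unique beta hbeta) as [k hk]. exists k. split; [exact hk|].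
destruct hk as [[hk1 hkb] _].
assert (hk0 : k <> 0) by (apply Cmod_gt_0; lra).
assert (hk2 : k ^ 2 <> 1).
{ intro e. apply (f_equal Cmod) in e. rewrite Cmod_pow, Cmod_1 in e. simpl in e. nra. }
assert (hL : 2 - E0 - 4 * t0 <> 0).
{ intro e. apply hEm. symmetry. apply C_sub_eq0. rewrite <- e. ring. }
assert (hL' : 2 - E0 + 4 * t0 <> 0).
{ intro e. apply hEp. symmetry. apply C_sub_eq0. rewrite <- e. ring. }
assert (hE2 : E0 <> - (2)).
{ intro e. apply hgamma. unfold gamma, qP2_gamma. rewrite e. unfold Cdiv. ring. }
intros sn hsn A hA.
assert (hA0 : A <> 0) by (intro e; apply hk0; rewrite <- hA, e; ring).
split.
{ destruct (sn_surjective _ _ hsn hk2 (cayley_F c f0 / A)) as [z0 [hz hv]]. exists z0.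
  split; [exact hz|]. rewrite hv. field. exact hA0. }
intros z0 hz0 hz0v.
destruct (C_sqrt_exists (- (1) / (k * gamma))) as [s hs].
set (m := - zeta / (2 * gamma)).
assert (hm : m ^ 2 = quartic k s).
{ assert (hz2 : zeta ^ 2 = 4 + 4 * gamma ^ 2 + 4 * gamma * (1 + k ^ 2) / k).
  { apply C_sub_eq0.
    transitivity (- (4 * gamma) * (k ^ 2 + beta * k + 1) / k).
    - unfold beta, qP2_beta. field. split; assumption.
    - rewrite hkb. unfold Cdiv. ring. }
  transitivity (zeta ^ 2 / (4 * gamma ^ 2)); [unfold m; field; exact hgamma|].
  rewrite hz2. unfold quartic. rewrite hs. field. split; assumption. }
destruct (sn_curve_surjective _ _ hsn hk0 hk2 s m hm) as [p1 [hp1 [hp1s hp1m]]].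
assert (hs0 : s <> 0).
{ intro e. apply C1_neq0. transitivity (- (k * gamma) * (- (1) / (k * gamma)));
    [field; split; assumption|]. rewrite <- hs, e. ring. }
assert (hp1s0 : sn p1 <> 0) by now rewrite hp1s.
(* both [p1] and [- p1] qualify; the sign is fixed by [f1] *)
assert (hp : exists p, ~ is_pole sn p /\ sn p ^ 2 = s ^ 2 /\ C_derive sn p = m /\
  (f1 <> - (1) -> ~ is_pole sn (z0 + p) /\ A * sn (z0 + p) = cayley_F c f1)).
{ destruct (classic (f1 = - (1))) as [hf1'|hf1'].
  { exists p1. repeat split; try tauto. now rewrite hp1s. }
  set (y1 := cayley_F c f1 / A).
  assert (hy1 : A * y1 = cayley_F c f1) by (unfold y1; field; exact hA0).
  pose proof (cayley_biquadratic E0 t0 c hL hL' hc hc4 f0 f1 hf0' hf1' hf0 hf1 eq_refl) as hB.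
  cbv zeta in hB. rewrite <- hz0v, <- hy1 in hB. fold gamma zeta in hB.
  assert (hmz : zeta = - (2) * gamma * m) by (unfold m; field; exact hgamma).
  assert (hgs : k * gamma * s ^ 2 = - (1)) by (rewrite hs; field; split; assumption).
  destruct (sn_shift_value _ _ hsn hk0 hk2 p1 hp1 hp1s0 z0 y1 hz0) as [[h1 h2]|[h1 h2]].
  - rewrite hp1s, hp1m.
    transitivity (- s ^ 2 * ((A * sn z0) ^ 2 * (A * y1) ^ 2 +
      gamma * ((A * sn z0) ^ 2 + (A * y1) ^ 2) + zeta * (A * sn z0) * (A * y1) + 1)).
    2: { rewrite hB. ring. }
    transitivity (- (A ^ 2 * gamma * s ^ 2) * (sn z0 ^ 2 + y1 ^ 2) - s ^ 2 -
       (A ^ 2) ^ 2 * s ^ 2 * sn z0 ^ 2 * y1 ^ 2 + (A ^ 2 * gamma * s ^ 2) * 2 * m * sn z0 * y1).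
    + rewrite hA, hgs. ring.
    + rewrite hmz. ring.
  - exists p1. repeat split; auto.
    + now rewrite hp1s.
    + now rewrite h2.
  - destruct (sn_odd _ _ hsn hk2 p1 hp1 hp1s0) as [o1 [o2 o3]]. exists (- p1).
    repeat split; auto.
    + rewrite o2, hp1s. ring.
    + now rewrite o3.
    + change (z0 + - p1) with (z0 - p1). now rewrite h2. }
destruct hp as [p [hp [hps [hpm hpf1]]]].
assert (hkgs : k * gamma * sn p ^ 2 = - (1)) by (rewrite hps, hs; field; split; assumption).
exists p. split; [exact hp|]. split; [rewrite hps, hs; field; split; assumption|].
intros N hN n hn.
assert (hmz : zeta = - (2) * gamma * C_derive sn p) by (rewrite hpm; unfold m; field; exact hgamma).
pose proof (limit_orbit t0 f0 f1 hE2 N hN) as hlim.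
destruct (admissible_near t0 f0 f1 N hN) as [m0 [M0 [hm0 hadm]]].
unfold F. apply (limit_tends_to_sn k sn hsn hk0 hk2 E0 t0 c A p z0 hL hL' hc hc4 hA hp hkgs hmz
  f0 f1 N) with (g := fun eps => qP2_f 1 t0 f0 f1 eps n).
- intros j hj. apply (limit_neq0 t0 f0 f1 N hN j hj). now apply hlim.
- intros j hj. now apply hlim.
- apply orbit_f_initial with k; auto; unfold orbit_pt; simpl;
    replace (z0 + p * 0) with z0 by ring; auto.
- intro h1N.
  assert (hf1' : f1 <> - (1)).
  { destruct (filter_ex _ hadm) as [eps he]. exact (proj2 (he 1%nat h1N)). }
  destruct (hpf1 hf1') as [h1 h2].
  apply orbit_f_initial with k; auto; unfold orbit_pt; simpl;
    replace (z0 + p * 1) with (z0 + p) by ring; auto.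
- exact hn.
- now apply hlim.
- generalize hadm. apply filter_imp. intros eps he. now apply he.
Qed.
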